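(* Let $\mathbf{X}$ be a finite-dimensional normed space, $P$ and $Q$ compact subsets of finite-dimensional spaces, $x_0\in\mathbf{X}$, and let $f:\mathbf{T}\times\mathbf{X}\times P\times Q\to\mathbf{X}$ satisfy: 1) $f$ is continuous; 2) for every compact $A\subset\mathbf{T}\times\mathbf{X}$ there is a summable function $L_A:\mathbf{T}\to\mathbb{R}$ such that $\|f(t,x_1,u,v)-f(t,x_2,u,v)\|\leqslant L_A(t)\|x_1-x_2\|$ for all $(t,x_1),(t,x_2)\in A$, $u\in P$, $v\in Q$; 3) there is a locally summable function $a:\mathbf{T}\to\mathbb{R}$ such that $\|f(t,x,u,v)\|\leqslant a(t)(1+\|x\|)$ for all $(t,x,u,v)\in\mathbf{T}\times\mathbf{X}\times P\times Q$. Let $M\subset\mathbf{T}\times\mathbf{X}$ be closed, and consider the game with the set of bundles $$\mathbf{V}=\{\varphi(\Pi_\nu(\mathbf{T}\times P\times Q)) : \nu\in\Pi(\mathbf{T}\times Q)\}$$ (the pair ''program mixed control / program relaxed control''). Then the value $C_M=\infty$ is precise if and only if it is rough.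
   Context: $\mathbf{T}=\{t\in\mathbb{R}: t\geqslant 0\}$; $\lambda$ is Lebesgue measure; $C(\mathbf{T},\mathbf{X})$ is the set of continuous maps $\mathbf{T}\to\mathbf{X}$. The underlying control system is $\dot{x}=f(t,x,u,v)$, $x(0)=x_0$, $u\in P$, $v\in Q$. Measures. $\Pi(\mathbf{T}\times Q)$ is the set of all regular Borel measures $\nu$ on $\mathbf{T}\times Q$ with $\nu(I\times Q)=\lambda(I)$ for every compact $I\subset\mathbf{T}$. $\Pi(\mathbf{T}\times P\times Q)$ is the set of all regular Borel measures $\eta$ on $\mathbf{T}\times P\times Q$ with $\eta(I\times P\times Q)=\lambda(I)$ for every compact $I\subset\mathbf{T}$. For $\nu\in\Pi(\mathbf{T}\times Q)$, $\Pi_\nu(\mathbf{T}\times P\times Q)$ is the set of all $\eta\in\Pi(\mathbf{T}\times P\times Q)$ compatible with $\nu$, i.e. such that $\eta(I\times P\times A)=\nu(I\times A)$ for all Borel $I\subset\mathbf{T}$, $A\subset Q$. Trajectories. For $\eta\in\Pi(\mathbf{T}\times P\times Q)$, $\varphi(\eta)\in C(\mathbf{T},\mathbf{X})$ is the (unique) solution of $$x(t)=x_0+\int_{[0,t]\times P\times Q}f(\tau,x(\tau),u,v)\,d\eta(\tau,u,v)\qquad\text{for all } t\in\mathbf{T}.$$ Game. For a closed set $N\subset\mathbf{T}\times\mathbf{X}$ and $x\in C(\mathbf{T},\mathbf{X})$ put $$c_N(x)=\inf\big(\{t\in\mathbf{T}: (t,x(t))\in N\}\cup\{+\infty\}\big),\qquad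 C_N=\sup_{\Phi\in\mathbf{V}}\inf_{x\in\Phi}c_N(x).$$ Precise: the value $C_M=\infty$ is called precise if there is $\Phi\in\mathbf{V}$ such that $(t,x(t))\notin M$ for all $x\in\Phi$ and all $t\in\mathbf{T}$ (which implies $C_M=\infty$). Rough: the value $C_M=\infty$ is called rough (with respect to $M$) if there is a closed set $\widetilde{M}\subset\mathbf{T}\times\mathbf{X}$ with $M\subset\operatorname{int}\widetilde{M}$ (interior in $\mathbf{T}\times\mathbf{X}$) such that $C_{\widetilde{M}}=\infty$. *)

(* Defs.v *)
From HB Require Import structures.
From mathcomp Require Import all_boot all_order all_algebra.
From mathcomp Require Import all_classical all_reals all_analysis.
Import Order.TTheory GRing.Theory Num.Theory.
Import numFieldNormedType.Exports.

Set Implicit Arguments.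
Unset Strict Implicit.
Unset Printing Implicit Defensive.

Local Open Scope classical_set_scope.
Local Open Scope ring_scope.

(* Finite-dimensional normed spaces: the norm is arbitrary and unrelated to any
   basis. *)
#[short(type="normedVectType")]
HB.structure Definition NormedVector (K : numFieldType) :=
  {V of NormedModule K V & Vector K V}.

Notation borel Z := (g_sigma_algebraType (@open Z)).

Section integral.
Context {d : measure_display} {T : measurableType d} {R : realType}.

(* Integral of a function with values in a finite-dimensional space, computed
   in coordinates; it does not depend on the basis.  As for [Rintegral], its
   value is only meaningful for integrable functions. *)
Definition vintegral (X : normedVectType R) (mu : {measure set T -> \bar R})
    (D : set T) (g : T -> X) : X :=
  \sum_(i < \dim {:X})
    (\int[mu]_(z in D) coord (vbasis {:X}) i (g z)) *: (vbasis {:X})`_i.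
End integral.

Definition regular_measure {R : realType} {Z : normedModType R}
    (mu : {measure set (borel Z) -> \bar R}) : Prop :=
  forall A : set (borel Z), measurable A ->
    mu A = ereal_inf [set mu O | O in [set O : set Z | open O /\ A `<=` O]] /\
    mu A = ereal_sup [set mu K | K in [set K : set Z | compact K /\ K `<=` A]].

Section game.
Context {R : realType} {X U V : normedVectType R}.

(* Elements of C(T, X) are functions on R continuous on [time]; their values at
   negative times are never used. *)
Definition time : set R := [set t | 0 <= t].

(* A Borel measure on the closed set T x Q (resp. T x P x Q) is encoded as a
   Borel measure on the ambient space that vanishes outside of this set.  As
   the set is closed, this changes neither the Borel subsets nor regularity. *)
Definition Pi_Q (Q : set V)
    (nu : {measure set (borel (R * V)%type) -> \bar R}) : Prop :=
  [/\ regular_measure nu,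
      nu (~` (time `*` Q)) = 0%E &
      forall I : set R, compact I -> I `<=` time ->
        nu (I `*` Q) = lebesgue_measure I].

Definition Pi_PQ (P : set U) (Q : set V)
    (eta : {measure set (borel (R * U * V)%type) -> \bar R}) : Prop :=
  [/\ regular_measure eta,
      eta (~` (time `*` P `*` Q)) = 0%E &
      forall I : set R, compact I -> I `<=` time ->
        eta (I `*` P `*` Q) = lebesgue_measure I].

Definition Pi_compat (P : set U) (Q : set V)
    (nu : {measure set (borel (R * V)%type) -> \bar R})
    (eta : {measure set (borel (R * U * V)%type) -> \bar R}) : Prop :=
  Pi_PQ P Q eta /\
  forall (I : set R) (A : set V),
    measurable I -> I `<=` time ->
    measurable (A : set (borel V)) -> A `<=` Q ->
    eta (I `*` P `*` A) = nu (I `*` A).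

(* The graph of phi: [trajectory f x0 P Q eta x] reads x = phi(eta). *)
Definition trajectory (f : R -> X -> U -> V -> X) (x0 : X)
    (P : set U) (Q : set V)
    (eta : {measure set (borel (R * U * V)%type) -> \bar R})
    (x : R -> X) : Prop :=
  {within time, continuous x} /\
  forall t, time t ->
    x t = x0 + vintegral eta (`[0, t] `*` P `*` Q)
                 (fun z => f z.1.1 (x z.1.1) z.1.2 z.2).

(* The set of bundles { phi(Pi_nu) | nu }. *)
Definition bundles (f : R -> X -> U -> V -> X) (x0 : X)
    (P : set U) (Q : set V) : set (set (R -> X)) :=
  [set [set x | exists2 eta, Pi_compat P Q nu eta &
                  trajectory f x0 P Q eta x]
     | nu in Pi_Q Q].

Definition hitting_time (N : set (R * X)) (x : R -> X) : \bar R :=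
  ereal_inf ([set t%:E | t in [set t | time t /\ N (t, x t)]]
             `|` [set +oo%E]).

Definition game_value (B : set (set (R -> X))) (N : set (R * X)) : \bar R :=
  ereal_sup [set ereal_inf [set hitting_time N x | x in Phi] | Phi in B].

Definition precise (B : set (set (R -> X))) (M : set (R * X)) : Prop :=
  exists2 Phi, B Phi &
    forall x, Phi x -> forall t, time t -> ~ M (t, x t).

(* The interior is taken in the subspace T x X. *)
Definition rough (B : set (set (R -> X))) (M : set (R * X)) : Prop :=
  exists Mt : set (R * X),
    [/\ closed Mt, Mt `<=` time `*` setT,
        M `<=` interior (Mt : set (subspace (time `*` [set: X]))) &
        game_value B Mt = +oo%E].

End game.

(* Integrability with respect to the completed Lebesgue measure, so that
   summable functions need only be Lebesgue measurable, not Borel. *)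
Definition summable_on {R : realType} (D : set R) (g : R -> R) : Prop :=
  (@completed_lebesgue_measure R).-integrable D (EFin \o g).

(* Main.v *)
Require Import Defs.
From HB Require Import structures.
From mathcomp Require Import all_boot all_order all_algebra finmap.
From mathcomp Require Import all_classical all_reals all_analysis.
From mathcomp Require Import measurable_realfun ring lra.
Import Order.TTheory GRing.Theory Num.Theory.
Import numFieldNormedType.Exports.
Local Open Scope classical_set_scope.
Local Open Scope ring_scope.

(** Call bundle of [nu] the set of trajectories of the controls [eta] compatible
    with [nu].  Both implications rest on the behaviour of bundles under weak
    convergence, that is convergence of the integrals of continuous functions
    over the slabs [0, t] x P x Q.  Limits are taken along an ultrafilter on
    [nat], so that every sequence in a compact set converges.

    Precise implies rough.  A limit of measures compatible with [nu] exists and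
    is compatible with [nu] ([Pi_compat_limit]), and trajectories depend
    continuously on the control, uniformly on bounded intervals of times
    ([trajectory_cvg]).  Hence the points (t, x t), for x in the bundle of [nu],
    form a closed set ([bundle_graph_closed]).  If the bundle avoids [M], then
    normality of R x X gives a closed neighbourhood of [M] which is disjoint
    from this closed set, and the value of the game for it is infinite.

    Rough implies precise.  Let Mt be the closed neighbourhood of [M].  For each
    n there is [nu_ n] whose bundle avoids Mt up to time n; let [nu] be a limit
    of the [nu_ n] ([Pi_Q_limit]).  If a trajectory of the bundle of [nu] met [M]
    at a time t, it would be in the interior of Mt at that time.  By
    [bundle_lower_limit] it is approximated at time t by trajectories of the
    bundles of the [nu_ n], which would meet Mt at time t for some n >= t.

    The main point is [bundle_lower_limit].  The conditional distribution of
    the first control given (t, v) under a measure [eta] compatible with [nu] is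
    only measurable in (t, v), so it cannot be combined with another [nu_ n].
    Averaging it over the cells of a partition of unity gives distributions
    carried by finitely many points u_j, with weights w_j (t, v) which are
    continuous.  The measures obtained in this way from [nu] approximate [eta]
    ([weights_approximation], [weights_dense]), and for fixed weights the measure
    obtained from [nu_ n] converges to the one obtained from [nu], because an
    integral for it is an integral for [nu_ n] of a continuous function
    ([average_control]). *)

Set Implicit Arguments.
Unset Strict Implicit.
Unset Printing Implicit Defensive.

(** * Finite-dimensional normed spaces *)

Section finite_dimension.
Context {R : realType}.

Lemma ultra_compact_cvg (T : topologicalType) (I : Type) (F : set_system I)
    (K : set T) (g : I -> T) : UltraFilter F -> compact K ->
  (forall i, K (g i)) -> exists2 p, K p & g @ F --> p.
Proof.
move=> UF cK Kg.
have [p [Kp clp]] : K `&` cluster (g @ F) !=set0.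
  by apply: cK; exact: (@filterE _ F _ _ Kg).
exists p => // B Bp; have [//|] := in_ultra_setVsetC (g @^-1` B) UF.
by move=> FnB; have [x []] := clp (~` B) B FnB Bp.
Qed.

Context {X : normedVectType R}.
Let n := \dim {:X}.
Let e := vbasis {:X}.

Let lincomb (v : 'rV[R]_n) : X := \sum_(i < n) v ord0 i *: e`_i.

Let lincomb_continuous : continuous lincomb.
Proof.
move=> v; rewrite /continuous_at /lincomb.
apply: (@cvg_big _ _ _ _ _ _ _ (nbhs v)); first exact: add_continuous.
by move=> i _; apply: cvgZr_tmp; exact: coord_continuous.
Qed.

Let lincombK (x : X) : lincomb (\row_i coord e i x) = x.
Proof.
rewrite [RHS](coord_vbasis (memvf x)).
by apply: eq_bigr => i _; rewrite mxE.
Qed.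

Let lincomb_eq0 v : lincomb v = 0 -> v = 0.
Proof.
move=> v0; have /freeP ef := basis_free (vbasisP {:X}).
by apply/rowP => i; rewrite mxE; apply: (ef (fun i => v ord0 i)).
Qed.

(** The norm is an arbitrary one, so its equivalence with the norm of
    coordinates comes from its minimum on the unit sphere of coordinates. *)
Lemma coord_bounded : exists2 C : R, 0 < C &
  forall i x, `|coord e i x| <= C * `|x|.
Proof.
have lincombZ a v : lincomb (a *: v) = a *: lincomb v.
  by rewrite /lincomb scaler_sumr; apply: eq_bigr => i _; rewrite mxE scalerA.
have [m m0 mP] : exists2 m : R, 0 < m & forall v, m * `|v| <= `|lincomb v|.
  pose S := [set v : 'rV[R]_n | `|v| = 1].
  have S_normalize v : v != 0 -> S (`|v|^-1 *: v).
    move=> v0; rewrite /S/= normrZ normfV normr_id mulVf//.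
    by rewrite normr_eq0.
  have [S0|/set0P/negP/negPn/eqP S0] := pselect (S !=set0); last first.
    exists 1 => // v; have [->|v0] := eqVneq v 0; first by rewrite normr0 mulr0.
    by have := S_normalize _ v0; rewrite S0.
  have cS : compact S.
    apply: bounded_closed_compact.
      exists 1; split => // t t1 v; rewrite /S/= => ->; exact: ltW.
    rewrite (_ : S = (fun v => `|v|) @^-1` [set 1]); last by [].
    apply: closed_comp; last exact: closed_eq.
    by move=> v _; exact: norm_continuous.
  have [v0 v0S v0min] := @compact_EVT_min _ R (fun v => `|lincomb v|) S S0 cS
    (continuous_subspaceT (fun v => continuous_comp (@lincomb_continuous v)
      (@norm_continuous _ _ _))).
  exists `|lincomb v0|.
    rewrite normr_gt0; apply/eqP => /lincomb_eq0 v00.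
    by move: v0S; rewrite inE /S/= v00 normr0 => /esym/eqP; rewrite oner_eq0.
  move=> v; have [->|v_neq0] := eqVneq v 0; first by rewrite normr0 mulr0.
  have := v0min _ (mem_set (S_normalize _ v_neq0)).
  rewrite lincombZ normrZ normfV normr_id.
  by rewrite mulrC ler_pdivlMr ?normr_gt0.
exists m^-1; first by rewrite invr_gt0.
move=> i x; rewrite mulrC ler_pdivlMr// mulrC.
rewrite -{2}(lincombK x); apply: le_trans (mP _); rewrite ler_pM2l//.
rewrite [leRHS]/Num.norm /= mx_normrE; apply/bigmax_geP; right => /=.
by exists (ord0, i) => //=; rewrite mxE.
Qed.

Lemma coord_continuous_vect i : continuous (coord e i : X -> R^o).
Proof.
have [C C0 coordC] := coord_bounded.
apply: bounded_linear_continuous; apply/linear_boundedP.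
by exists C; split; [exact: num_real|move=> r Cr x]; apply: (le_trans (coordC _ _)); rewrite ler_wpM2r// ltW.
Qed.

Lemma closed_ball0_compact (B : R) : compact [set x : X | `|x| <= B].
Proof.
have [C C0 coordC] := coord_bounded.
have cimg : compact (lincomb @` [set v : 'rV[R]_n | forall i, v ord0 i \in `[- (C * B), C * B]]).
  apply: continuous_compact; first exact/continuous_subspaceT/lincomb_continuous.
  apply: (@rV_compact _ _ (fun=> `[- (C * B), C * B]%classic)) => _.
  exact: segment_compact.
apply: (subclosed_compact _ cimg).
- rewrite (_ : mkset _ = (fun x : X => `|x|) @^-1` [set t | t <= B]); last by [].
  by apply: closed_comp => [x _|]; [exact: norm_continuous|exact: closed_le].
- move=> x xB; exists (\row_i coord e i x) => // i; rewrite mxE in_itv/= -ler_norml.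
  by apply: le_trans (coordC _ _) _; rewrite ler_pM2l.
Qed.

End finite_dimension.

(** * Ultralimits of Borel measures *)

Section borel_sets.
Context {R : realType} {Z : normedModType R}.

Lemma borel_open (O : set Z) : open O -> measurable (O : set (borel Z)).
Proof. exact: sub_sigma_algebra. Qed.

Lemma borel_closed (C : set Z) : closed C -> measurable (C : set (borel Z)).
Proof.
move=> cC; rewrite -(setCK C); apply: (@measurableC _ (borel Z)).
by apply: borel_open; exact: closed_openC.
Qed.

Lemma borel_compact (K : set Z) : compact K -> measurable (K : set (borel Z)).
Proof. by move=> cK; apply: borel_closed; exact: (compact_closed (@norm_hausdorff _ Z) cK). Qed.

End borel_sets.

Section weak_limit.
Context {R : realType} {Z : normedModType R} {F : set_system nat}
  {UF : UltraFilter F}.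
Variable m : nat -> {measure set (borel Z) -> \bar R}.
Hypothesis mK : forall K : set Z, compact K -> exists B : R, forall n, (m n K <= B%:E)%E.
Local Open Scope ereal_scope.

(* The limits of the masses of compact sets form a content, from which a
   measure is built as in the Riesz representation theorem: inner limits on
   open sets, then an outer measure for which open sets are Caratheodory
   measurable. *)
Let ell (K : set Z) : R := lim (fine (m n K) @[n --> F]).

Let mK_fin K n : compact K -> m n K \is a fin_num.
Proof.
move=> /mK[B /(_ n) mB]; rewrite ge0_fin_numE//.
exact: le_lt_trans mB (ltry _).
Qed.

Let cvg_ell K : compact K -> fine (m n K) @[n --> F] --> ell K.
Proof.
move=> cK; have [B mB] := mK cK.
have [p _ pP] : exists2 p : R, `[0%R, B]%classic p & fine (m n K) @[n --> F] --> p.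
  apply: ultra_compact_cvg; first exact: segment_compact.
  move=> n /=; rewrite in_itv/= fine_ge0//= -lee_fin fineK//.
  exact: mK_fin.
by rewrite /ell (cvg_lim _ pP).
Qed.

Let ell0 : ell set0 = 0%R.
Proof.
rewrite /ell (_ : (fun n => _) = fun=> 0%R); first exact: lim_cst.
by apply/funext => n; rewrite measure0.
Qed.

Let ellU K K' : compact K -> compact K' -> (ell (K `|` K') <= ell K + ell K')%R.
Proof.
move=> cK cK'.
have cU : compact (K `|` K') by exact: compactU.
have cD : (fine (m n K) + fine (m n K'))%R @[n --> F] --> (ell K + ell K')%R.
  exact: cvgD (cvg_ell cK) (cvg_ell cK').
apply: (ler_cvg_to (cvg_ell cU) cD).
apply: nearW => n; rewrite -fineD; [|exact: mK_fin..].
apply: fine_le; [exact: mK_fin|by rewrite fin_numD !mK_fin|].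
by apply: measureU2; exact: borel_compact.
Qed.

Let ell_disjU K K' : compact K -> compact K' -> K `&` K' = set0 ->
  ell (K `|` K') = (ell K + ell K')%R.
Proof.
move=> cK cK' KK'; apply: cvg_lim => //.
rewrite (_ : (fun n => _) = (fun n => fine (m n K) + fine (m n K')))%R.
  exact: cvgD (cvg_ell cK) (cvg_ell cK').
apply/funext => n; rewrite measureU//; [|exact: borel_compact..].
by rewrite fineD// mK_fin.
Qed.

Let ell_bigU (K : nat -> set Z) n : (forall i, compact (K i)) ->
  (ell (\big[setU/set0]_(i < n) K i) <= \sum_(i < n) ell (K i))%R.
Proof.
move=> cK; elim: n => [|n IH]; first by rewrite !big_ord0 ell0.
rewrite !big_ord_recr/=; apply: le_trans (ellU _ _) _ => //.
  by apply: bigsetU_compact.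
by rewrite lerD2r.
Qed.

Let lam (O : set Z) : \bar R :=
  ereal_sup [set (ell K)%:E | K in [set K | compact K /\ K `<=` O]].

Let lam_ge0 O : 0 <= lam O.
Proof.
apply: ereal_sup_ubound; exists set0; last by rewrite ell0.
by split; [exact: compact0|exact: sub0set].
Qed.

Let le_lam O O' : O `<=` O' -> lam O <= lam O'.
Proof.
move=> OO'; apply: ereal_sup_le => _ [K [cK KO] <-]; exists K => //.
by split => //; exact: subset_trans OO'.
Qed.

Let lam0 : lam set0 = 0.
Proof.
apply/eqP; rewrite eq_le lam_ge0 andbT; apply: ge_ereal_sup => _ [K [_ +] <-].
by rewrite subset0 => ->; rewrite ell0.
Qed.

(* A compact set covered by the O i is cut into compact pieces L i of points
   whose 1/(n+1)-ball lies in O i. *)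
Let lam_bigcup (O : nat -> set Z) : (forall i, open (O i)) ->
  lam (\bigcup_i O i) <= \sum_(i <oo) lam (O i).
Proof.
move=> oO; apply: ge_ereal_sup => _ [K [cK KO] <-].
have [n Kn] : exists n, K `<=` [set x | exists2 i, (i < n)%N &
    forall y, (`|x - y| < n.+1%:R^-1)%R -> O i y].
  have /compact_near_coveringP/(_ nat \oo (fun n x => exists2 i, (i < n)%N &
    forall y, (`|x - y| < n.+1%:R^-1)%R -> O i y) _) := cK.
  case=> [x /KO[i _ Oix]|n _ /(_ n (leqnn n))]; last by exists n.
  have /nbhs_ballP[r /= r0 xrO] : nbhs x (O i) by exact: open_nbhs_nbhs.
  have r20 : (0 < r / 2)%R by rewrite divr_gt0.
  near=> x' n => /=; exists i; first by near: n; exact: nbhs_infty_gt.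
  have xx' : (`|x - x'| < r / 2)%R.
    have : ball x (r / 2) x' by near: x'; exact: nbhsx_ballx.
    by rewrite -ball_normE.
  have nr : (n.+1%:R^-1 < r / 2)%R.
    by near: n; exact: (near_infty_natSinv_lt (PosNum r20)).
  move=> y x'y; apply: xrO; rewrite -ball_normE/=.
  rewrite (le_lt_trans (ler_distD x' _ _))// (splitr r) ltrD//.
  exact: lt_trans nr.
pose L i := K `&` [set x | forall y, (`|x - y| < n.+1%:R^-1)%R -> O i y].
have cL i : compact (L i).
  apply: compact_closedI => //; rewrite -openC.
  rewrite (_ : ~` _ = \bigcup_(y in ~` O i) ball y n.+1%:R^-1).
    by apply: bigcup_open => y _; exact: ball_open.
  rewrite eqEsubset; split => [x /= /existsNP[y /not_implyP[xy Oy]]|x [y Oy]].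
    by exists y => //; rewrite -ball_normE/= distrC.
  by rewrite -ball_normE/= distrC => xy /(_ y xy).
have KL : K = \big[setU/set0]_(i < n) L i.
  rewrite -bigcup_mkord eqEsubset; split => [x Kx|x [i _ []]//].
  by have [i ni Oi] := Kn _ Kx; exists i.
rewrite KL; apply: le_trans (nneseries_lim_ge n _); last by [].
rewrite big_mkord; apply: (@le_trans _ _ (\sum_(i < n) ell (L i))%R%:E).
  by rewrite lee_fin; exact: ell_bigU.
rewrite -sumEFin; apply: lee_sum => i _; apply: ereal_sup_ubound.
exists (L i) => //; split => // x [_].
by apply; rewrite subrr normr0.
Unshelve. all: by end_near. Qed.

Let mu (A : set Z) : \bar R :=
  ereal_inf [set lam O | O in [set O | open O /\ A `<=` O]].

Let mu_open O : open O -> mu O = lam O.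
Proof.
move=> oO; apply/eqP; rewrite eq_le; apply/andP; split.
  by apply: ereal_inf_lbound; exists O => //; split.
by apply: le_ereal_inf_tmp => _ [W [_ OW] <-]; exact: le_lam.
Qed.

Let mu0 : mu set0 = 0.
Proof. by rewrite mu_open ?lam0//; exact: open0. Qed.

Let mu_ge0 A : 0 <= mu A.
Proof. by apply: le_ereal_inf_tmp => _ [W _ <-]. Qed.

Let le_mu : {homo mu : A B / A `<=` B >-> A <= B}.
Proof.
move=> A B AB; apply: ereal_inf_le_tmp => _ [W [oW BW] <-]; exists W => //.
by split => //; exact: subset_trans BW.
Qed.

Let mu_sigma_subadditive : sigma_subadditive mu.
Proof.
move=> A; apply/lee_addgt0Pr => e e0.
have [W AW] : {W : nat -> set Z & forall i, [/\ open (W i), A i `<=` W i &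
    lam (W i) <= mu (A i) + (e / (2 ^ i.+1)%:R)%:E]}.
  apply: (@choice _ _ (fun i O => [/\ open O, A i `<=` O &
    lam O <= mu (A i) + (e / (2 ^ i.+1)%:R)%:E])) => i.
  have ei0 : (0 < e / (2 ^ i.+1)%:R)%R by rewrite divr_gt0// ltr0n expn_gt0.
  have [muoo|muoo] := eqVneq (mu (A i)) +oo.
    by exists setT; split; [exact: openT|by []|rewrite muoo addye// leey].
  have mufin : mu (A i) \is a fin_num by rewrite ge0_fin_numE// lt_neqAle muoo leey.
  have [_ [W [oW AW] <-] lamW] := lb_ereal_inf_adherent ei0 mufin.
  by exists W; split => //; exact: ltW.
apply: (@le_trans _ _ (\sum_(i <oo) (mu (A i) + (e / (2 ^ i.+1)%:R)%:E))).
  apply: (@le_trans _ _ (lam (\bigcup_i W i))).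
    apply: ereal_inf_lbound; exists (\bigcup_i W i) => //; split.
      by apply: bigcup_open => i _; have [] := AW i.
    by apply: subset_bigcup => i _; have [] := AW i.
  apply: le_trans (lam_bigcup _) _; first by move=> i; have [] := AW i.
  by apply: lee_nneseries => // i; have [_ _ +] := AW i.
exact: (epsilon_trick xpredT (fun i => mu_ge0 (A i)) (ltW e0)).
Qed.

HB.instance Definition _ := isOuterMeasure.Build R Z mu mu0 mu_ge0 le_mu
  mu_sigma_subadditive.

Let mu_caratheodory_open (G : set Z) : open G -> caratheodory_measurable mu G.
Proof.
move=> oG; apply: le_caratheodory_measurable => A.
apply: le_ereal_inf_tmp => _ [W [oW AW] <-].
apply: (@le_trans _ _ (lam (W `&` G) + mu (A `&` ~` G))).
  rewrite leeD2r// -mu_open; last exact: openI.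
  by apply: le_mu; exact: setSI.
have [->|Woo] := eqVneq (lam W) +oo; first exact: leey.
have Wfin : lam W \is a fin_num by rewrite ge0_fin_numE// lt_neqAle Woo leey.
have AGfin : mu (A `&` ~` G) \is a fin_num.
  rewrite ge0_fin_numE// (@le_lt_trans _ _ (lam W))// ?ltey//.
  by rewrite -mu_open//; apply: le_mu => x [/AW].
rewrite -leeBrDr//; apply: ge_ereal_sup => _ [K [cK KWG] <-].
rewrite leeBrDr// addeC -leeBrDr//.
have KG : K `<=` G by move=> x /KWG[].
have oWK : open (W `\` K).
  by apply: openI => //; apply: closed_openC; exact: (compact_closed (@norm_hausdorff _ Z)).
apply: (@le_trans _ _ (lam (W `\` K))).
  rewrite -mu_open//; apply: le_mu => x [Ax Gx]; split; first exact: AW.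
  by move/KG.
apply: ge_ereal_sup => _ [L [cL LWK] <-]; rewrite leeBrDr//.
rewrite -EFinD -ell_disjU//; last first.
  by rewrite -subset0 => x [/LWK[_ Kx] /Kx].
apply: ereal_sup_ubound; exists (L `|` K) => //; split; first exact: compactU.
by move=> x [/LWK[]|/KWG[]].
Qed.

Let measurable_caratheodory (A : set (borel Z)) : measurable A ->
  caratheodory_measurable mu A.
Proof.
move: A; apply: smallest_sub; last by move=> G; exact: mu_caratheodory_open.
split.
- exact: caratheodory_measurable_set0.
- by move=> A; rewrite setTD; exact: caratheodory_measurable_setC.
- by move=> A mA; exact: caratheodory_measurable_bigcup.
Qed.

Let borel_measure (A : set (borel Z)) := mu A.

Let borel_measure_sigma_additive : semi_sigma_additive borel_measure.
Proof.
move=> A mA tA mUA.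
apply: (@caratheodory_measure_sigma_additive _ _ mu) => [i| |].
- exact: measurable_caratheodory.
- exact: tA.
- exact: measurable_caratheodory.
Qed.

HB.instance Definition _ := isMeasure.Build _ (borel Z) R borel_measure
  mu0 (fun A => mu_ge0 A) borel_measure_sigma_additive.

(** In the limit, mass can only increase on compact sets and decrease on open
    sets; as the mass of an open set may be infinite, the latter is stated
    through a uniform bound c. *)
Lemma weak_limit_measure : exists nu : {measure set (borel Z) -> \bar R},
  [/\ forall A : set (borel Z), measurable A ->
        nu A = ereal_inf [set nu O | O in [set O : set Z | open O /\ A `<=` O]],
      forall K : set Z, compact K ->
        exists2 l : R, fine (m n K) @[n --> F] --> l & l%:E <= nu K &
      forall (O : set Z) (c : \bar R), open O -> (forall n, m n O <= c) ->
        nu O <= c].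
Proof.
exists borel_measure; rewrite /borel_measure; split.
- move=> A _; rewrite {1}/mu; congr ereal_inf; rewrite eqEsubset.
  by split=> _ [W [oW AW] <-]; exists W => //; [exact: mu_open|exact/esym/mu_open].
- move=> K cK; exists (ell K); first exact: cvg_ell.
  apply: le_ereal_inf_tmp => _ [W [oW KW] <-].
  by apply: ereal_sup_ubound; exists K => //; split.
- move=> W c oW mc; apply: (@le_trans _ _ (mu W)); first by [].
  rewrite mu_open//; apply: ge_ereal_sup => _ [K [cK KW] <-].
  have mKc n : m n K <= c.
    apply: le_trans (mc n); apply: le_measure => //; rewrite inE.
      exact: borel_compact.
    exact: borel_open.
  case: c mc mKc => [c| |] _ mKc; last 2 first.
  + exact: leey.
  + by have := mKc 0%N; rewrite leNgt (lt_le_trans ltNy0)// measure_ge0.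
  rewrite lee_fin; apply: (limr_le (cvgP _ (cvg_ell cK))).
  by apply: nearW => n; rewrite -lee_fin fineK// mK_fin.
Qed.

End weak_limit.

(** * Integrals of continuous functions on compact sets *)

Section Rintegral_extra.
Context {d : measure_display} {T : measurableType d} {R : realType}.
Implicit Types (mu : {measure set T -> \bar R}) (D A : set T).

Lemma le_integrable_bounded mu D (g : T -> R) (C : R) : measurable D ->
  (mu D < +oo)%E -> measurable_fun D g -> (forall z, D z -> `|g z| <= C) ->
  mu.-integrable D (EFin \o g).
Proof.
move=> mD Doo mg gC; apply: measurable_bounded_integrable => //.
exists C; split; first exact: num_real.
by move=> r Cr z Dz; apply: (le_trans (gC _ Dz)); exact: ltW.
Qed.

Lemma integrable_addR mu D (f g : T -> R) : measurable D ->
  mu.-integrable D (EFin \o f) -> mu.-integrable D (EFin \o g) ->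
  mu.-integrable D (EFin \o (fun z => f z + g z)).
Proof. by move=> mD fi gi; apply: eq_integrable (integrableD mD fi gi). Qed.

Lemma integrable_scaleR mu D (f : T -> R) (r : R) : measurable D ->
  mu.-integrable D (EFin \o f) -> mu.-integrable D (EFin \o (fun z => r * f z)).
Proof. by move=> mD fi; apply: eq_integrable (integrableZl mD r fi). Qed.

Lemma Rintegral_sum mu D (I : Type) (s : seq I) (h : I -> T -> R) :
  measurable D -> (forall i, mu.-integrable D (EFin \o h i)) ->
  \int[mu]_(z in D) (\sum_(i <- s) h i z) = \sum_(i <- s) \int[mu]_(z in D) h i z.
Proof.
move=> mD ih; elim: s => [|i s IH].
  rewrite big_nil; under eq_Rintegral do rewrite big_nil.
  by rewrite Rintegral_cst// mul0r.
rewrite big_cons -IH; under eq_Rintegral do rewrite big_cons.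
rewrite RintegralD//.
rewrite (_ : EFin \o _ = fun z => (\sum_(j <- s) (EFin \o h j) z)%E).
  exact: integrable_sum.
by apply/funext => z /=; rewrite sumEFin.
Qed.

Lemma integrable_Rsum mu D (I : Type) (s : seq I) (h : I -> T -> R) :
  measurable D -> (forall i, mu.-integrable D (EFin \o h i)) ->
  mu.-integrable D (EFin \o (fun z => \sum_(i <- s) h i z)).
Proof.
move=> mD ih; rewrite (_ : EFin \o _ = fun z => (\sum_(j <- s) (EFin \o h j) z)%E).
  exact: integrable_sum.
by apply/funext => z /=; rewrite sumEFin.
Qed.

Lemma Rintegral_indic mu D A : measurable D -> measurable A ->
  \int[mu]_(z in D) (\1_A z : R) = fine (mu (A `&` D)).
Proof. by move=> mD mA; rewrite /Rintegral integral_indic. Qed.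

End Rintegral_extra.

Section within_continuous.
Context {R : realType} {Z : normedModType R}.
Implicit Types (D : set Z) (g : Z -> R).

Lemma within_continuous_measurable D g : closed D ->
  {within D, continuous g} -> measurable_fun (D : set (borel Z)) (g : borel Z -> R).
Proof.
move=> cD /continuousP cg.
apply: (measurability _ (RGenOpens.measurableE R)) => _ [_ [a [b ->] <-]].
have /open_subspaceP[V oV VD] : open (g @^-1` `]a, b[ : set (subspace D)).
  exact/cg/interval_open.
rewrite setIC -VD; apply: measurableI; first exact: borel_open.
exact: borel_closed.
Qed.

Lemma within_continuous_bounded D g : compact D ->
  {within D, continuous g} -> exists2 C : R, 0 < C & forall z, D z -> `|g z| <= C.
Proof.
move=> cD cg; have /compact_bounded [M [Mr gM]] := continuous_compact cg cD.
exists (`|M| + 1) => [|z Dz]; first by rewrite ltr_wpDl.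
by apply: gM; [rewrite ltr_pwDr// ler_norm|exists z].
Qed.

Lemma within_continuous_integrable (mu : {measure set (borel Z) -> \bar R}) D g :
  compact D -> (mu D < +oo)%E -> {within D, continuous g} ->
  mu.-integrable D (EFin \o (g : borel Z -> R)).
Proof.
move=> cD Doo cg; have [C _ gC] := within_continuous_bounded cD cg.
have clD : closed D by exact: (compact_closed (@norm_hausdorff _ Z)).
apply: (le_integrable_bounded _ Doo _ gC); first exact: borel_closed.
exact: within_continuous_measurable.
Qed.

Lemma within_continuous_ge D g (c : R) : compact D -> {within D, continuous g} ->
  compact (D `&` [set z | c <= g z]).
Proof.
move=> cD cg.
have clD : closed D by exact: (compact_closed (@norm_hausdorff _ Z)).
apply: (subclosed_compact _ cD); last by move=> x [].
have : closed (g @^-1` [set y | c <= y] : set (subspace D)).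
  by move/continuous_closedP : cg; apply; exact: closed_ge.
by move=> /closed_subspaceP[V cV VD]; rewrite setIC -VD; exact: closedI.
Qed.

End within_continuous.

Lemma floor_sum (R : realType) (N : nat) (y : R) : 0 <= y <= N%:R ->
  \sum_(j < N) (j.+1%:R <= y)%R%:R <= y <= \sum_(j < N) (j.+1%:R <= y)%R%:R + 1.
Proof.
move=> /andP[y0]; elim: N => [|N IH] yN.
  by rewrite big_ord0; apply/andP; split => //; rewrite add0r (le_trans yN).
rewrite big_ord_recr/=; have [yN'|Ny] := leP y N%:R.
  have -> : (N.+1%:R <= y) = false.
    by apply/negbTE; rewrite -ltNge (le_lt_trans yN')// ltr_nat.
  by rewrite addr0; exact: IH.
have -> : \sum_(j < N) (j.+1%:R <= y)%R%:R = N%:R :> R.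
  rewrite (eq_bigr (fun=> 1)) ?sumr_const ?card_ord// => j _.
  by rewrite (le_trans _ (ltW Ny))// ler_nat.
rewrite -natr1 in yN *; case: (leP (N%:R + 1) y) => h /=; rewrite ?addr0; apply/andP; split; lra.
Qed.

(** On a compact set D of constant mass, upper semicontinuity on the compact
    subsets of D suffices for the convergence of integrals: by the layer-cake
    formula it bounds the limit of the integrals of g from above, and the same
    bound for 1 - g is the converse one. *)
Section portmanteau.
Context {R : realType} {Z : normedModType R} {F : set_system nat}
  {UF : UltraFilter F}.
Variables (m : nat -> {measure set (borel Z) -> \bar R})
  (mu : {measure set (borel Z) -> \bar R}) (D : set Z) (c : R).
Hypothesis cD : compact D.
Hypothesis usc : forall K : set Z, compact K -> K `<=` D ->
  exists2 l : R, fine (m n K) @[n --> F] --> l & (l%:E <= mu K)%E.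
Hypothesis mD : forall n, m n D = c%:E.
Hypothesis muD : mu D = c%:E.

Let mu_fin (nu : {measure set (borel Z) -> \bar R}) K : nu D = c%:E -> compact K ->
  K `<=` D -> nu K \is a fin_num.
Proof.
move=> nuD cK KD; rewrite ge0_fin_numE// (@le_lt_trans _ _ (nu D))//.
  by apply: le_measure => //; rewrite inE; exact: borel_compact.
by rewrite nuD ltry.
Qed.

(* The number of levels j+1 <= N g, for j < N, is the integer part of N g.  The
   superlevel sets are compact, so that upper semicontinuity applies to them. *)
Let layer (g : Z -> R) (N : nat) : {within D, continuous g} ->
  (forall z, D z -> 0 <= g z <= 1) ->
  forall nu : {measure set (borel Z) -> \bar R}, nu D = c%:E ->
  \sum_(j < N) fine (nu (D `&` [set z | j.+1%:R <= N%:R * g z]))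
    <= N%:R * \int[nu]_(z in D) g z
    <= \sum_(j < N) fine (nu (D `&` [set z | j.+1%:R <= N%:R * g z])) + c.
Proof.
move=> cg g01 nu nuD.
have mbD : measurable (D : set (borel Z)) by exact: borel_compact.
have Doo : (nu D < +oo)%E by rewrite nuD ltry.
have cNg : {within D, continuous (fun z => N%:R * g z)}.
  by move=> z; apply: cvgM; [exact: cvg_cst|exact: cg].
pose A j := D `&` [set z | j.+1%:R <= N%:R * g z].
have mA j : measurable (A j : set (borel Z)).
  by apply: borel_compact; exact: within_continuous_ge.
have iA (j : 'I_N) : nu.-integrable D (EFin \o (\1_(A j) : borel Z -> R)).
  apply: (@le_integrable_bounded _ _ _ _ _ _ 1) => //.
  by move=> z _; rewrite indicE; case: (_ \in _); rewrite ?normr1 ?normr0.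
have iS := integrable_Rsum (index_enum 'I_N) mbD iA.
have iNg := within_continuous_integrable cD Doo cNg.
have -> : \sum_(j < N) fine (nu (A j)) = \int[nu]_(z in D) (\sum_(j < N) \1_(A j) z).
  rewrite Rintegral_sum//; apply: eq_bigr => j _.
  rewrite Rintegral_indic//; congr (fine (nu _)).
  by rewrite setIidl// => z [].
have -> : N%:R * \int[nu]_(z in D) g z = \int[nu]_(z in D) (N%:R * g z).
  by rewrite RintegralZl//; exact: within_continuous_integrable.
have floorA z : D z -> \sum_(j < N) \1_(A j) z <= N%:R * g z <= \sum_(j < N) \1_(A j) z + 1.
  move=> Dz; have /andP[g0 g1] := g01 _ Dz.
  have -> : \sum_(j < N) \1_(A j) z = \sum_(j < N) (j.+1%:R <= N%:R * g z)%R%:R :> R.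
    apply: eq_bigr => j _; rewrite indicE; congr (_%:R); congr nat_of_bool.
    by apply/idP/idP => [/set_mem[]//|h]; apply/mem_set; split.
  apply: floor_sum; rewrite mulr_ge0//=.
  by rewrite ler_piMr.
apply/andP; split.
  by apply: le_Rintegral => // z /floorA/andP[].
have i1 : nu.-integrable D (EFin \o (fun=> 1 : R)).
  by apply: (@le_integrable_bounded _ _ _ _ _ _ 1) => // z _; rewrite normr1.
have -> : c = \int[nu]_(z in D) 1.
  by rewrite Rintegral_cst// mul1r nuD.
rewrite -RintegralD//; apply: le_Rintegral => //.
  exact: integrable_addR.
by move=> z /floorA/andP[].
Qed.

Let limit_le (g : Z -> R) (l : R) : {within D, continuous g} ->
  (forall z, D z -> 0 <= g z <= 1) ->
  \int[m n]_(z in D) g z @[n --> F] --> l -> l <= \int[mu]_(z in D) g z.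
Proof.
move=> cg g01 gl; apply/ler_addgt0Pr => e e0.
(* The layer-cake sum is off by at most the mass c, to be compared with N e. *)
pose N := (Num.truncn (c / e)).+1.
have c0 : 0 <= c by rewrite -lee_fin -muD.
have ceN : c <= N%:R * e by rewrite -ler_pdivrMr// ltW// truncnS_gt.
have N0 : 0 < N%:R :> R by rewrite ltr0n.
rewrite -(ler_pM2l N0) mulrDr; apply: (@le_trans _ _ (N%:R * \int[mu]_(z in D) g z + c)); last by rewrite lerD2l.
have := layer N cg g01.
set A := fun j => D `&` [set z | j.+1%:R <= N%:R * g z] => layerN.
have cA j : compact (A j).
  apply: within_continuous_ge => // z; apply: cvgM; [exact: cvg_cst|exact: cg].
have AD j : A j `<=` D by move=> z [].
have /choice[L mL] : forall j, exists l : R,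
    fine (m n (A j)) @[n --> F] --> l /\ (l%:E <= mu (A j))%E.
  by move=> j; have [a ? ?] := usc (cA j) (AD j); exists a.
apply: (@le_trans _ _ (\sum_(j < N) L j + c)).
  have cvgL : \sum_(j < N) fine (m n (A j)) + c @[n --> F] --> \sum_(j < N) L j + c.
    apply: cvgD; last exact: cvg_cst.
    apply: cvg_big; first exact: add_continuous.
    by move=> j _; have [] := mL j.
  have cvgI : N%:R * \int[m n]_(z in D) g z @[n --> F] --> N%:R * l.
    by apply: cvgM; [exact: cvg_cst|].
  apply: (ler_cvg_to cvgI cvgL); apply: nearW => n.
  by have /andP[] := layerN (m n) (mD n).
rewrite lerD2r; have /andP[+ _] := layerN mu muD; apply: le_trans.
apply: ler_sum => j _; rewrite -lee_fin fineK; first by have [] := mL j.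
exact: (mu_fin muD (cA j) (AD j)).
Qed.

Lemma portmanteau (g : Z -> R) : {within D, continuous g} ->
  \int[m n]_(z in D) g z @[n --> F] --> \int[mu]_(z in D) g z.
Proof.
move=> cg.
have mbD : measurable (D : set (borel Z)) by exact: borel_compact.
have [C C0 gC] := within_continuous_bounded cD cg.
pose h z := (g z + C) / (2 * C).
have C20 : 0 < 2 * C by rewrite mulr_gt0.
have ch : {within D, continuous h}.
  by move=> z; apply: cvgM; [apply: cvgD; [exact: cg|exact: cvg_cst]|exact: cvg_cst].
have h01 z : D z -> 0 <= h z <= 1.
  move=> /gC; rewrite ler_norml => /andP[g1 g2].
  by rewrite /h ler_pdivrMr// divr_ge0//=; lra.
have ch' : {within D, continuous (fun z => 1 - h z)}.
  by move=> z; apply: cvgB; [exact: cvg_cst|exact: ch].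
have h01' z : D z -> 0 <= 1 - h z <= 1 by move=> /h01 /andP[? ?]; apply/andP; split; lra.
have int1 (nu : {measure set (borel Z) -> \bar R}) : nu D = c%:E ->
    nu.-integrable D (EFin \o (fun=> 1 : R)) /\ \int[nu]_(z in D) 1 = c.
  move=> nuD; split; last by rewrite Rintegral_cst// mul1r nuD.
  by apply: (@le_integrable_bounded _ _ _ _ _ _ 1) => //; rewrite ?nuD ?ltry// normr1.
have inth (nu : {measure set (borel Z) -> \bar R}) : nu D = c%:E ->
    nu.-integrable D (EFin \o (h : borel Z -> R)).
  by move=> nuD; apply: within_continuous_integrable => //; rewrite nuD ltry.
have int1h (nu : {measure set (borel Z) -> \bar R}) : nu D = c%:E ->
    \int[nu]_(z in D) (1 - h z) = c - \int[nu]_(z in D) h z.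
  move=> nuD; have [i1 <-] := int1 _ nuD.
  by rewrite RintegralB//; exact: inth.
have intg (nu : {measure set (borel Z) -> \bar R}) : nu D = c%:E ->
    \int[nu]_(z in D) g z = 2 * C * \int[nu]_(z in D) h z - C * c.
  move=> nuD; have [i1 <-] := int1 _ nuD.
  rewrite -RintegralZl//; last exact: inth.
  rewrite -RintegralZl// -RintegralB//; last 2 first.
  - by apply: integrable_scaleR => //; exact: inth.
  - exact: integrable_scaleR.
  by apply: eq_Rintegral => z _; rewrite /h mulrC divfK ?gt_eqF// mulr1 addrK.
have [l _ hl] : exists2 l : R, `[0, c]%classic l & \int[m n]_(z in D) h z @[n --> F] --> l.
  apply: ultra_compact_cvg; first exact: segment_compact.
  move=> n /=; rewrite in_itv/= Rintegral_ge0 => [|z /h01/andP[]//].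
  have [i1 <-] := int1 _ (mD n).
  by apply: le_Rintegral => // [|z /h01/andP[]//]; exact: inth.
have lE : l = \int[mu]_(z in D) h z.
  apply/eqP; rewrite eq_le (limit_le ch h01 hl)/=.
  suff : c - l <= c - \int[mu]_(z in D) h z by rewrite lerD2l lerN2.
  rewrite -int1h//; apply: (limit_le ch' h01').
  rewrite (_ : (fun n => _) = (fun n => c - \int[m n]_(z in D) h z)).
    by apply: cvgB; [exact: cvg_cst|].
  by apply/funext => n; exact: int1h.
rewrite intg// -lE (_ : (fun n => _) = (fun n => 2 * C * \int[m n]_(z in D) h z - C * c)).
  by apply: cvgB; [apply: cvgM; [exact: cvg_cst|]|exact: cvg_cst].
by apply/funext => n; exact: intg.
Qed.

End portmanteau.

(** * Measures with prescribed mass up to each time *)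

Section timed_measures.
Context {R : realType} {Z : normedModType R} {S : set Z} {tm : Z -> R}.
Hypotheses (tm_continuous : continuous tm) (closedS : closed S)
  (compactS : forall t, compact (S `&` [set z | tm z <= t])).
Let slice t := S `&` [set z | tm z <= t].

(** The common part of [Pi_Q] and [Pi_PQ]: the time s is part of the point z, and
    only the masses of the sets of points with time at most t matter for the
    existence of limits. *)
Definition timed_measure (T : set Z) (s : Z -> R)
    (mu : {measure set (borel Z) -> \bar R}) : Prop :=
  mu (~` T) = 0%E /\ forall t, 0 <= t -> mu (T `&` [set z | s z <= t]) = t%:E.

Let mS : measurable (S : set (borel Z)).
Proof. exact: borel_closed. Qed.

Let mslice t : measurable (slice t : set (borel Z)).
Proof. by apply: borel_compact; exact: compactS. Qed.

Lemma timed_measure_setI (mu : {measure set (borel Z) -> \bar R}) (A : set (borel Z)) :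
  mu (~` S) = 0%E -> measurable A -> mu A = mu (A `&` S).
Proof.
move=> muS mA; rewrite (measureDI mu mA mS) [X in (X + _)%E](_ : _ = 0%E) ?add0e//.
apply: (subset_measure0 _ _ _ muS); [exact: measurableD|exact: measurableC|].
by move=> z [].
Qed.

Let timed_measure_le (mu : {measure set (borel Z) -> \bar R}) (A : set (borel Z)) t :
  timed_measure S tm mu -> measurable A -> 0 <= t ->
  (forall z, A z -> S z -> tm z <= t) -> (mu A <= t%:E)%E.
Proof.
move=> [muS muslice] mA t0 At; rewrite (timed_measure_setI muS mA) -(muslice t)//.
apply: le_measure; rewrite ?inE; [exact: measurableI|exact: mslice|].
by move=> z [Az Sz]; split => //=; exact: At.
Qed.

Lemma timed_measure_compact (K : set Z) : compact K -> exists2 t : R, 0 <= t &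
  forall z, K z -> tm z <= t.
Proof.
move=> cK; have ctm : {within K, continuous tm} by exact: continuous_subspaceT.
have [C C0 KC] := within_continuous_bounded cK ctm.
by exists C => [|z /KC]; [exact: ltW|apply: le_trans; exact: ler_norm].
Qed.

(* Inside a compact slice, an open set which is slightly larger than the
   complement of A has a compact complement which is slightly smaller than A. *)
Let timed_measure_regular (mu : {measure set (borel Z) -> \bar R}) :
  timed_measure S tm mu ->
  (forall A : set (borel Z), measurable A ->
    mu A = ereal_inf [set mu O | O in [set O : set Z | open O /\ A `<=` O]]) ->
  regular_measure mu.
Proof.
move=> [muS muslice] outer A mA; split; first exact: outer.
apply/eqP; rewrite eq_le; apply/andP; split; last first.
  apply: ge_ereal_sup => _ [K [cK KA] <-]; apply: le_measure; rewrite ?inE//.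
  exact: borel_compact.
set sup := ereal_sup _.
have le_slice t : 0 <= t -> (mu (A `&` slice t) <= sup)%E.
  move=> t0; apply/lee_addgt0Pr => e e0.
  have mB : measurable (slice t `\` A : set (borel Z)) by exact: measurableD.
  have slice_fin : mu (slice t) \is a fin_num by rewrite muslice.
  have sub_fin (B : set (borel Z)) : measurable B -> B `<=` slice t -> mu B \is a fin_num.
    move=> mB' Bt; rewrite ge0_fin_numE// (@le_lt_trans _ _ (mu (slice t)))//.
      by apply: le_measure; rewrite ?inE.
    by rewrite muslice// ltry.
  have Bfin := sub_fin _ mB (@subDsetl _ _ _).
  have [_ [W [oW BW] <-]] : exists2 y, [set mu O | O in [set O : set Z | open O /\ slice t `\` A `<=` O]] y & (y < mu (slice t `\` A) + e%:E)%E.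
    by rewrite outer//; apply: lb_ereal_inf_adherent => //; rewrite -outer.
  move=> muW.
  have Wfin : mu W \is a fin_num.
    by rewrite ge0_fin_numE// (lt_le_trans muW)// -(fineK Bfin) -EFinD leey.
  have mW : measurable (W : set (borel Z)) by exact: borel_open.
  have cK : compact (slice t `\` W).
    by apply: compact_closedI; [exact: compactS|exact: open_closedC].
  apply: (@le_trans _ _ (mu (slice t `\` W) + e%:E)%E); last first.
    apply: leeD2r; apply: ereal_sup_ubound; exists (slice t `\` W) => //; split => // z [tz Wz].
    by apply: contrapT => Az; apply: Wz; exact: BW.
  have E1 : mu (slice t) = (mu (slice t `\` A) + mu (A `&` slice t))%E.
    by rewrite setIC; exact: measureDI.
  have E2 : mu (slice t) = (mu (slice t `\` W) + mu (slice t `&` W))%E.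
    exact: measureDI.
  have le3 : (mu (slice t `&` W) <= mu W)%E by exact: measureIr.
  have f1 : mu (A `&` slice t) \is a fin_num.
    by apply: sub_fin; [exact: measurableI|move=> z []].
  have f2 : mu (slice t `\` W) \is a fin_num.
    by apply: sub_fin; [exact: measurableD|move=> z []].
  have f3 : mu (slice t `&` W) \is a fin_num.
    by apply: sub_fin; [exact: measurableI|move=> z []].
  move: E1 E2 le3 muW; rewrite -(fineK Bfin) -(fineK f1) -(fineK f2) -(fineK f3) -(fineK slice_fin) -(fineK Wfin).
  by rewrite -!EFinD lte_fin !lee_fin => -[E1] [E2] le3 muW'; lra.
rewrite (timed_measure_setI muS mA).
have -> : A `&` S = \bigcup_n (A `&` slice n%:R).
  rewrite -setI_bigcupr; congr (_ `&` _); rewrite eqEsubset; split => [z Sz|z [n _ []]//].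
  exists (Num.truncn (tm z)).+1 => //; split => //=.
  by apply/ltW/truncnS_gt.
have mAn n : measurable (A `&` slice n%:R : set (borel Z)) by exact: measurableI.
have cvg_mu : mu (A `&` slice n%:R) @[n --> \oo] --> mu (\bigcup_n (A `&` slice n%:R)).
  apply: nondecreasing_cvg_mu => //; first exact: bigcupT_measurable.
  move=> i j ij; apply/subsetPset => z [Az [Sz zi]]; split => //; split => //=.
  by rewrite (le_trans zi)// ler_nat.
rewrite -(cvg_lim _ cvg_mu)//; apply: lime_le; first exact: cvgP cvg_mu.
by apply: nearW => n; exact: le_slice.
Qed.

(** No mass escapes: the sets of points of S with time at most t are compact, so
    their mass does not decrease at the limit, and they have open neighbourhoods
    of mass at most t + e, so it does not increase. *)
Lemma timed_measure_limit (F : set_system nat) (UF : UltraFilter F)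
    (m : nat -> {measure set (borel Z) -> \bar R}) :
  (forall n, timed_measure S tm (m n)) ->
  exists mu : {measure set (borel Z) -> \bar R},
  [/\ timed_measure S tm mu, regular_measure mu,
      forall K : set Z, compact K ->
        exists2 l : R, fine (m n K) @[n --> F] --> l & (l%:E <= mu K)%E &
      forall t (g : Z -> R), 0 <= t ->
        {within S `&` [set z | tm z <= t], continuous g} ->
        \int[m n]_(z in S `&` [set z | tm z <= t]) g z @[n --> F] -->
        \int[mu]_(z in S `&` [set z | tm z <= t]) g z].
Proof.
move=> mP.
have m_bounded (K : set Z) : compact K -> exists B : R, forall n, (m n K <= B%:E)%E.
  move=> cK; have [t t0 Kt] := timed_measure_compact cK.
  exists t => n; apply: (timed_measure_le (mP n)) => //; first exact: borel_compact.
  by move=> z /Kt.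
have [mu [outer usc lsc]] := weak_limit_measure m_bounded.
have mu_timed : timed_measure S tm mu.
  split.
    apply/eqP; rewrite eq_le measure_ge0 andbT; apply: lsc; first exact: closed_openC.
    by move=> n; have [->] := mP n.
  move=> t t0; apply/eqP; rewrite eq_le; apply/andP; split.
    apply/lee_addgt0Pr => e e0; rewrite -EFinD.
    apply: (@le_trans _ _ (mu (tm @^-1` [set y | y < t + e]))).
      apply: le_measure; rewrite ?inE.
      - exact: mslice.
      - by apply: borel_open; apply: open_comp => [z _|]; [exact: tm_continuous|exact: open_lt].
      - by move=> z [_] /= /le_lt_trans -> //; rewrite ltrDl.
    apply: lsc.
      by apply: open_comp => [z _|]; [exact: tm_continuous|exact: open_lt].
    move=> n; apply: (timed_measure_le (mP n)).
    - by apply: borel_open; apply: open_comp => [z _|]; [exact: tm_continuous|exact: open_lt].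
    - by rewrite addr_ge0// ltW.
    - by move=> z /= /ltW.
  have [l ml lmu] := usc _ (@compactS t).
  apply: le_trans lmu; rewrite (_ : l = t)//; rewrite -(cvg_lim _ ml)//.
  rewrite (_ : (fun n => _) = (fun=> t)); first exact: lim_cst.
  by apply/funext => n; have [_ ->] := mP n.
exists mu; split => //; first exact: timed_measure_regular.
move=> t g t0 cg; apply: (@portmanteau _ _ _ _ _ _ _ t) => //.
- by move=> K cK _; exact: usc.
- by move=> n; have [_ ->] := mP n.
- by have [_ ->] := mu_timed.
Qed.

End timed_measures.

(** * Limits of controls *)

Section measure_comparison.
Context {d : measure_display} {T : measurableType d} {R : realType}.

(** The inequality for the complement of A in D is the converse one for A. *)
Lemma measure_squeeze (m1 m2 : {measure set T -> \bar R}) (D : set T) :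
  measurable D -> m1 D = m2 D -> (m2 D < +oo)%E ->
  (forall A, measurable A -> A `<=` D -> (m1 A <= m2 A)%E) ->
  forall A, measurable A -> A `<=` D -> m1 A = m2 A.
Proof.
move=> mD m12D Doo m12 A mA AD; apply/eqP; rewrite eq_le m12//=.
have finS (m : {measure set T -> \bar R}) B : (m D < +oo)%E -> measurable B ->
    B `<=` D -> m B \is a fin_num.
  move=> mDoo mB BD; rewrite ge0_fin_numE// (le_lt_trans _ mDoo)//.
  by apply: le_measure; rewrite ?inE.
have Doo1 : (m1 D < +oo)%E by rewrite m12D.
have mDA : measurable (D `\` A) by exact: measurableD.
have E (m : {measure set T -> \bar R}) : m D = (m (D `\` A) + m A)%E.
  by rewrite (measureDI m mD mA) [D `&` A]setIidr.
have := m12 _ mDA (@subDsetl _ _ _).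
have := m12D; rewrite !E.
rewrite -(fineK (finS m1 _ Doo1 mA AD)) -(fineK (finS m2 _ Doo mA AD)).
rewrite -(fineK (finS m1 _ Doo1 mDA (@subDsetl _ _ _))).
rewrite -(fineK (finS m2 _ Doo mDA (@subDsetl _ _ _))).
by rewrite -!EFinD !lee_fin => -[E1] le1; lra.
Qed.

Lemma measureU3 (mu : {measure set T -> \bar R}) (A B C : set T) :
  measurable A -> measurable B -> measurable C ->
  A `&` B = set0 -> (A `|` B) `&` C = set0 ->
  mu (A `|` B `|` C) = (mu A + mu B + mu C)%E.
Proof.
by move=> mA mB mC AB ABC; rewrite measureU ?measureU//; exact: measurableU.
Qed.

(** The existential hides the instance of the image measure, which depends on the
    proof of measurability of phi. *)
Lemma pushforward_measure {d' : measure_display} {T' : measurableType d'}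
    (phi : T -> T') (mu : {measure set T -> \bar R}) :
  measurable_fun setT phi ->
  exists m : {measure set T' -> \bar R}, (forall A, m A = mu (phi @^-1` A)) /\
    forall D (f : T' -> \bar R), measurable D -> measurable_fun D f ->
      (forall y, D y -> 0 <= f y)%E ->
      (\int[m]_(y in D) f y = \int[mu]_(x in phi @^-1` D) f (phi x))%E.
Proof.
move=> mphi.
exists (measure_function_pushforward__canonical__measure_function_Measure mu mphi); split=> // D f mD mf f0.
rewrite ge0_integral_pushforward//.
by move=> y /set_mem; exact: f0.
Qed.

End measure_comparison.

Section control_measures.
Context {R : realType} {U V : normedVectType R} {P : set U} {Q : set V}.
Hypotheses (compactP : compact P) (compactQ : compact Q).

Lemma continuous_borel_measurable (Z W : normedModType R) (phi : Z -> W) :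
  continuous phi -> measurable_fun setT (phi : borel Z -> borel W).
Proof.
move=> cphi; apply: (@measurability _ _ _ (borel W) _ _ (@open W) erefl).
move=> _ [G oG <-]; rewrite setTI; apply: borel_open; apply: open_comp => // z _; exact: cphi.
Qed.

Lemma continuous_real_measurable (Z : normedModType R) (phi : Z -> R) :
  continuous phi -> measurable_fun setT (phi : borel Z -> R).
Proof.
move=> cphi; apply: within_continuous_measurable; first exact: closedT.
exact: continuous_subspaceT.
Qed.

Lemma closed_time : closed (@time R).
Proof. exact: closed_ge. Qed.

Lemma slabQE (t : R) : (`[0, t]%classic `*` Q) = (time `*` Q) `&` [set z | z.1 <= t].
Proof.
rewrite eqEsubset; split => [[s v] [/=]|[s v] [[/= s0 Qv] st]].
  by rewrite in_itv/= => /andP[s0 st] Qv.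
by split => //=; rewrite in_itv/= st andbT.
Qed.

Lemma slabPQE (t : R) : (`[0, t]%classic `*` P `*` Q) = (time `*` P `*` Q) `&` [set z | z.1.1 <= t].
Proof.
rewrite eqEsubset; split => [[[s u] v] [[/=]]|[[s u] v] [[[/= s0 Pu] Qv] st]].
  by rewrite in_itv/= => /andP[s0 st] Pu Qv.
by split => //=; rewrite in_itv/= st andbT.
Qed.

Lemma compact_slabQ (t : R) : compact (`[0, t]%classic `*` Q).
Proof. by apply: compact_setX => //; exact: segment_compact. Qed.

Lemma compact_slabPQ (t : R) : compact (`[0, t]%classic `*` P `*` Q).
Proof. by do 2 (apply: compact_setX => //); exact: segment_compact. Qed.

Let closedP : closed P.
Proof. exact: (compact_closed (@norm_hausdorff _ U)). Qed.

Let closedQ : closed Q.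
Proof. exact: (compact_closed (@norm_hausdorff _ V)). Qed.

Lemma closed_timeQ : closed (@time R `*` Q).
Proof.
rewrite (_ : _ `*` _ = (fst @^-1` time) `&` (snd @^-1` Q)); last by [].
by apply: closedI; apply: closed_comp => // z _; [exact: cvg_fst|exact: cvg_snd].
Qed.

Lemma closed_timePQ : closed (@time R `*` P `*` Q).
Proof.
rewrite (_ : _ `*` _ = ((fun z => z.1.1) @^-1` time) `&`
  ((fun z => z.1.2) @^-1` P) `&` (snd @^-1` Q)); last by [].
apply: closedI; last by apply: closed_comp => // z _; exact: cvg_snd.
apply: closedI; apply: closed_comp => // z _.
- by apply: cvg_comp; [exact: cvg_fst|exact: cvg_fst].
- by apply: cvg_comp; [exact: cvg_fst|exact: cvg_snd].
Qed.

Lemma borel_rectQ (I : set R) (A : set V) : measurable I ->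
  measurable (A : set (borel V)) -> measurable (I `*` A : set (borel (R * V)%type)).
Proof.
move=> mI mA.
rewrite (_ : _ `*` _ = (fst @^-1` I) `&` (snd @^-1` A)); last by [].
apply: measurableI; rewrite -[X in measurable X]setTI.
- by apply: (@continuous_real_measurable (R * V)%type) => // z; exact: cvg_fst.
- by apply: (@continuous_borel_measurable (R * V)%type V) => // z; exact: cvg_snd.
Qed.

Lemma borel_rectPQ (I : set R) (A : set V) : measurable I ->
  measurable (A : set (borel V)) ->
  measurable (I `*` P `*` A : set (borel (R * U * V)%type)).
Proof.
move=> mI mA.
rewrite (_ : _ `*` _ = ((fun z : R * U * V => z.1.1) @^-1` I) `&`
  ((fun z => z.1.2) @^-1` P) `&` (snd @^-1` A)); last by [].
do 2?apply: measurableI; rewrite -[X in measurable X]setTI.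
- apply: (@continuous_real_measurable (R * U * V)%type (fun z => z.1.1)) => // z.
  by apply: cvg_comp; [exact: cvg_fst|exact: cvg_fst].
- apply: (@continuous_borel_measurable (R * U * V)%type U (fun z => z.1.2)) => //.
    by move=> z; apply: cvg_comp; [exact: cvg_fst|exact: cvg_snd].
  exact: borel_closed.
- by apply: (@continuous_borel_measurable (R * U * V)%type V) => // z; exact: cvg_snd.
Qed.

Lemma lebesgue_measure_itv0 (t : R) : 0 <= t -> lebesgue_measure `[0, t]%classic = t%:E.
Proof.
move=> t0; rewrite lebesgue_measure_itv/= lte_fin sube0.
by case: ltgtP t0 => // <-.
Qed.

Lemma itv0_time (t : R) : `[0, t]%classic `<=` @time R.
Proof. by move=> s; rewrite /= in_itv/= => /andP[]. Qed.

Lemma Pi_Q_timed nu : Pi_Q Q nu -> timed_measure (time `*` Q) fst nu.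
Proof.
move=> [_ nu0 nuI]; split => // t t0.
rewrite -slabQE nuI; [exact: lebesgue_measure_itv0|exact: segment_compact|].
exact: itv0_time.
Qed.

Lemma compact_time_bounded (I : set R) : compact I -> I `<=` time ->
  exists2 t, 0 <= t & I `<=` `[0, t].
Proof.
move=> cI It; have [t t0 tI] := @timed_measure_compact R R id (fun=> cvg_id) _ cI.
by exists t => // s Is; rewrite /= in_itv/= tI// andbT; exact: It.
Qed.

(* A Borel measure dominating Lebesgue measure on compact sets of times and
   with the right mass on intervals has Lebesgue marginal. *)
Let marginal_squeeze (mu : {measure set (measurableTypeR R) -> \bar R}) (t : R) :
  0 <= t -> mu `[0, t]%classic = t%:E ->
  (forall I : set R, compact I -> I `<=` `[0, t] -> (lebesgue_measure I <= mu I)%E) ->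
  forall I : set R, measurable I -> I `<=` `[0, t] -> lebesgue_measure I = mu I.
Proof.
move=> t0 mut leK; apply: (@measure_squeeze _ _ _ (@lebesgue_measure R) mu `[0, t]%classic).
- exact: measurable_itv.
- by rewrite mut; exact: lebesgue_measure_itv0.
- by rewrite mut ltry.
move=> I mI It; rewrite lebesgue_regularity_inner_sup//.
apply: ge_ereal_sup => _ [K [cK KI] <-]; apply: (le_trans (leK _ cK _)).
  exact: subset_trans It.
apply: le_measure; rewrite ?inE//.
by apply: closed_measurable; exact: (compact_closed (@Rhausdorff R)).
Qed.

Lemma fst_preimageQ (J : set R) : J `<=` time ->
  (fst @^-1` J) `&` (time `*` Q) = J `*` Q.
Proof.
move=> Jt; rewrite eqEsubset; split => -[s v] /=; first by move=> [Js [_ Qv]].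
by move=> [Js Qv]; split => //; split => //; exact: Jt.
Qed.

Let time_marginal (nu : {measure set (borel (R * V)%type) -> \bar R}) :
  nu (~` (time `*` Q)) = 0%E ->
  exists m : {measure set (measurableTypeR R) -> \bar R},
    forall J : set R, measurable J -> J `<=` time -> m J = nu (J `*` Q).
Proof.
move=> nu0.
have mfst : measurable_fun setT (fst : borel (R * V)%type -> measurableTypeR R).
  by apply: continuous_real_measurable => z; exact: cvg_fst.
have [m [mE _]] := pushforward_measure nu mfst; exists m => J mJ Jt.
have mfJ : measurable (fst @^-1` J : set (borel (R * V)%type)).
  by rewrite -[X in measurable X]setTI; exact: mfst.
by rewrite mE (timed_measure_setI closed_timeQ nu0 mfJ) fst_preimageQ.
Qed.

Lemma Pi_Q_marginal nu (I : set R) (t : R) : Pi_Q Q nu -> 0 <= t -> measurable I ->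
  I `<=` `[0, t] -> nu (I `*` Q) = lebesgue_measure I.
Proof.
move=> nuP t0 mI It; have [_ nu0 nuI] := nuP; have [_ nut] := Pi_Q_timed nuP.
have [m mE] := time_marginal nu0.
have mE' J : measurable J -> J `<=` `[0, t] -> m J = nu (J `*` Q).
  by move=> mJ Jt; apply: mE => //; exact: subset_trans (@itv0_time t).
rewrite -mE'//; apply/esym/(marginal_squeeze t0) => //.
  by rewrite mE'// slabQE nut.
move=> J cJ Jt; rewrite mE'// ?nuI//; first exact: subset_trans (@itv0_time t).
by apply: closed_measurable; exact: (compact_closed (@Rhausdorff R)).
Qed.

(** The marginal of the limit dominates Lebesgue measure by upper semicontinuity
    on the compact sets I x Q, and has the same mass on the intervals [0, t]. *)
Lemma Pi_Q_limit (F : set_system nat) (UF : UltraFilter F) nu_ :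
  (forall n, Pi_Q Q (nu_ n)) -> exists2 nu, Pi_Q Q nu &
  forall (t : R) g, 0 <= t -> {within `[0, t]%classic `*` Q, continuous g} ->
    \int[nu_ n]_(z in `[0, t]%classic `*` Q) g z @[n --> F] -->
    \int[nu]_(z in `[0, t]%classic `*` Q) (g z : R).
Proof.
move=> nuP.
have cslab (t : R) : compact ((time `*` Q) `&` [set z | z.1 <= t]).
  by rewrite -slabQE; exact: compact_slabQ.
have cfst : continuous (fst : R * V -> R) by move=> z; exact: cvg_fst.
have [nu [nu_timed nu_reg usc cvg_int]] := timed_measure_limit cfst
  closed_timeQ cslab UF (fun n => Pi_Q_timed (nuP n)).
exists nu; last first.
  by move=> t g t0 cg; rewrite slabQE; apply: cvg_int => //; rewrite -slabQE.
have [nu0 nut] := nu_timed; split => // I cI It.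
have [t t0 It'] := compact_time_bounded cI It.
have [m mE] := time_marginal nu0.
have mE' J : measurable J -> J `<=` `[0, t] -> m J = nu (J `*` Q).
  by move=> mJ Jt; apply: mE => //; exact: subset_trans (@itv0_time t).
have mcompact (J : set R) : compact J -> measurable J.
  by move=> cJ; apply: closed_measurable; exact: (compact_closed (@Rhausdorff R)).
rewrite -mE'//; last exact: mcompact.
apply/esym/(marginal_squeeze t0) => //; last exact: mcompact.
  by rewrite mE'// ?slabQE ?nut//; exact: measurable_itv.
move=> J cJ Jt; rewrite mE'//; last exact: mcompact.
have Jtime : J `<=` time by exact: subset_trans (@itv0_time t).
have [l Jl lnu] := usc _ (compact_setX cJ compactQ).
apply: le_trans lnu.
have lebJ : (lebesgue_measure J <= t%:E)%E.
  rewrite -(lebesgue_measure_itv0 t0); apply: le_measure; rewrite ?inE//.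
  exact: mcompact.
have lebfin : lebesgue_measure J \is a fin_num.
  by rewrite ge0_fin_numE// (le_lt_trans lebJ)// ltry.
rewrite -(fineK lebfin) lee_fin -(cvg_lim _ Jl)//.
rewrite (_ : (fun n => _) = (fun=> fine (lebesgue_measure J))) ?lim_cst//.
by apply/funext => n; have [_ _ ->] := nuP n.
Qed.

(** [Pi_compat] up to regularity; the marginal on [time] is that of nu.  A
    measure given by a formula is first shown to be compatible; the limit of the
    constant sequence then is a regular measure with the same integrals of
    continuous functions. *)
Definition compatible (nu : {measure set (borel (R * V)%type) -> \bar R})
    (eta : {measure set (borel (R * U * V)%type) -> \bar R}) : Prop :=
  eta (~` (time `*` P `*` Q)) = 0%E /\
  forall (I : set R) (A : set V), measurable I -> I `<=` time ->
    measurable (A : set (borel V)) -> A `<=` Q ->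
    eta (I `*` P `*` A) = nu (I `*` A).

Let mQ : measurable (Q : set (borel V)).
Proof. exact: borel_closed. Qed.

Lemma Pi_compat_compatible nu eta : Pi_compat P Q nu eta -> compatible nu eta.
Proof. by move=> [[_ eta0 _] etaE]. Qed.

Lemma compatible_timed nu eta : Pi_Q Q nu -> compatible nu eta ->
  timed_measure (time `*` P `*` Q) (fun z => z.1.1) eta.
Proof.
move=> nuP [eta0 etaE]; split => // t t0.
rewrite -slabPQE etaE//; last exact: itv0_time.
rewrite slabQE; have [_ ->] := Pi_Q_timed nuP => //.
Qed.

Lemma compatible_Pi_compat nu eta : Pi_Q Q nu -> regular_measure eta ->
  compatible nu eta -> Pi_compat P Q nu eta.
Proof.
move=> [_ _ nuI] eta_reg [eta0 etaE]; split => //; split => // I cI It.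
rewrite etaE ?nuI//.
by apply: closed_measurable; exact: (compact_closed (@Rhausdorff R)).
Qed.

(* Up to time t the two measures have the same mass t, which is the sum of the
   masses of I x A, of I x (Q \ A) and of the complement of I: the three
   inequalities are equalities.  Then t tends to infinity. *)
Let compatible_of_le nu eta : Pi_Q Q nu ->
  timed_measure (time `*` P `*` Q) (fun z => z.1.1) eta ->
  (forall (I : set R) (A : set V), measurable I -> I `<=` time ->
    measurable (A : set (borel V)) -> A `<=` Q ->
    (nu (I `*` A) <= eta (I `*` P `*` A))%E) ->
  compatible nu eta.
Proof.
move=> nuP [eta0 etat] le_eta; split => // I A mI It mA AQ.
have [_ nut] := Pi_Q_timed nuP.
have bounded_eq (t : R) : 0 <= t -> eta ((I `&` `[0, t]) `*` P `*` A) = nu ((I `&` `[0, t]) `*` A).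
  move=> t0.
  pose J := I `&` `[0, t]; pose J' := `[0, t]%classic `\` I.
  have mt : measurable (`[0, t]%classic : set R) by exact: measurable_itv.
  have mJ : measurable J by exact: measurableI.
  have mJ' : measurable J' by exact: measurableD.
  have Jt : J `<=` time by move=> s [/It].
  have J't : J' `<=` time by move=> s [/itv0_time].
  have QAQ : Q `\` A `<=` Q by move=> v [].
  have mQA : measurable (Q `\` A : set (borel V)) by exact: measurableD.
  have eE : eta (`[0, t]%classic `*` P `*` Q) =
      (eta (J `*` P `*` A) + eta (J `*` P `*` (Q `\` A)) + eta (J' `*` P `*` Q))%E.
    rewrite -measureU3; [|exact: borel_rectPQ..| |]; last 2 first.
    - by rewrite -subset0 => -[[s u] v] [[_ Av] [_ [_ /(_ Av)]]].
    - by rewrite -subset0 => -[[s u] v] [[[[[Is _] _] _]|[[[Is _] _] _]] [[[_ /(_ Is)]]]].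
    congr (eta _); rewrite eqEsubset; split => -[[s u] v] /=.
      move=> [[st Pu] Qv]; have [Is|Is] := pselect (I s); last by right.
      by left; have [Av|Av] := pselect (A v); [left|right].
    by move=> [[[[[Is st] Pu] /AQ Qv]|[[[Is st] Pu] [Qv _]]]|[[[st _] Pu] Qv]].
  have nE : nu (`[0, t]%classic `*` Q) =
      (nu (J `*` A) + nu (J `*` (Q `\` A)) + nu (J' `*` Q))%E.
    rewrite -measureU3; [|exact: borel_rectQ..| |]; last 2 first.
    - by rewrite -subset0 => -[s v] [[_ Av] [_ [_ /(_ Av)]]].
    - by rewrite -subset0 => -[s v] [[[[Is _] _]|[[Is _] _]] [[_ /(_ Is)]]].
    congr (nu _); rewrite eqEsubset; split => -[s v] /=.
      move=> [st Qv]; have [Is|Is] := pselect (I s); last by right.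
      by left; have [Av|Av] := pselect (A v); [left|right].
    by move=> [[[[Is st] /AQ Qv]|[[Is st] [Qv _]]]|[[st _] Qv]].
  have := le_eta _ _ mJ' J't mQ (fun _ => id).
  have := le_eta _ _ mJ Jt mQA QAQ.
  have := le_eta _ _ mJ Jt mA AQ.
  have : eta (`[0, t]%classic `*` P `*` Q) = t%:E by rewrite slabPQE etat.
  have : nu (`[0, t]%classic `*` Q) = t%:E by rewrite slabQE nut.
  rewrite eE nE -/J.
  have := measure_ge0 nu (J `*` A); have := measure_ge0 nu (J `*` (Q `\` A)).
  have := measure_ge0 nu (J' `*` Q).
  case: (nu (J `*` A)) => [n1| |]//; case: (nu (J `*` (Q `\` A))) => [n2| |]//;
  case: (nu (J' `*` Q)) => [n3| |]// _ _ _ .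
  have := measure_ge0 eta (J `*` P `*` A); have := measure_ge0 eta (J `*` P `*` (Q `\` A)).
  have := measure_ge0 eta (J' `*` P `*` Q).
  case: (eta (J `*` P `*` A)) => [e1| |]//; case: (eta (J `*` P `*` (Q `\` A))) => [e2| |]//;
  case: (eta (J' `*` P `*` Q)) => [e3| |]// _ _ _.
  by rewrite -!EFinD !lee_fin => -[nt] [et] l1 l2 l3; congr EFin; lra.
pose I_ n := I `&` `[0, n%:R]%classic.
have mI_ n : measurable (I_ n) by apply: measurableI => //; exact: measurable_itv.
have cover (s : R) : I s -> exists n, I_ n s.
  move=> Is; exists (Num.truncn s).+1; split => //=.
  by rewrite in_itv/= (It _ Is)/=; exact/ltW/truncnS_gt.
have ndI i j : (i <= j)%N -> I_ i `<=` I_ j.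
  move=> ij s [Is]; rewrite /= in_itv/= => /andP[s0 si]; split => //=.
  by rewrite in_itv/= s0/= (le_trans si)// ler_nat.
have cvg_eta : eta (I_ n `*` P `*` A) @[n --> \oo] --> eta (I `*` P `*` A).
  rewrite (_ : I `*` P `*` A = \bigcup_n (I_ n `*` P `*` A)); last first.
    rewrite eqEsubset; split => [[[s u] v] [[/cover[n Ins] Pu] Av]|]; first by exists n.
    by move=> [[s u] v] [n _ [[[Is _] Pu] Av]].
  apply: nondecreasing_cvg_mu; first by move=> n; exact: borel_rectPQ.
    by apply: bigcupT_measurable => n; exact: borel_rectPQ.
  by move=> i j ij; apply/subsetPset => -[[s u] v] [[/(ndI _ _ ij) Is Pu] Av].
have cvg_nu : nu (I_ n `*` A) @[n --> \oo] --> nu (I `*` A).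
  rewrite (_ : I `*` A = \bigcup_n (I_ n `*` A)); last first.
    rewrite eqEsubset; split => [[s v] [/cover[n Ins] Av]|]; first by exists n.
    by move=> [s v] [n _ [[Is _] Av]].
  apply: nondecreasing_cvg_mu; first by move=> n; exact: borel_rectQ.
    by apply: bigcupT_measurable => n; exact: borel_rectQ.
  by move=> i j ij; apply/subsetPset => -[s v] [/(ndI _ _ ij) Is Av].
rewrite -(cvg_lim _ cvg_eta)// -(cvg_lim _ cvg_nu)//; congr (lim (_ @ \oo)).
by apply/funext => n; exact: bounded_eq.
Qed.

(** By inner regularity of nu it suffices to compare the masses of compact
    rectangles, and on these the limit dominates nu by upper semicontinuity. *)
Lemma Pi_compat_limit (F : set_system nat) (UF : UltraFilter F) nu eta_ :
  Pi_Q Q nu -> (forall n, compatible nu (eta_ n)) ->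
  exists2 eta, Pi_compat P Q nu eta &
  forall (t : R) g, 0 <= t -> {within `[0, t]%classic `*` P `*` Q, continuous g} ->
    \int[eta_ n]_(z in `[0, t]%classic `*` P `*` Q) g z @[n --> F] -->
    \int[eta]_(z in `[0, t]%classic `*` P `*` Q) (g z : R).
Proof.
move=> nuP eta_P.
have cslab (t : R) : compact ((time `*` P `*` Q) `&` [set z | z.1.1 <= t]).
  by rewrite -slabPQE; exact: compact_slabPQ.
have ctm : continuous (fun z : R * U * V => z.1.1).
  by move=> z; apply: cvg_comp; [exact: cvg_fst|exact: cvg_fst].
have [eta [eta_timed eta_reg usc cvg_int]] := timed_measure_limit ctm
  closed_timePQ cslab UF (fun n => compatible_timed nuP (eta_P n)).
exists eta; last first.
  by move=> t g t0 cg; rewrite slabPQE; apply: cvg_int => //; rewrite -slabPQE.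
apply: compatible_Pi_compat => //; apply: compatible_of_le => // I A mI It mA AQ.
have [nu_reg nu0 nuI] := nuP.
have [_ ->] := nu_reg _ (borel_rectQ mI mA).
apply: ge_ereal_sup => _ [K [cK KIA] <-].
(* K is contained in the compact rectangle of its projections. *)
pose K1 := fst @` K; pose K2 := snd @` K.
have cK1 : compact K1.
  by apply: continuous_compact => //; apply: continuous_subspaceT => z; exact: cvg_fst.
have cK2 : compact K2.
  by apply: continuous_compact => //; apply: continuous_subspaceT => z; exact: cvg_snd.
have K1I : K1 `<=` I by move=> _ [z /KIA[]] ? ? <-.
have K2A : K2 `<=` A by move=> _ [z /KIA[]] ? ? <-.
have mK1 : measurable K1.
  by apply: closed_measurable; exact: (compact_closed (@Rhausdorff R)).
have mK2 : measurable (K2 : set (borel V)) by exact: borel_compact.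
have K1t := subset_trans K1I It; have K2Q := subset_trans K2A AQ.
apply: (@le_trans _ _ (nu (K1 `*` K2))).
  apply: le_measure; rewrite ?inE; [exact: borel_compact|exact: borel_rectQ|].
  by move=> z Kz; split; exists z.
apply: (@le_trans _ _ (eta (K1 `*` P `*` K2))); last first.
  apply: le_measure; rewrite ?inE; [exact: borel_rectPQ|exact: borel_rectPQ|].
  by move=> z [[/K1I ? ?] /K2A ?].
have cR : compact (K1 `*` P `*` K2) by apply: compact_setX => //; exact: compact_setX.
have [l Jl leta] := usc _ cR.
have [t t0 Kt] := compact_time_bounded cK1 K1t.
have nufin : nu (K1 `*` K2) \is a fin_num.
  rewrite ge0_fin_numE// (@le_lt_trans _ _ (nu (`[0, t]%classic `*` Q)))//.
    apply: le_measure; rewrite ?inE; [exact: borel_rectQ| |].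
      by apply: borel_rectQ => //; exact: measurable_itv.
    by move=> z [/Kt ? /K2Q].
  by rewrite slabQE; have [_ ->] := Pi_Q_timed nuP; rewrite ?ltry.
apply: le_trans leta.
rewrite -(fineK nufin) lee_fin -(cvg_lim _ Jl)//.
rewrite (_ : (fun n => _) = (fun=> fine (nu (K1 `*` K2)))) ?lim_cst//.
by apply/funext => n; have [_ ->] := eta_P n.
Qed.

End control_measures.
Arguments compatible {R U V} P Q nu eta.

(** * Integrals of controls over short intervals of times *)

Section completed_lebesgue.
Context {R : realType}.

Lemma measurable_completed (A : set R) : measurable (A : set (measurableTypeR R)) ->
  (wlength (@idfun R))^*%mu.-cara.-measurable A.
Proof. exact: sub_caratheodory. Qed.

Lemma ge0_integral_completed (D : set R) (h : R -> \bar R) :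
  measurable (D : set (measurableTypeR R)) -> measurable_fun (D : set (measurableTypeR R)) h ->
  (forall x, D x -> 0 <= h x)%E ->
  (\int[lebesgue_measure]_(x in D) h x = \int[completed_lebesgue_measure]_(x in D) h x)%E.
Proof.
move=> mD mh h0.
have mid : measurable_fun setT
    (id : caratheodory_type (wlength (@idfun R))^*%mu -> measurableTypeR R).
  by move=> _ A mA; rewrite setTI; exact: measurable_completed.
have [m [mE mint]] := pushforward_measure (@completed_lebesgue_measure R) mid.
rewrite -[RHS](mint D h mD mh h0).
by apply: eq_measure_integral => A mA AD; rewrite mE.
Qed.

Lemma lebesgue_measure_itv_le (s t : R) : s <= t ->
  lebesgue_measure `[s, t]%classic = (t - s)%:E.
Proof.
move=> st; rewrite lebesgue_measure_itv/= lte_fin; case: ltgtP st => // -> _.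
by rewrite subrr.
Qed.

Lemma integral_continuity_modulus (a : R -> R) (T e : R) : summable_on `[0, T]%classic a ->
  0 < e -> exists2 d : R, 0 < d & forall s t, 0 <= s <= t -> t <= T -> t - s <= d ->
  \int[completed_lebesgue_measure]_(x in `[s, t]) `|a x| < e.
Proof.
move=> ia e0.
have mT : measurable (`[0, T]%classic : set (caratheodory_type (wlength (@idfun R))^*%mu)).
  by apply: measurable_completed; exact: measurable_itv.
pose a0 := a \_ `[0, T].
have ia0 : (@completed_lebesgue_measure R).-integrable setT (EFin \o a0).
  move: ia; rewrite /summable_on (integrable_mkcond _ mT).
  apply: eq_integrable => // x _; rewrite /a0 /patch/=.
  by case: ifP => xT; rewrite ?xT.
have [d [d0 dP]] := integral_normr_continuous ia0 e0.
exists (d / 2); first by rewrite divr_gt0.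
move=> s t /andP[s0 st] tT tsd.
have mst : measurable (`[s, t]%classic : set (caratheodory_type (wlength (@idfun R))^*%mu)).
  by apply: measurable_completed; exact: measurable_itv.
have lt_d : (@completed_lebesgue_measure R `[s, t]%classic < d%:E)%E.
  rewrite (_ : completed_lebesgue_measure _ = lebesgue_measure `[s, t]%classic)//.
  rewrite lebesgue_measure_itv_le// lte_fin.
  by rewrite (le_lt_trans tsd)// ltr_pdivrMr// ltr_pMr// ltr1n.
have := dP _ mst lt_d; congr (_ < _); apply: eq_Rintegral => x.
rewrite inE/= in_itv/= => /andP[sx xt]; rewrite /a0 patchE mem_set//=.
by rewrite in_itv/= (le_trans s0 sx) (le_trans xt).
Qed.

End completed_lebesgue.

Section control_integrals.
Context {R : realType} {U V : normedVectType R} {P : set U} {Q : set V}.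
Hypotheses (compactP : compact P) (compactQ : compact Q).
Context {nu : {measure set (borel (R * V)%type) -> \bar R}}
  {eta : {measure set (borel (R * U * V)%type) -> \bar R}}.
Hypotheses (nuP : Pi_Q Q nu) (etaP : compatible P Q nu eta).

Let slab (s t : R) : set (R * U * V) := `[s, t]%classic `*` P `*` Q.

Let control_nonempty : exists u v, P u /\ Q v.
Proof.
have [_ eta1] := compatible_timed compactQ nuP etaP.
apply: contrapT => PQ0; have := eta1 1 ler01.
rewrite -slabPQE (_ : _ `*` _ = set0) ?measure0; last first.
  by rewrite -subset0 => -[[s u] v] [[_ Pu] Qv]; apply: PQ0; exists u, v.
by move=> [/esym/eqP]; rewrite oner_eq0.
Qed.

Lemma compact_slab (s t : R) : compact (slab s t).
Proof. by do 2 (apply: compact_setX => //); exact: segment_compact. Qed.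

Lemma eta_slab (s t : R) : 0 <= s <= t -> eta (slab s t) = (t - s)%:E.
Proof.
move=> /andP[s0 st].
have It : `[s, t]%classic `<=` @time R.
  by move=> r; rewrite /= in_itv/= => /andP[/(le_trans s0)].
have mQ : measurable (Q : set (borel V)) by exact: borel_compact.
have [_ etaE] := etaP; have [_ _ nuE] := nuP.
rewrite etaE ?nuE//; last exact: segment_compact.
exact: lebesgue_measure_itv_le.
Qed.

Let time_slab (s t : R) (A : set R) : 0 <= s -> measurable A -> A `<=` `[s, t] ->
  eta ((fun z : R * U * V => z.1.1) @^-1` A) = lebesgue_measure A.
Proof.
move=> s0 mA Ast; have [eta0 etaE] := etaP.
have At : A `<=` time by move=> r /Ast; rewrite /= in_itv/= => /andP[/(le_trans s0)].
have At0 : A `<=` `[0, Num.max 0 t].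
  move=> r Ar; have := Ast _ Ar; rewrite /= !in_itv/= => /andP[_ rt].
  by rewrite (At _ Ar)/= le_max rt orbT.
have mpi : measurable_fun setT ((fun z => z.1.1) : borel (R * U * V)%type -> R).
  apply: continuous_real_measurable => z.
  by apply: cvg_comp; [exact: cvg_fst|exact: cvg_fst].
have mpA : measurable (((fun z : R * U * V => z.1.1) @^-1` A) : set (borel (R * U * V)%type)).
  by rewrite -[X in measurable X]setTI; exact: mpi.
rewrite (timed_measure_setI (closed_timePQ compactP compactQ) eta0 mpA).
rewrite (_ : _ `&` _ = A `*` P `*` Q); last first.
  rewrite eqEsubset; split => -[[r u] v] /=; first by move=> [Ar [[_ Pu] Qv]].
  by move=> [[Ar Pu] Qv]; do !split => //; exact: At.
rewrite etaE//; last by apply: borel_closed; exact: (compact_closed (@norm_hausdorff _ V)).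
by apply: (Pi_Q_marginal compactQ nuP _ mA At0); rewrite le_max lexx.
Qed.

(** The function a is only Lebesgue measurable, so that a z.1.1 need not be
    measurable in z for the Borel sets and cannot be integrated for eta.  The
    supremum h of G over P x Q is a Borel function of the time, since the sets
    where h > c are open in [s, t], and it lies between G and S |a|. *)
Lemma integral_slab_le (a : R -> R) (G : R * U * V -> R) (S s t : R) :
  0 <= s <= t -> 0 <= S -> summable_on `[s, t]%classic a ->
  {within slab s t, continuous G} ->
  (forall z, slab s t z -> 0 <= G z <= S * `|a z.1.1|) ->
  \int[eta]_(z in slab s t) G z <=
  S * \int[completed_lebesgue_measure]_(r in `[s, t]) `|a r|.
Proof.
move=> /andP[s0 st] S0 ia cG G0a.
have clslab : closed (slab s t).
  exact: (compact_closed (@norm_hausdorff _ _) (@compact_slab s t)).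
have mslab : measurable (slab s t : set (borel (R * U * V)%type)) by exact: borel_closed.
have [u0 [v0 [Pu0 Qv0]]] := control_nonempty.
have mpi : measurable_fun setT ((fun z => z.1.1) : borel (R * U * V)%type -> measurableTypeR R).
  apply: continuous_real_measurable => z.
  by apply: cvg_comp; [exact: cvg_fst|exact: cvg_fst].
pose h (r : R) : \bar R := ereal_sup [set (G (r, w.1, w.2))%:E | w in P `*` Q].
have Gh z : slab s t z -> ((G z)%:E <= h z.1.1)%E.
  by case: z => -[r u] v [[_ Pu] Qv]; apply: ereal_sup_ubound; exists (u, v).
have h0 r : `[s, t]%classic r -> (0 <= h r)%E.
  move=> str; apply: (@le_trans _ _ (G (r, u0, v0))%:E).
    by have /andP[] := G0a (r, u0, v0) (conj (conj str Pu0) Qv0).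
  exact: (Gh (r, u0, v0) (conj (conj str Pu0) Qv0)).
have ha r : `[s, t]%classic r -> (h r <= (S * `|a r|)%:E)%E.
  move=> str; apply: ge_ereal_sup => _ [[u v] [/= Pu Qv] <-]; rewrite lee_fin.
  by have /andP[] := G0a (r, u, v) (conj (conj str Pu) Qv).
have mh : measurable_fun (`[s, t]%classic : set (measurableTypeR R)) h.
  apply: (measurability _ (ErealGenOInfty.measurableE R)) => _ [_ [c ->] <-].
  have /open_subspaceP[W oW WG] : open (G @^-1` `]c, +oo[ : set (subspace (slab s t))).
    by move/continuousP : cG; apply; exact: interval_open.
  rewrite (_ : _ `&` _ = `[s, t] `&`
      \bigcup_(w in P `*` Q) (fun r : R => (r, w.1, w.2)) @^-1` W); last first.
    rewrite eqEsubset; split => r [str].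
      rewrite /= in_itv/= andbT => /ereal_sup_gt[_ [w [Pw Qw] <-] cG'].
      split => //; exists w => //=.
      have : (W `&` slab s t) (r, w.1, w.2).
        by rewrite WG; split => //=; rewrite in_itv/= andbT -lte_fin.
      by case.
    move=> [w [Pw Qw] /= Ww]; split => //=; rewrite in_itv/= andbT.
    have : (W `&` slab s t) (r, w.1, w.2) by [].
    rewrite WG => -[/= ]; rewrite in_itv/= andbT => cG' sl.
    by apply: lt_le_trans (Gh _ sl); rewrite lte_fin.
  apply: measurableI; first exact: measurable_itv.
  apply: open_measurable; apply: bigcup_open => w _; apply: open_comp => // r _.
  have c1 : (fun x : R => (x, w.1)) @ r --> (r, w.1).
    exact: (cvg_pair (@cvg_id _ (nbhs r)) (cvg_cst _)).
  exact: (cvg_pair c1 (cvg_cst _)).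
have mhpi : measurable_fun (slab s t : set (borel (R * U * V)%type)) (h \o (fun z => z.1.1)).
  apply: (@measurable_comp _ _ _ _ _ _ `[s, t]%classic) => //.
  - by move=> _ [[[r u] v] [[str _] _] <-].
  - by apply: measurable_funTS; exact: mpi.
have [m [mE mint]] := pushforward_measure eta mpi.
have mst : measurable (`[s, t]%classic : set (caratheodory_type (wlength (@idfun R))^*%mu)).
  by apply: measurable_completed; exact: measurable_itv.
have iabs : (@completed_lebesgue_measure R).-integrable `[s, t]%classic (EFin \o (fun r => `|a r|)).
  exact: integrable_norm.
have iSabs := integrable_scaleR S mst iabs.
have le1 : (\int[eta]_(z in slab s t) (G z)%:E <=
    \int[completed_lebesgue_measure]_(r in `[s, t]) (S * `|a r|)%:E)%E.
  apply: (@le_trans _ _ (\int[eta]_(z in slab s t) h z.1.1)%E).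
    apply: ge0_le_integral => //.
    - by move=> z /G0a/andP[]; rewrite lee_fin.
    - by apply/measurable_EFinP; exact: within_continuous_measurable.
  apply: (@le_trans _ _ (\int[m]_(r in `[s, t]) h r)%E).
    rewrite mint//.
    apply: ge0_subset_integral => //.
    - by rewrite -[X in measurable X]setTI; apply: mpi => //; exact: measurable_itv.
    - apply: (@measurable_comp _ _ _ _ _ _ `[s, t]%classic) => //.
      + by move=> _ [z ? <-].
      + by apply: measurable_funTS; exact: mpi.
    - by move=> z /h0.
    - by move=> z [[]].
  rewrite (eq_measure_integral (@lebesgue_measure R)); last first.
    by move=> A mA Ast; rewrite mE; exact: (time_slab s0 mA Ast).
  rewrite ge0_integral_completed//.
  have mhc : measurable_fun (`[s, t]%classic : set (caratheodory_type (wlength (@idfun R))^*%mu)) h.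
    move=> _ A mA; apply: measurable_completed; apply: mh => //.
  have mSa : measurable_fun (`[s, t]%classic : set (caratheodory_type (wlength (@idfun R))^*%mu))
      (fun r => (S * `|a r|)%:E).
    exact: measurable_int iSabs.
  exact: (ge0_le_integral _ mst h0 mhc mSa ha).
rewrite -RintegralZl//; apply: fine_le => //.
- by apply: integrable_fin_num => //; apply: within_continuous_integrable => //;
    rewrite ?eta_slab ?ltry ?s0//; exact: compact_slab.
- exact: (integrable_fin_num mst iSabs).
Qed.

End control_integrals.

(** * Vector integrals and a Gronwall inequality *)

Lemma continuous_within_comp (T1 T2 T3 : topologicalType) (D : set T1) (E : set T2)
    (g : T1 -> T2) (h : T2 -> T3) :
  {within D, continuous g} -> {within E, continuous h} -> (forall x, D x -> E (g x)) ->
  {within D, continuous (fun x => h (g x))}.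
Proof.
move=> /subspace_continuousP cg /subspace_continuousP ch DE.
apply/subspace_continuousP => x Dx B /(ch _ (DE _ Dx)) hB.
have := cg x Dx _ hB; apply: filterS2 (withinT _ _) => z Dz /(_ (DE _ Dz)).
exact.
Qed.

Arguments continuous_within_comp {T1 T2 T3 D E g h} _ _ _.

Lemma continuous_within_pair (T1 T2 T3 : topologicalType) (D : set T1)
    (g : T1 -> T2) (h : T1 -> T3) :
  {within D, continuous g} -> {within D, continuous h} ->
  {within D, continuous (fun x => (g x, h x))}.
Proof. by move=> cg ch x; apply: cvg_pair; [exact: cg|exact: ch]. Qed.

Section vintegral_theory.
Context {R : realType} {X : normedVectType R}.
Let n := \dim {:X}.
Let e := vbasis {:X}.

Lemma coord_within_continuous (Z : topologicalType) (D : set Z) (g : Z -> X) (i : 'I_n) :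
  {within D, continuous g} -> {within D, continuous (fun z => coord e i (g z) : R)}.
Proof.
move=> cg; apply: (@continuous_within_comp _ _ _ D setT) => //.
exact/continuous_subspaceT/coord_continuous_vect.
Qed.

Lemma norm_within_continuous (Z : topologicalType) (D : set Z) (g : Z -> X) :
  {within D, continuous g} -> {within D, continuous (fun z => `|g z|)}.
Proof.
move=> cg; apply: (@continuous_within_comp _ _ _ D setT) => //.
exact/continuous_subspaceT/norm_continuous.
Qed.

Context {Z : normedModType R}.

(** The constant accounts for the norm: integration is done in coordinates. *)
Lemma norm_vintegral_le : exists2 C : R, 0 < C &
  forall (mu : {measure set (borel Z) -> \bar R}) (D : set Z) (E : set Z) (g : Z -> X),
    compact D -> (mu D < +oo)%E -> {within D, continuous g} ->
    measurable (E : set (borel Z)) -> E `<=` D ->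
    `|vintegral mu E (g : borel Z -> X)| <= C * \int[mu]_(z in E) `|g z|.
Proof.
have [K K0 coordK] := @coord_bounded R X.
exists (1 + \sum_(i < n) `|e`_i| * K).
  by rewrite ltr_pwDl// sumr_ge0// => i _; rewrite mulr_ge0// ltW.
move=> mu D E g cD Doo cg mE ED.
have mD : measurable (D : set (borel Z)) by exact: borel_compact.
have iE (h : Z -> R) : {within D, continuous h} ->
    mu.-integrable E (EFin \o (h : borel Z -> R)).
  by move=> ch; apply: (integrableS mD) => //; exact: within_continuous_integrable.
apply: (le_trans (ler_norm_sum _ _ _)).
rewrite mulrDl mul1r -[leLHS]add0r lerD ?Rintegral_ge0// mulr_suml.
apply: ler_sum => i _; rewrite normrZ mulrC -mulrA ler_wpM2l//.
have ic := iE _ (coord_within_continuous (i := i) cg).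
have ig := iE _ (norm_within_continuous cg).
apply: (le_trans (le_normr_Rintegral mE ic)).
rewrite -RintegralZl//; apply: le_Rintegral => //; first exact: integrable_norm.
exact: integrable_scaleR.
Qed.

Lemma vintegralB (mu : {measure set (borel Z) -> \bar R}) (D : set Z) (g h : Z -> X) :
  compact D -> (mu D < +oo)%E -> {within D, continuous g} -> {within D, continuous h} ->
  vintegral mu D (g : borel Z -> X) - vintegral mu D (h : borel Z -> X) =
  vintegral mu D ((fun z => g z - h z) : borel Z -> X).
Proof.
move=> cD Doo cg ch; rewrite /vintegral -sumrB; apply: eq_bigr => i _.
rewrite -scalerBl -RintegralB//; first last.
- by apply: within_continuous_integrable => //; exact: coord_within_continuous.
- by apply: within_continuous_integrable => //; exact: coord_within_continuous.
- exact: borel_compact.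
by congr (_ *: _); apply: eq_Rintegral => z _; rewrite linearB.
Qed.

Lemma vintegral_setU (mu : {measure set (borel Z) -> \bar R}) (D A B : set Z) (g : Z -> X) :
  compact D -> (mu D < +oo)%E -> {within D, continuous g} ->
  measurable (A : set (borel Z)) -> measurable (B : set (borel Z)) ->
  D = A `|` B -> [disjoint A & B] ->
  vintegral mu D (g : borel Z -> X) =
  vintegral mu A (g : borel Z -> X) + vintegral mu B (g : borel Z -> X).
Proof.
move=> cD Doo cg mA mB DAB AB; rewrite /vintegral -big_split/=; apply: eq_bigr => i _.
rewrite -scalerDl DAB Rintegral_setU// -DAB.
by apply: within_continuous_integrable => //; exact: coord_within_continuous.
Qed.

End vintegral_theory.

Section picard_gronwall.
Context {R : realType}.

(** A Gronwall inequality for functions that are only known to satisfy an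
    integral inequality on steps of length at most d, short enough for the
    integral to be at most half of a bound S of the integrand.  When p k is the
    k-th difference of Picard iterates, the bound shows geometric convergence;
    when p k does not depend on k, letting k tend to infinity gives the usual
    bound by the initial value m. *)
Lemma picard_gronwall (p : nat -> R -> R) (T d m D : R) :
  0 < d -> 0 <= m -> 0 <= D -> (forall t, 0 <= t <= T -> p 0%N t <= D) ->
  (forall k, p k 0 <= m) ->
  (forall k s t S, 0 <= s <= t -> t <= T -> t - s <= d -> 0 <= S ->
    (forall r, s <= r <= t -> p k r <= S) -> p k.+1 t <= p k.+1 s + S / 2) ->
  forall k i t, 0 <= t <= T -> t <= i.+1%:R * d ->
    p k t <= 2 ^+ i.+1 * m + (2 / 3) ^+ k * 4 ^+ i * D.
Proof.
move=> d0 m0 D0 pD pm pS; elim=> [|k IHk].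
  move=> i t tT _; apply: (le_trans (pD _ tT)).
  rewrite expr0 mul1r -[leLHS]add0r lerD ?mulr_ge0 ?exprn_ge0//.
  by rewrite ler_peMl// exprn_ege1// ler1n.
have c0 : 0 <= (2 / 3 : R) ^+ k by rewrite exprn_ge0// divr_ge0.
elim=> [|i IHi] t /andP[t0 tT]; rewrite ?mul1r => td.
  have := pS k 0 t (2 * m + (2 / 3) ^+ k * D).
  rewrite lexx t0 subr0 => /(_ erefl tT td).
  have -> : 0 <= 2 * m + (2 / 3) ^+ k * D by rewrite addr_ge0// mulr_ge0.
  move=> /(_ erefl) h; rewrite expr1 expr0 mulr1 exprS.
  have : p k.+1 t <= p k.+1 0 + (2 * m + (2 / 3) ^+ k * D) / 2.
    apply: h => r /andP[r0 rt].
    have := IHk 0%N r; rewrite r0 (le_trans rt tT) mul1r (le_trans rt td) expr1 expr0 mulr1.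
    by move=> /(_ erefl erefl).
  move=> /le_trans; apply.
  have := pm k.+1; have : 0 <= (2 / 3) ^+ k * D by rewrite mulr_ge0.
  by set c := (2 / 3) ^+ k; rewrite -mulrA; lra.
have [ti|ti] := leP t (i.+1%:R * d).
  have t01 : 0 <= t <= T by rewrite t0.
  apply: (le_trans (IHi t t01 ti)).
  rewrite lerD// ler_wpM2r//.
    by rewrite ler_weXn2l// ler1n.
  by rewrite ler_wpM2l ?exprn_ge0 ?divr_ge0// ler_weXn2l// ler1n.
set s := i.+1%:R * d in ti.
have s0 : 0 <= s by rewrite mulr_ge0// ltW.
have sT : s <= T by rewrite (le_trans (ltW ti)).
have s01 : 0 <= s <= T by rewrite s0.
have ps := IHi s s01 (lexx _).
have st : 0 <= s <= t by rewrite s0 ltW.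
have tsd : t - s <= d by move: td; rewrite /s -natr1; lra.
set S := 2 ^+ i.+2 * m + (2 / 3) ^+ k * 4 ^+ i.+1 * D.
have q0 : 0 <= (4 : R) ^+ i by rewrite exprn_ge0.
have b0 : 0 <= (2 : R) ^+ i by rewrite exprn_ge0.
have S0 : 0 <= S by rewrite /S !exprS addr_ge0// !mulr_ge0.
have pt : p k.+1 t <= p k.+1 s + S / 2.
  apply: (pS k s t S st tT tsd S0) => r /andP[sr rt].
  apply: IHk; first by rewrite (le_trans s0 sr) (le_trans rt tT).
  exact: le_trans rt td.
apply: (le_trans pt); move: ps; rewrite /S !exprS.
set c := (2 / 3) ^+ k; set b := 2 ^+ i; set q := 4 ^+ i => ps.
have : 0 <= c * q * D by rewrite !mulr_ge0.
lra.
Qed.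

End picard_gronwall.

(** * Trajectories *)

Lemma lipschitz_within_continuous {R : realType} {X : normedModType R} (x : R -> X) :
  (forall T, 0 <= T -> exists C, forall s t, 0 <= s <= t -> t <= T ->
     `|x t - x s| <= C * (t - s)) ->
  {within time, continuous x}.
Proof.
move=> lipx; apply/subspace_continuousP => s s0; apply/cvgrPdist_lt => e e0.
have s10 : 0 <= s + 1 by rewrite addr_ge0.
have [C xC] := lipx _ s10.
have C1 : 0 < `|C| + 1 by rewrite ltr_wpDl.
have d0 : 0 < Num.min 1 (e / (`|C| + 1)) by rewrite lt_min ltr01 divr_gt0.
have : \forall t \near s, `|s - t| < Num.min 1 (e / (`|C| + 1)).
  by have := nbhsx_ballx s _ d0; rewrite -ball_normE.
apply: filterS => t; rewrite lt_min => /andP[st1 ste] t0.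
have key : `|x s - x t| <= C * `|s - t|.
  have [st|/ltW ts] := leP s t.
    have ts1 : t <= s + 1 by rewrite -lerBlDl (le_trans (ler_norm _))// distrC ltW.
    have ts0 : 0 <= t - s by rewrite subr_ge0.
    rewrite distrC (distrC s) (ger0_norm ts0); apply: xC => //.
    by rewrite (s0 : 0 <= s).
  have st0 : 0 <= s - t by rewrite subr_ge0.
  rewrite (ger0_norm st0); apply: xC; last by rewrite lerDl.
  by rewrite (t0 : 0 <= t).
apply: (le_lt_trans key); apply: (@le_lt_trans _ _ ((`|C| + 1) * `|s - t|)).
  by rewrite ler_wpM2r// (le_trans (ler_norm _))// lerDl.
by rewrite mulrC -ltr_pdivlMr.
Qed.

Section trajectories.
Context {R : realType} {X U V : normedVectType R} {P : set U} {Q : set V}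
  {x0 : X} {f : R -> X -> U -> V -> X}.
Hypotheses (compactP : compact P) (compactQ : compact Q)
    (f_cont : {within time `*` [set: X] `*` P `*` Q, continuous
                (fun z : R * X * U * V => f z.1.1.1 z.1.1.2 z.1.2 z.2)})
    (f_lip : forall A : set (R * X), compact A -> A `<=` time `*` [set: X] ->
       exists2 L : R -> R, summable_on time L &
         forall t x1 x2 u v, A (t, x1) -> A (t, x2) -> P u -> Q v ->
           `|f t x1 u v - f t x2 u v| <= L t * `|x1 - x2|)
    (f_growth : exists2 a : R -> R,
       (forall K : set R, compact K -> K `<=` time -> summable_on K a) &
         forall t x u v, time t -> P u -> Q v ->
           `|f t x u v| <= a t * (1 + `|x|)).

Implicit Types (y : R -> X) (eta : {measure set (borel (R * U * V)%type) -> \bar R}).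

Definition control eta := exists2 nu, Pi_Q Q nu & compatible P Q nu eta.

Definition field y (z : R * U * V) : X := f z.1.1 (y z.1.1) z.1.2 z.2.

Definition drift eta t (g : R * U * V -> X) : X :=
  vintegral eta (`[0, t]%classic `*` P `*` Q) (g : borel (R * U * V)%type -> X).

Let slab (s t : R) : set (R * U * V) := `[s, t]%classic `*` P `*` Q.

Let slab_time (s t : R) : 0 <= s -> slab s t `<=` time `*` P `*` Q.
Proof.
by move=> s0 -[[r u] v] [[+ Pu] Qv]; rewrite /= in_itv/= => /andP[/(le_trans s0)].
Qed.

Let within_slab (Y : topologicalType) (s t : R) (g : R * U * V -> Y) : 0 <= s ->
  {within time `*` P `*` Q, continuous g} -> {within slab s t, continuous g}.
Proof. by move=> s0; apply: continuous_subspaceW; exact: slab_time. Qed.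

Let compact_slab' (s t : R) : compact (slab s t).
Proof. exact: compact_slab. Qed.

Let control_slab eta (s t : R) : control eta -> 0 <= s <= t -> eta (slab s t) = (t - s)%:E.
Proof. by move=> [nu nuP etaP] st; exact: (eta_slab compactQ nuP etaP). Qed.

Let control_slab_fin eta (s t : R) : control eta -> 0 <= s <= t -> (eta (slab s t) < +oo)%E.
Proof. by move=> eC st; rewrite control_slab// ltry. Qed.

Lemma field_continuous y : {within time, continuous y} ->
  {within time `*` P `*` Q, continuous (field y)}.
Proof.
move=> cy.
have c1 : {within time `*` P `*` Q, continuous (fun z : R * U * V => z.1.1)}.
  by apply: continuous_subspaceT => z; apply: cvg_comp; [exact: cvg_fst|exact: cvg_fst].
have c2 : {within time `*` P `*` Q, continuous (fun z : R * U * V => z.1.2)}.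
  by apply: continuous_subspaceT => z; apply: cvg_comp; [exact: cvg_fst|exact: cvg_snd].
have c3 : {within time `*` P `*` Q, continuous (fun z : R * U * V => z.2)}.
  by apply: continuous_subspaceT => z; exact: cvg_snd.
have c4 : {within time `*` P `*` Q, continuous (fun z : R * U * V => y z.1.1)}.
  have PQt (z : R * U * V) : (time `*` P `*` Q) z -> time z.1.1 by move=> [[]].
  exact: (continuous_within_comp c1 cy PQt).
apply: (continuous_within_comp (g := fun z : R * U * V => (z.1.1, y z.1.1, z.1.2, z.2)) _ f_cont).
  by do 3 (apply: continuous_within_pair => //).
by move=> z [[? ?] ?].
Qed.

Lemma drift_increment : exists2 C : R, 0 < C & forall eta s t g, control eta -> 0 <= s <= t ->
  {within time `*` P `*` Q, continuous g} ->
  `|drift eta t g - drift eta s g| <= C * \int[eta]_(z in slab s t) `|g z|.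
Proof.
have [C C0 vC] := @norm_vintegral_le R X (R * U * V)%type.
exists C => // eta s t g eC /andP[s0 st] cg.
have t0 : 0 <= t by exact: le_trans st.
pose E : set (R * U * V) := `]s, t]%classic `*` P `*` Q.
have mE : measurable (E : set (borel (R * U * V)%type)).
  by apply: borel_rectPQ => //; exact: borel_compact.
have Et : E `<=` slab s t.
  by move=> -[[r u] v] [[+ Pu] Qv]; split => //; split => //; exact: subset_itv_oc_cc.
have cg0 : {within slab 0 t, continuous g} by exact: within_slab.
have ms : measurable (slab 0 s : set (borel (R * U * V)%type)) by exact: borel_compact.
have mst : measurable (slab s t : set (borel (R * U * V)%type)) by exact: borel_compact.
have fin0t : (eta (slab 0 t) < +oo)%E by apply: control_slab_fin; rewrite ?lexx.
have slabU : slab 0 t = slab 0 s `|` E.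
  rewrite eqEsubset; split => -[[r u] v].
    move=> [[+ Pu] Qv]; rewrite /= in_itv/= => /andP[r0 rt].
    have [rs|sr] := leP r s; [left|right]; split => //; split => //=.
      by rewrite in_itv/= r0.
    by rewrite in_itv/= sr.
  case=> -[[+ Pu] Qv]; rewrite /= in_itv/= => /andP[r1 r2]; split => //; split => //=;
    rewrite in_itv/= ?r1 ?r2 ?(le_trans r2)//.
  by rewrite andbT (le_trans s0)// ltW.
have dis : [disjoint slab 0 s & E].
  apply/disj_setPS => -[[r u] v] [[[+ _] _] [[+ _] _]].
  by rewrite /= !in_itv/= => /andP[_ rs] /andP[]; rewrite ltNge rs.
rewrite /drift -!/(slab _ _).
rewrite (vintegral_setU (@compact_slab' 0 t) fin0t cg0 ms mE slabU dis) addrC addKr.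
apply: (le_trans (vC _ _ _ _ (@compact_slab' 0 t) fin0t cg0 mE _)).
  by rewrite slabU; right.
rewrite ler_pM2l//; apply: fine_le.
- have ig : eta.-integrable (slab s t) (EFin \o (fun z => `|g z|)).
    apply: within_continuous_integrable => //; first by apply: control_slab_fin; rewrite ?s0.
    by apply: norm_within_continuous; exact: within_slab.
  by apply: integrable_fin_num => //; apply: integrableS ig.
- apply: integrable_fin_num => //.
  apply: within_continuous_integrable => //; first by apply: control_slab_fin; rewrite ?s0.
  by apply: norm_within_continuous; exact: within_slab.
- apply: ge0_subset_integral => //; apply/measurable_EFinP.
  apply: within_continuous_measurable.
    exact: (compact_closed (@norm_hausdorff _ _) (@compact_slab' s t)).
  by apply: norm_within_continuous; exact: within_slab.
Qed.

Lemma integral_slab_cst eta s t (M : R) (g : R * U * V -> R) : control eta -> 0 <= s <= t ->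
  {within time `*` P `*` Q, continuous g} -> (forall z, slab s t z -> g z <= M) ->
  \int[eta]_(z in slab s t) g z <= M * (t - s).
Proof.
move=> eC st cg gM; have /andP[s0 _] := st.
have mst : measurable (slab s t : set (borel (R * U * V)%type)) by exact: borel_compact.
have fin := control_slab_fin eC st.
have -> : M * (t - s) = \int[eta]_(z in slab s t) M.
  by rewrite Rintegral_cst// control_slab.
apply: le_Rintegral => //.
- by apply: within_continuous_integrable => //; exact: within_slab.
- by apply: (le_integrable_bounded (C := `|M|)).
Qed.

Lemma drift0 eta g : control eta -> {within time `*` P `*` Q, continuous g} ->
  drift eta 0 g = 0.
Proof.
move=> eC cg; have [C C0 vC] := @norm_vintegral_le R X (R * U * V)%type.
have fin : (eta (slab 0 0) < +oo)%E by apply: control_slab_fin; rewrite ?lexx.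
have cg0 : {within slab 0 0, continuous g} by exact: within_slab.
have mst : measurable (slab 0 0 : set (borel (R * U * V)%type)) by exact: borel_compact.
have := vC eta _ _ _ (@compact_slab' 0 0) fin cg0 mst (fun _ => id).
have cn := norm_within_continuous cg.
have [M _ gM] := within_continuous_bounded (@compact_slab' 0 0) (norm_within_continuous cg0).
have st0 : 0 <= (0 : R) <= 0.
  by rewrite lexx.
have slabM z : slab 0 0 z -> `|g z| <= M by move=> /gM; rewrite normr_id.
have := integral_slab_cst eC st0 cn slabM; rewrite subrr mulr0 => le0 /le_trans.
move=> /(_ 0); rewrite pmulr_rle0// => /(_ le0); rewrite normr_le0 => /eqP.
exact.
Qed.

(** Continuity of f makes the field bounded along bounded paths, so increments
    are bounded by a multiple of t - s; the bound a only gives equicontinuity. *)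
Lemma drift_lipschitz (T B : R) : exists C : R, forall eta y s t, control eta ->
  {within time, continuous y} -> (forall r, 0 <= r <= T -> `|y r| <= B) ->
  0 <= s <= t -> t <= T ->
  `|drift eta t (field y) - drift eta s (field y)| <= C * (t - s).
Proof.
have [C C0 dC] := drift_increment.
pose D : set (R * X * U * V) := `[0, T]%classic `*` [set x | `|x| <= B] `*` P `*` Q.
have cD : compact D.
  do 2 (apply: compact_setX => //); apply: compact_setX; first exact: segment_compact.
  exact: closed_ball0_compact.
have DT : D `<=` time `*` [set: X] `*` P `*` Q.
  by move=> z [[[+ _] Pu] Qv]; rewrite /= in_itv/= => /andP[].
have cf : {within D, continuous (fun z : R * X * U * V => `|f z.1.1.1 z.1.1.2 z.1.2 z.2|)}.
  by apply: norm_within_continuous; exact: continuous_subspaceW f_cont.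
have [M M0 fM] := within_continuous_bounded cD cf.
exists (C * M) => eta y s t eC cy yB st tT; have /andP[s0 _] := st.
apply: (le_trans (dC _ _ _ _ eC st (field_continuous cy))).
rewrite -mulrA ler_pM2l//; apply: integral_slab_cst => //.
  by apply: norm_within_continuous; exact: field_continuous.
move=> [[r u] v] [[+ Pu] Qv]; rewrite /= in_itv/= => /andP[sr rt].
have rT : 0 <= r <= T by rewrite (le_trans s0 sr) (le_trans rt tT).
have := fM (r, y r, u, v); rewrite normr_id; apply; split => //; split => //; split => /=.
  by rewrite in_itv.
exact: yB.
Qed.

(** The form of the linear growth condition required by [picard_gronwall]. *)
Lemma growth_step (T : R) : exists2 d : R, 0 < d & forall eta y s t S, control eta ->
  {within time, continuous y} -> 0 <= s <= t -> t <= T -> t - s <= d -> 0 <= S ->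
  (forall r, s <= r <= t -> 1 + `|y r| <= S) ->
  `|drift eta t (field y) - drift eta s (field y)| <= S / 2.
Proof.
have [C C0 dC] := drift_increment; have [a ia fa] := f_growth.
have C20 : 0 < (2 * C)^-1 by rewrite invr_gt0 mulr_gt0.
have iaT : summable_on `[0, T]%classic a.
  by apply: ia; [exact: segment_compact|exact: itv0_time].
have [d d0 ad] := integral_continuity_modulus iaT C20.
exists d => // eta y s t S eC cy st tT tsd S0 yS; have /andP[s0 _] := st.
apply: (le_trans (dC _ _ _ _ eC st (field_continuous cy))).
have [nu nuP etaP] := eC.
have ist : summable_on `[s, t]%classic a.
  apply: ia; first exact: segment_compact.
  by move=> r; rewrite /= in_itv/= => /andP[/(le_trans s0)].
have le1 : \int[eta]_(z in slab s t) `|field y z| <=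
    S * \int[completed_lebesgue_measure]_(r in `[s, t]) `|a r|.
  apply: (integral_slab_le compactP compactQ nuP etaP st S0 ist).
    by apply: norm_within_continuous; apply: within_slab => //; exact: field_continuous.
  move=> [[r u] v] sl; rewrite normr_ge0/=; have [[/= r0 Pu] Qv] := slab_time s0 sl.
  have [[/=]] := sl; rewrite in_itv/= => srt _ _.
  apply: (le_trans (fa _ _ _ _ r0 Pu Qv)).
  apply: (@le_trans _ _ (`|a r| * (1 + `|y r|))).
    by rewrite ler_wpM2r ?addr_ge0// ler_norm.
  by rewrite [leRHS]mulrC ler_wpM2l// yS.
apply: (@le_trans _ _ (C * (S * (2 * C)^-1))); last first.
  by rewrite (_ : C * _ = S / 2)//; field; rewrite gt_eqF.
rewrite ler_pM2l//; apply: (le_trans le1); rewrite ler_wpM2l// ltW//.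
exact: ad.
Qed.

(** The form of the Lipschitz condition required by [picard_gronwall]. *)
Lemma lipschitz_step (T B : R) : exists2 d : R, 0 < d & forall eta y1 y2 s t S, control eta ->
  {within time, continuous y1} -> {within time, continuous y2} ->
  (forall r, 0 <= r <= T -> `|y1 r| <= B) -> (forall r, 0 <= r <= T -> `|y2 r| <= B) ->
  0 <= s <= t -> t <= T -> t - s <= d -> 0 <= S ->
  (forall r, s <= r <= t -> `|y1 r - y2 r| <= S) ->
  `|(drift eta t (field y1) - drift eta t (field y2)) -
    (drift eta s (field y1) - drift eta s (field y2))| <= S / 2.
Proof.
have [C C0 dC] := drift_increment.
pose A : set (R * X) := `[0, T]%classic `*` [set x | `|x| <= B].
have cA : compact A.
  by apply: compact_setX; [exact: segment_compact|exact: closed_ball0_compact].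
have At : A `<=` time `*` [set: X] by move=> [r x] [/itv0_time].
have [L iL fL] := f_lip cA At.
have C20 : 0 < (2 * C)^-1 by rewrite invr_gt0 mulr_gt0.
have mtime : measurable (@time R : set (caratheodory_type (wlength (@idfun R))^*%mu)).
  by apply: measurable_completed; apply: closed_measurable; exact: closed_time.
have subL (s t : R) : 0 <= s -> summable_on `[s, t]%classic L.
  move=> s0; apply: (integrableS mtime _ _ iL).
    by apply: measurable_completed; exact: measurable_itv.
  by move=> r; rewrite /= in_itv/= => /andP[/(le_trans s0)].
have [d d0 Ld] := integral_continuity_modulus (subL 0 T (lexx 0)) C20.
exists d => // eta y1 y2 s t S eC cy1 cy2 y1B y2B st tT tsd S0 yS.
have /andP[s0 le_st] := st; have t0 : 0 <= t by exact: le_trans le_st.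
have cf1 := field_continuous cy1; have cf2 := field_continuous cy2.
have cg : {within time `*` P `*` Q, continuous (fun z => field y1 z - field y2 z)}.
  by move=> z; apply: cvgB; [exact: cf1|exact: cf2].
have driftB r : 0 <= r -> drift eta r (field y1) - drift eta r (field y2) =
    drift eta r (fun z => field y1 z - field y2 z).
  move=> r0; apply: vintegralB; [exact: compact_slab'| |exact: within_slab..].
  by apply: control_slab_fin; rewrite ?lexx.
rewrite !driftB//; apply: (le_trans (dC _ _ _ _ eC st cg)).
have [nu nuP etaP] := eC.
have le1 : \int[eta]_(z in slab s t) `|field y1 z - field y2 z| <=
    S * \int[completed_lebesgue_measure]_(r in `[s, t]) `|L r|.
  apply: (integral_slab_le compactP compactQ nuP etaP st S0 (subL _ _ s0)).
    by apply: norm_within_continuous; exact: within_slab.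
  move=> [[r u] v] sl; rewrite normr_ge0/=; have [[/= r0 Pu] Qv] := slab_time s0 sl.
  have [[/=]] := sl; rewrite in_itv/= => srt _ _.
  have rT : 0 <= r <= T by have /andP[_ rt] := srt; rewrite (r0 : 0 <= r) (le_trans rt).
  have A1 : A (r, y1 r) by split; [rewrite /= in_itv|exact: y1B].
  have A2 : A (r, y2 r) by split; [rewrite /= in_itv|exact: y2B].
  apply: (le_trans (fL _ _ _ _ _ A1 A2 Pu Qv)).
  apply: (@le_trans _ _ (`|L r| * `|y1 r - y2 r|)).
    by rewrite ler_wpM2r// ler_norm.
  by rewrite [leRHS]mulrC ler_wpM2l// yS.
apply: (@le_trans _ _ (C * (S * (2 * C)^-1))); last first.
  by rewrite (_ : C * _ = S / 2)//; field; rewrite gt_eqF.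
rewrite ler_pM2l//; apply: (le_trans le1); rewrite ler_wpM2l// ltW//.
exact: Ld.
Qed.

Let geometric_le (a b c : R) : (forall k, a <= b + (2 / 3) ^+ k * c) -> a <= b.
Proof.
move=> ab; have c0 : (fun k : nat => (2 / 3 : R) ^+ k) @ \oo --> (0 : R).
  by apply: cvg_expr; rewrite ger0_norm ?divr_ge0// ltr_pdivrMr// mul1r ltr_nat.
have bc : (fun k : nat => b + (2 / 3) ^+ k * c) @ \oo --> b.
  rewrite -[X in _ --> X]addr0 -(mul0r c); apply: cvgD; first exact: cvg_cst.
  by apply: cvgM => //; exact: cvg_cst.
rewrite -(cvg_lim _ bc)//; apply: limr_ge; first exact: cvgP bc.
exact: nearW.
Qed.

Let step_count (T d : R) : 0 < d -> exists i : nat, T <= i.+1%:R * d.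
Proof.
move=> d0; exists (Num.truncn (T / d)).
by rewrite -ler_pdivrMr// ltW// truncnS_gt.
Qed.

Let path_bounded y T : {within time, continuous y} -> exists B, forall t, 0 <= t <= T -> `|y t| <= B.
Proof.
move=> cy; have cyT : {within `[0, T], continuous (fun t => `|y t|)}.
  by apply: norm_within_continuous; apply: continuous_subspaceW cy; exact: itv0_time.
have [B _ yB] := within_continuous_bounded (@segment_compact _ 0 T) cyT.
by exists B => t tT; have := yB t; rewrite normr_id; apply; rewrite /= in_itv.
Qed.

Lemma trajectory_drift eta x t : trajectory f x0 P Q eta x -> 0 <= t ->
  x t = x0 + drift eta t (field x).
Proof. by move=> [_ xE] t0; exact: xE. Qed.

Lemma trajectory_bounded T : exists B, forall eta x, control eta ->
  trajectory f x0 P Q eta x -> forall t, 0 <= t <= T -> `|x t| <= B.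
Proof.
have [d d0 step] := growth_step T; have [i Ti] := step_count T d0.
exists (2 ^+ i.+1 * (1 + `|x0|)) => eta x eC xP t tT.
have [cx xE] := xP.
have [B xB] := path_bounded T cx.
have m0 : 0 <= 1 + `|x0| by rewrite addr_ge0.
suff : 1 + `|x t| <= 2 ^+ i.+1 * (1 + `|x0|) by apply: le_trans; rewrite lerDr.
apply: (@geometric_le _ _ (4 ^+ i * (1 + `|B|))) => k; rewrite mulrA.
apply: (@picard_gronwall R (fun _ t => 1 + `|x t|) T d _ (1 + `|B|) d0 m0) => //.
- by move=> s sT; rewrite lerD2l (le_trans (xB _ sT))// ler_norm.
- move=> _; rewrite (trajectory_drift xP (lexx 0)) drift0 ?addr0//.
  exact: field_continuous.
- move=> _ s r S sr rT rsd S0 xS; have /andP[s0 le_sr] := sr.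
  have := step _ _ _ _ _ eC cx sr rT rsd S0 xS.
  rewrite -addrA lerD2l -lerBlDl => le1; apply: le_trans le1.
  have -> : drift eta r (field x) - drift eta s (field x) = x r - x s.
    by rewrite !(trajectory_drift xP) ?(le_trans s0)// opprD addrACA subrr add0r.
  exact: lerB_dist.
- by apply: le_trans Ti; have /andP[] := tT.
Qed.

Lemma trajectory_unique eta x y T : control eta ->
  trajectory f x0 P Q eta x -> trajectory f x0 P Q eta y -> 0 <= T -> x T = y T.
Proof.
move=> eC xP yP T0; have [cx _] := xP; have [cy _] := yP.
have [B bB] := trajectory_bounded T.
have xB := bB _ _ eC xP; have yB := bB _ _ eC yP.
have [d d0 step] := lipschitz_step T B; have [i Ti] := step_count T d0.
have TT : 0 <= T <= T by rewrite T0 lexx.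
have B0 : 0 <= B by apply: le_trans (xB _ TT).
apply/eqP; rewrite -subr_eq0 -normr_le0.
apply: (@geometric_le _ _ (4 ^+ i * (B + B))) => k; rewrite mulrA.
rewrite -[X in _ <= X + _](mulr0 (2 ^+ i.+1)).
apply: (@picard_gronwall R (fun _ t => `|x t - y t|) T d 0 (B + B) d0 (lexx 0)) => //.
- by rewrite addr_ge0.
- by move=> s sT; rewrite (le_trans (ler_normB _ _))// lerD ?xB ?yB.
- move=> _; rewrite (trajectory_drift xP (lexx 0)) (trajectory_drift yP (lexx 0)).
  by rewrite !drift0 ?subrr ?normr0//; exact: field_continuous.
- move=> _ s r S sr rT rsd S0 xS; have /andP[s0 le_sr] := sr.
  have r0 : 0 <= r by exact: le_trans le_sr.
  have := step _ _ _ _ _ _ eC cx cy xB yB sr rT rsd S0 xS.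
  rewrite -lerBlDl => le1; apply: le_trans le1.
  have dE u : 0 <= u -> drift eta u (field x) - drift eta u (field y) = x u - y u.
    by move=> u0; rewrite (trajectory_drift xP u0) (trajectory_drift yP u0) opprD addrACA subrr add0r.
  by rewrite !dE//; exact: lerB_dist.
Qed.

Lemma drift_continuous eta y : control eta -> {within time, continuous y} ->
  {within time, continuous (fun t => x0 + drift eta t (field y))}.
Proof.
move=> eC cy; apply: lipschitz_within_continuous => T T0.
have [B yB] := path_bounded T cy; have [C dC] := drift_lipschitz T B.
exists C => s t st tT; rewrite opprD addrACA subrr add0r.
exact: dC.
Qed.

Definition weak_cvg (F : set_system nat)
    (eta_ : nat -> {measure set (borel (R * U * V)%type) -> \bar R}) eta : Prop :=
  forall (t : R) (g : R * U * V -> R), 0 <= t ->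
    {within `[0, t]%classic `*` P `*` Q, continuous g} ->
    \int[eta_ n]_(z in `[0, t]%classic `*` P `*` Q) g z @[n --> F] -->
    \int[eta]_(z in `[0, t]%classic `*` P `*` Q) g z.

(** The paths x n are integrals along paths w n which become uniformly close to
    them: this covers both a sequence of trajectories, with w n = x n, and the
    Picard iterates, with w n the iterate which precedes x n. *)
Section limit.
Context {F : set_system nat} {UF : UltraFilter F}.
Context {eta_ : nat -> {measure set (borel (R * U * V)%type) -> \bar R}}
  {eta : {measure set (borel (R * U * V)%type) -> \bar R}} {w x : nat -> R -> X}.
Hypotheses (eta_C : forall n, control (eta_ n))
  (eta_cvg : weak_cvg F eta_ eta)
  (w_continuous : forall n, {within time, continuous (w n)})
  (xE : forall n t, 0 <= t -> x n t = x0 + drift (eta_ n) t (field (w n)))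
  (w_bounded : forall T, exists B, forall n t, 0 <= t <= T -> `|w n t| <= B)
  (xw : forall T e, 0 < e -> \forall n \near F, forall t, 0 <= t <= T -> `|x n t - w n t| <= e).

Let x_lipschitz T : exists C, forall n s t, 0 <= s <= t -> t <= T ->
  `|x n t - x n s| <= C * (t - s).
Proof.
have [B wB] := w_bounded T; have [C dC] := drift_lipschitz T B.
exists C => n s t st tT; have /andP[s0 le_st] := st.
rewrite !xE ?(le_trans s0)// opprD addrACA subrr add0r.
by apply: dC => //; exact: wB.
Qed.

Let limit_exists : exists y : R -> X, forall t, 0 <= t -> x n t @[n --> F] --> y t.
Proof.
suff H : forall t : R, exists p : X, 0 <= t -> x n t @[n --> F] --> p.
  by have [y xy] := choice H; exists y.
move=> t; have [t0|_] := leP 0 t; last by exists 0.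
have [C xC] := x_lipschitz t.
have xB n : [set q : X | `|q| <= C * t + `|x0|] (x n t).
  have := xC n 0 t; rewrite lexx t0 subr0 => /(_ erefl (lexx _)).
  rewrite [x n 0]xE// drift0//; last exact: field_continuous.
  rewrite addr0 => le1; rewrite /= -lerBlDr; apply: le_trans le1.
  exact: lerB_dist.
have [p _ xp] := ultra_compact_cvg UF (@closed_ball0_compact _ X _) xB.
by exists p.
Qed.

(** The limit y exists at each time by compactness, and the common Lipschitz
    constant makes the convergence uniform.  Then the fields along w n converge
    uniformly to the field along y, whose integrals for eta_ n converge. *)
Lemma trajectory_limit : exists2 y, trajectory f x0 P Q eta y &
  forall T e, 0 < e -> \forall n \near F, forall t, 0 <= t <= T -> `|x n t - y t| <= e.
Proof.
have [y xy] := limit_exists.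
have y_lipschitz T : exists C, forall s t, 0 <= s <= t -> t <= T ->
    `|y t - y s| <= C * (t - s).
  have [C xC] := x_lipschitz T; exists C => s t st tT; have /andP[s0 le_st] := st.
  have cvg_diff : `|x n t - x n s| @[n --> F] --> `|y t - y s|.
    by apply: cvg_norm; apply: cvgB; apply: xy => //; exact: le_trans le_st.
  rewrite -(cvg_lim _ cvg_diff)//; apply: limr_le; first exact: cvgP cvg_diff.
  by apply: nearW => n; exact: xC.
have cy : {within time, continuous y}.
  by apply: lipschitz_within_continuous => T T0; exact: y_lipschitz.
have unif_x T e : 0 < e -> \forall n \near F, forall t, 0 <= t <= T -> `|x n t - y t| <= e.
  move=> e0; have [C1 xC] := x_lipschitz T; have [C2 yC] := y_lipschitz T.
  have e30 : 0 < e / 3 by rewrite divr_gt0.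
  have near_lip (K : R) (t : R) : \forall t' \near t, `|K| * `|t - t'| <= e / 3.
    have K1 : 0 < `|K| + 1 by rewrite ltr_wpDl.
    have d0 : 0 < e / 3 / (`|K| + 1) by rewrite divr_gt0.
    have := nbhsx_ballx t _ d0; rewrite -ball_normE; apply: filterS => t' /= tt'.
    apply: (@le_trans _ _ ((`|K| + 1) * `|t - t'|)); first by rewrite ler_wpM2r// lerDl.
    by rewrite mulrC -ler_pdivlMr// ltW.
  have sym (z : R -> X) (K : R) :
      (forall s t, 0 <= s <= t -> t <= T -> `|z t - z s| <= K * (t - s)) ->
      forall s t, 0 <= s <= T -> 0 <= t <= T -> `|z s - z t| <= `|K| * `|s - t|.
    move=> zK s t /andP[s0 sT] /andP[t0 tT]; have [st|/ltW ts] := leP s t.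
      rewrite distrC (distrC s); apply: (@le_trans _ _ (K * (t - s))).
        by apply: zK => //; rewrite s0.
      by rewrite (le_trans (ler_norm _))// normrM.
    apply: (@le_trans _ _ (K * (s - t))); first by apply: zK => //; rewrite t0.
    by rewrite (le_trans (ler_norm _))// normrM.
  have cover (t : R) : `[0, T]%classic t -> \forall t' \near t & n \near F,
      0 <= t' <= T -> `|x n t' - y t'| <= e.
    rewrite /= in_itv/= => tT; have /andP[t0 _] := tT.
    have xyt : \forall n \near F, `|y t - x n t| < e / 3.
      by move/cvgrPdist_lt : (xy t t0); exact.
    near=> t' n.
    have l1 : `|C1| * `|t - t'| <= e / 3 by near: t'; exact: near_lip.
    have l2 : `|C2| * `|t - t'| <= e / 3 by near: t'; exact: near_lip.
    have l3 : `|y t - x n t| < e / 3 by near: n; exact: xyt.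
    move=> t'T; rewrite (_ : e = e / 3 + (e / 3 + e / 3)); last by field.
    rewrite (le_trans (ler_distD (x n t) _ _))// lerD//.
      by rewrite distrC; apply: (le_trans (sym _ _ (xC n) _ _ tT t'T)).
    rewrite (le_trans (ler_distD (y t) _ _))// lerD//; first by rewrite distrC ltW.
    exact: (le_trans (sym _ _ yC _ _ tT t'T)).
  have /compact_near_coveringP/(_ nat F _ _ cover) := @segment_compact _ 0 T.
  apply: filterS => n nP t tT; apply: nP => //.
have unif_w T e : 0 < e -> \forall n \near F, forall t, 0 <= t <= T -> `|w n t - y t| <= e.
  move=> e0; have e20 : 0 < e / 2 by rewrite divr_gt0.
  apply: filterS2 (unif_x T _ e20) (xw T e20) => n nx nw t tT.
  rewrite (splitr e) (le_trans (ler_distD (x n t) _ _))// lerD ?nx//.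
  by rewrite distrC nw.
have unif_field T e : 0 < e -> \forall n \near F, forall z, slab 0 T z ->
    `|field (w n) z - field y z| <= e.
  move=> e0; have e20 : 0 < e / 2 by rewrite divr_gt0.
  have cover (z : R * U * V) : slab 0 T z -> \forall z' \near z & n \near F,
      slab 0 T z' -> `|field (w n) z' - field y z'| <= e.
    move=> sz; have [[z0 Pz] Qz] := slab_time (lexx 0) sz.
    pose q : R * X * U * V := (z.1.1, y z.1.1, z.1.2, z.2).
    have Dq : (time `*` [set: X] `*` P `*` Q) q by [].
    have /cvgrPdist_lt/(_ _ e20) := (subspace_continuousP _ _).1 f_cont q Dq.
    rewrite /within/= => /nbhs_ballP[r /= r0 qr].
    have r20 : 0 < r / 2 by rewrite divr_gt0.
    have yr : \forall t \near z.1.1, time t -> `|y z.1.1 - y t| < r / 2.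
      by have /cvgrPdist_lt/(_ _ r20) := (subspace_continuousP _ _).1 cy _ z0.
    have yrz : \forall z' \near z, time z'.1.1 -> `|y z.1.1 - y z'.1.1| < r / 2.
      have c1 : (fun z' : R * U * V => z'.1.1) @ z --> z.1.1.
        by apply: cvg_comp; [exact: cvg_fst|exact: cvg_fst].
      exact: c1 yr.
    have wr := unif_w T _ r20.
    near=> z' n.
    have zz' : ball z r z' by near: z'; exact: nbhsx_ballx.
    have yz' : time z'.1.1 -> `|y z.1.1 - y z'.1.1| < r / 2 by near: z'; exact: yrz.
    have wy : forall t, 0 <= t <= T -> `|w n t - y t| <= r / 2 by near: n; exact: wr.
    move=> sz'; have [[z'0 Pz'] Qz'] := slab_time (lexx 0) sz'.
    have z'T : 0 <= z'.1.1 <= T by have [[]] := sz'; rewrite /= in_itv.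
    have {}yz' := yz' z'0; have {}wy := wy _ z'T.
    have [[b1 b2] b3] := zz'.
    have qy : ball q r (z'.1.1, y z'.1.1, z'.1.2, z'.2).
      split => //; split => //; split => //=.
      by rewrite -ball_normE/= (lt_le_trans yz')// ler_pdivrMr// ler_peMr// ?ler1n// ltW.
    have qw : ball q r (z'.1.1, w n z'.1.1, z'.1.2, z'.2).
      split => //; split => //; split => //=.
      rewrite -ball_normE/= (splitr r) (le_lt_trans (ler_distD (y z'.1.1) _ _))//.
      by rewrite ltr_leD// distrC.
    have ey := qr _ qy (conj (conj (conj z'0 I) Pz') Qz').
    have ew := qr _ qw (conj (conj (conj z'0 I) Pz') Qz').
    rewrite (splitr e) (le_trans (ler_distD (field y z) _ _))// lerD//.
      by rewrite distrC ltW.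
    exact: ltW.
  have /compact_near_coveringP/(_ nat F _ _ cover) := @compact_slab' 0 T.
  by apply: filterS => n nP z sz; exact: nP.
exists y; last exact: unif_x.
split => // t t0.
have slab0 : 0 <= (0 : R) <= t by rewrite lexx.
have drift_y : drift (eta_ n) t (field y) @[n --> F] --> drift eta t (field y).
  rewrite /drift /vintegral; apply: cvg_big; first exact: add_continuous.
  move=> i _; apply: cvgZr_tmp; apply: eta_cvg => //.
  by apply: coord_within_continuous; apply: within_slab => //; exact: field_continuous.
have [C C0 dC] := drift_increment.
have drift_w : drift (eta_ n) t (field (w n)) - drift (eta_ n) t (field y) @[n --> F] --> 0.
  apply/cvgr0Pnorm_le => e e0.
  have e'0 : 0 < e / (C * (t + 1)) by rewrite divr_gt0// mulr_gt0// ltr_wpDl.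
  apply: filterS (unif_field t _ e'0) => n nP.
  have cg : {within time `*` P `*` Q, continuous (fun z => field (w n) z - field y z)}.
    by move=> z; apply: cvgB; exact: field_continuous.
  have -> : drift (eta_ n) t (field (w n)) - drift (eta_ n) t (field y) =
      drift (eta_ n) t (fun z => field (w n) z - field y z).
    apply: vintegralB; [exact: compact_slab'|exact: control_slab_fin| |];
      by apply: within_slab => //; exact: field_continuous.
  have := dC _ _ _ _ (eta_C n) slab0 cg; rewrite drift0// subr0 => /le_trans; apply.
  have := integral_slab_cst (eta_C n) slab0 (norm_within_continuous cg) nP.
  rewrite subr0 -(ler_pM2l C0) => /le_trans; apply.
  rewrite -[leRHS](@divfK _ (C * (t + 1))) ?gt_eqF ?mulr_gt0 ?ltr_wpDl//.
  rewrite mulrCA ler_pM2l// ler_pM2l// lerDl//.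
have cvg_sum : x n t @[n --> F] --> x0 + drift eta t (field y).
  rewrite (_ : (fun n => _) = (fun n => x0 + ((drift (eta_ n) t (field (w n)) -
    drift (eta_ n) t (field y)) + drift (eta_ n) t (field y)))); last first.
    by apply/funext => n; rewrite subrK xE.
  apply: cvgD; first exact: cvg_cst.
  by rewrite -[X in _ --> X]add0r; apply: cvgD.
by rewrite -(cvg_lim _ (xy t t0))// (cvg_lim _ cvg_sum).
Unshelve. all: by end_near.
Qed.

End limit.

(** The differences of Picard iterates decrease geometrically, so that the limit
    of the iterates along an ultrafilter is a trajectory. *)
Lemma trajectory_exists eta : control eta -> exists x, trajectory f x0 P Q eta x.
Proof.
move=> eC; have [F [UF ooF]] := ultraFilterLemma (_ : ProperFilter \oo).
pose Phi y t := x0 + drift eta t (field y).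
pose y k := iter k Phi (fun=> x0).
have cy k : {within time, continuous (y k)}.
  elim: k => [|k IH]; last exact: drift_continuous.
  by apply: continuous_subspaceT => t; exact: cvg_cst.
have yS k t : y k.+1 t = x0 + drift eta t (field (y k)) by [].
have y0 k : y k 0 = x0.
  by case: k => // k; rewrite yS drift0 ?addr0//; exact: field_continuous.
have dE k s t : y k.+1 t - y k.+1 s = drift eta t (field (y k)) - drift eta s (field (y k)).
  by rewrite !yS opprD addrACA subrr add0r.
have y_bounded T : exists B, forall k t, 0 <= t <= T -> `|y k t| <= B.
  have [d d0 step] := growth_step T; have [i Ti] := step_count T d0.
  have m0 : 0 <= 1 + `|x0| by rewrite addr_ge0.
  exists (2 ^+ i.+1 * (1 + `|x0|) + 4 ^+ i * (1 + `|x0|)) => k t tT.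
  suff : 1 + `|y k t| <= 2 ^+ i.+1 * (1 + `|x0|) + 4 ^+ i * (1 + `|x0|).
    by apply: le_trans; rewrite lerDr.
  apply: (@le_trans _ _ (2 ^+ i.+1 * (1 + `|x0|) + (2 / 3) ^+ k * 4 ^+ i * (1 + `|x0|))); last first.
    rewrite lerD2l ler_wpM2r// ler_piMl ?exprn_ge0// exprn_ile1// ?divr_ge0//.
    by rewrite ler_pdivrMr// mul1r ler_nat.
  apply: (@picard_gronwall R (fun k t => 1 + `|y k t|) T d _ (1 + `|x0|) d0 m0) => //.
  - by move=> j; rewrite y0.
  - move=> j s r S sr rT rsd S0 yS'; have /andP[s0 le_sr] := sr.
    have := step _ _ _ _ _ eC (cy j) sr rT rsd S0 yS'.
    rewrite -addrA lerD2l -lerBlDl => le1; apply: le_trans le1.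
    by rewrite -dE; exact: lerB_dist.
  - by apply: le_trans Ti; have /andP[] := tT.
have y_decay T e : 0 < e -> \forall k \near F, forall t, 0 <= t <= T -> `|y k.+1 t - y k t| <= e.
  move=> e0; have [B yB] := y_bounded T.
  have [d d0 step] := lipschitz_step T B; have [i Ti] := step_count T d0.
  have yD t k : 0 <= t <= T -> `|y k.+1 t - y k t| <= (2 / 3) ^+ k * 4 ^+ i * (`|B| + `|B|).
    move=> tT; rewrite -[leRHS]add0r -[X in _ <= X + _](mulr0 (2 ^+ i.+1)).
    apply: (@picard_gronwall R (fun k t => `|y k.+1 t - y k t|) T d 0 (`|B| + `|B|) d0 (lexx 0)) => //.
    - by move=> s sT; rewrite (le_trans (ler_normB _ _))// lerD// (le_trans (yB _ _ sT)) ?ler_norm.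
    - by move=> j; rewrite !y0 subrr normr0.
    - move=> j s r S sr rT rsd S0 yS'; have /andP[s0 le_sr] := sr.
      have := step _ _ _ _ _ _ eC (cy j.+1) (cy j) (yB j.+1) (yB j) sr rT rsd S0 yS'.
      rewrite -lerBlDl => le1; apply: le_trans le1.
      have E r' : drift eta r' (field (y j.+1)) - drift eta r' (field (y j)) = y j.+2 r' - y j.+1 r'.
        by rewrite !yS opprD addrACA subrr add0r.
      by rewrite !E; exact: lerB_dist.
    - by apply: le_trans Ti; have /andP[] := tT.
  have c0 : (fun k : nat => (2 / 3 : R) ^+ k * (4 ^+ i * (`|B| + `|B|))) @ \oo --> (0 : R).
    rewrite -(mul0r (4 ^+ i * (`|B| + `|B|))); apply: cvgM; last exact: cvg_cst.
    by apply: cvg_expr; rewrite ger0_norm ?divr_ge0// ltr_pdivrMr// mul1r ltr_nat.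
  apply: ooF; move/cvgr0Pnorm_le : c0 => /(_ _ e0).
  apply: filterS => k ke t tT; apply: (le_trans (yD _ _ tT)).
  by rewrite -mulrA (le_trans (ler_norm _)).
have eta_cvg : weak_cvg F (fun=> eta) eta by move=> t g _ _; exact: cvg_cst.
have [x xP _] := trajectory_limit (fun=> eC) eta_cvg cy
  (fun k t _ => yS k t) y_bounded y_decay.
by exists x.
Qed.

Lemma trajectory_cvg (F : set_system nat) (UF : UltraFilter F)
    (eta_ : nat -> {measure set (borel (R * U * V)%type) -> \bar R}) eta
    (x_ : nat -> R -> X) :
  (forall n, control (eta_ n)) -> weak_cvg F eta_ eta ->
  (forall n, trajectory f x0 P Q (eta_ n) (x_ n)) ->
  exists2 x, trajectory f x0 P Q eta x &
  forall T e, 0 < e -> \forall n \near F, forall t, 0 <= t <= T -> `|x_ n t - x t| <= e.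
Proof.
move=> eta_C eta_cvg x_P.
apply: (trajectory_limit eta_C eta_cvg (w := x_)).
- by move=> n; have [] := x_P n.
- by move=> n t; exact: trajectory_drift.
- move=> T; have [B bB] := trajectory_bounded T; exists B => n.
  exact: bB.
- by move=> T e e0; apply: nearW => n t _; rewrite subrr normr0 ltW.
Qed.

End trajectories.

Arguments control {R U V} P Q eta.
Arguments weak_cvg {R U V} P Q F eta_ eta.

(** * Densities and projections *)

Section density.
Context {d : measure_display} {T : measurableType d} {R : realType}.
Local Open Scope ereal_scope.
Import HBNNSimple.

Lemma density_measure (mu : {measure set T -> \bar R}) (h : T -> \bar R) :
  measurable_fun setT h -> (forall x, 0 <= h x) -> (forall x, h x \is a fin_num) ->
  exists m : {measure set T -> \bar R},
    (forall A, m A = \int[mu]_(x in A) h x) /\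
    forall D (f : T -> \bar R), measurable D -> measurable_fun D f ->
      (forall x, D x -> 0 <= f x) ->
      \int[m]_(x in D) f x = \int[mu]_(x in D) (f x * h x).
Proof.
move=> mh h0 hfin.
pose m0 A := \int[mu]_(x in A) h x.
have m00 : m0 set0 = 0 by exact: integral_set0.
have m0_ge0 A : 0 <= m0 A by exact: integral_ge0.
pose m : {measure set T -> \bar R} := HB.pack m0
  (isMeasure.Build _ T R m0 m00 m0_ge0 (semi_sigma_additive_nng_induced mh h0)).
exists m; split=> // D f mD mf f0.
have mhD A : measurable_fun A h by exact: measurable_funTS.
pose f_ := nnsfun_approx mD mf.
have intf_ n : \int[m]_(x in D) (f_ n x)%:E = \int[mu]_(x in D) ((f_ n x)%:E * h x).
  have mfn r : measurable (f_ n @^-1` [set r]) by [].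
  under eq_integral do rewrite fimfunE -fsumEFin//.
  under [in RHS]eq_integral => x _.
    rewrite fimfunE -fsumEFin// ge0_mule_fsuml; last first.
      by move=> r; rewrite nnfun_muleindic_ge0.
    over.
  rewrite ge0_integral_fsum//; last 2 first.
  - by move=> r; exact/measurable_EFinP/measurable_funM.
  - by move=> r x _; rewrite nnfun_muleindic_ge0.
  rewrite ge0_integral_fsum//; last 2 first.
  - move=> r; apply: emeasurable_funM => //.
    exact/measurable_EFinP/measurable_funM.
  - by move=> r x _; rewrite mule_ge0// nnfun_muleindic_ge0.
  apply: eq_fsbigr => r rf.
  have r0 : (0 <= r)%R by move: rf; rewrite inE => -[x _ <-].
  rewrite integralZl_indic_nnsfun// integral_indic//.
  under [in RHS]eq_integral do rewrite EFinM -muleA.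
  rewrite ge0_integralZl_EFin//; last 2 first.
  - by move=> x _; rewrite mule_ge0// lee_fin.
  - by apply: emeasurable_funM => //; apply/measurable_EFinP.
  congr (_ * _); rewrite -[LHS]/(\int[mu]_(x in _) h x) setIC integral_mkcondr.
  apply: eq_integral => x _; rewrite patchE indicE.
  by case: (x \in _); rewrite ?mul1e ?mul0e.
transitivity (limn (fun n => \int[m]_(x in D) (f_ n x)%:E)).
  rewrite -monotone_convergence//.
  - apply: eq_integral => y /[!inE] yD; apply/esym/cvg_lim => //.
    exact: cvg_nnsfun_approx.
  - by move=> n; exact/measurable_EFinP/measurable_funP.
  - by move=> n y _; rewrite lee_fin.
  - by move=> y _ i j ij; rewrite lee_fin; exact/lefP/nd_nnsfun_approx.
rewrite (_ : (fun n => _) = (fun n => \int[mu]_(x in D) ((f_ n x)%:E * h x))); last first.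
  by apply/funext => n; exact: intf_.
rewrite -monotone_convergence//.
- apply: eq_integral => y /[!inE] yD; apply/cvg_lim => //.
  by apply: cvgeZr; [exact: hfin|exact: cvg_nnsfun_approx].
- move=> n; apply: emeasurable_funM => //.
  exact/measurable_EFinP/measurable_funP.
- by move=> n y _; rewrite mule_ge0// lee_fin.
- move=> y _ i j ij; rewrite lee_wpmul2r// lee_fin; exact/lefP/nd_nnsfun_approx.
Qed.

End density.

Section finite_nets.
Context {R : realType} {Z : normedModType R}.

Lemma finite_net (K : set Z) (r : R) : compact K -> 0 < r ->
  exists n (c : nat -> Z), (forall i, (i < n)%N -> K (c i)) /\
    forall z, K z -> exists2 i, (i < n)%N & `|z - c i| < r.
Proof.
move=> cK r0; have := cK; rewrite compact_cover => /(_ Z K (fun c => ball c r)).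
case=> [c _|z Kz|D DK KD].
- exact: ball_open.
- by exists z => //; exact: ballxx.
exists (size (enum_fset D)), (nth 0 (enum_fset D)); split=> [i iD|z /KD[c /= cD cz]].
  by apply/set_mem/DK; exact: mem_nth.
exists (index c (enum_fset D)); first by rewrite index_mem.
by rewrite nth_index//; move: cz; rewrite -ball_normE/= distrC.
Qed.

Lemma compact_open_margin (K G : set Z) : compact K -> open G -> K `<=` G ->
  exists2 r : R, 0 < r & forall z z', K z -> `|z - z'| < r -> G z'.
Proof.
move=> cK oG KG.
have cover z : K z -> \forall z' \near z & r \near (0 : R)^'+,
    forall y, `|z' - y| < r -> G y.
  move=> /KG Gz; have /nbhs_ballP[e /= e0 zeG] : nbhs z G by exact: open_nbhs_nbhs.
  have e20 : 0 < e / 2 by rewrite divr_gt0.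
  near=> z' r.
  have zz' : `|z - z'| < e / 2.
    have : ball z (e / 2) z' by near: z'; exact: nbhsx_ballx.
    by rewrite -ball_normE.
  have re : r < e / 2 by near: r; exact: nbhs_right_lt.
  move=> y z'y; apply: zeG; rewrite -ball_normE/= (splitr e).
  by rewrite (le_lt_trans (ler_distD z' _ _))// ltrD// (lt_trans z'y).
have /compact_near_coveringP/(_ R (0 : R)^'+ _ _ cover) := cK.
move=> near_r; have [r [r0 rP]] : exists r : R, 0 < r /\ forall z, K z -> forall y, `|z - y| < r -> G y.
  near (0 : R)^'+ => r; exists r; split; first by near: r; exact: nbhs_right_gt.
  by near: r.
by exists r => // z z' Kz; exact: rP.
Unshelve. all: by end_near. Qed.

End finite_nets.

(** Inclusion-exclusion, one set at a time: equality of two measures on a class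
    stable under intersection extends to finite unions, without complements. *)
Lemma measure_eq_bigcup {d} {T : measurableType d} {R : realType}
    (m1 m2 : {measure set T -> \bar R}) (C : set (set T)) :
  setI_closed C -> C `<=` measurable -> (forall A, C A -> m1 A = m2 A) ->
  (forall A, C A -> (m2 A < +oo)%E) ->
  forall n (A : nat -> set T), (forall i, (i < n)%N -> C (A i)) ->
    m1 (\bigcup_(i < n) A i) = m2 (\bigcup_(i < n) A i) /\
    (m2 (\bigcup_(i < n) A i) < +oo)%E.
Proof.
move=> CI mC eqC finC; elim=> [|n IH] A AC.
  by rewrite bigcup_mkord big_ord0 !measure0 ltry.
have mA i : (i < n.+1)%N -> measurable (A i) by move=> /AC/mC.
have mU k : (k <= n.+1)%N -> measurable (\bigcup_(i < k) A i).
  by move=> kn; apply: bigcup_measurable => i /= ik; apply: mA; exact: leq_trans kn.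
have USr : \bigcup_(i < n.+1) A i = (\bigcup_(i < n) A i) `|` A n.
  by rewrite !bigcup_mkord big_ord_recr.
have [e1 f1] := IH A (fun i ni => AC i (ltnW ni)).
have [e2 f2] := IH (fun i => A i `&` A n) (fun i ni => CI _ _ (AC i (ltnW ni)) (AC n (leqnn _))).
have An := AC n (leqnn _).
have E (m : {measure set T -> \bar R}) : (m (\bigcup_(i < n) A i) < +oo)%E ->
    m ((\bigcup_(i < n) A i) `|` A n) = (m (\bigcup_(i < n) A i) + m (A n) -
      m (\bigcup_(i < n) (A i `&` A n)))%E.
  by move=> moo; rewrite measureUfinl ?setI_bigcupl//; [exact: mU|exact: mA].
have e1' : (m1 (\bigcup_(i < n) A i) < +oo)%E by rewrite e1.
rewrite USr !E// e1 e2 (eqC _ An); split => //.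
rewrite (@le_lt_trans _ _ (m2 (\bigcup_(i < n) A i) + m2 (A n))%E)//.
  by rewrite leeBlDr ?leeDl// ge0_fin_numE.
by rewrite lte_add_pinfty// finC.
Qed.

(** Adding a constant reduces an identity between integrals of bounded functions
    to one between integrals of nonnegative functions. *)
Lemma Rintegral_transfer {d d'} {T : measurableType d} {T' : measurableType d'}
    {R : realType} (m : {measure set T -> \bar R}) (m' : {measure set T' -> \bar R})
    (D : set T) (D' : set T') (g : T -> R) (g' : T' -> R) (C : R) :
  measurable D -> measurable D' -> m D = m' D' -> (m' D' < +oo)%E ->
  m.-integrable D (EFin \o g) -> m'.-integrable D' (EFin \o g') ->
  (\int[m]_(x in D) (g x + C)%:E = \int[m']_(x in D') (g' x + C)%:E)%E ->
  \int[m]_(x in D) g x = \int[m']_(x in D') g' x.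
Proof.
move=> mD mD' DD' D'oo ig ig' gg'.
have Doo : (m D < +oo)%E by rewrite DD'.
have iC : m.-integrable D (EFin \o (fun=> C)).
  by apply: (@le_integrable_bounded _ _ _ _ _ _ `|C|).
have iC' : m'.-integrable D' (EFin \o (fun=> C)).
  by apply: (@le_integrable_bounded _ _ _ _ _ _ `|C|).
have : \int[m]_(x in D) (g x + C) = \int[m']_(x in D') (g' x + C) by congr fine.
by rewrite !RintegralD// !Rintegral_cst// DD' => /addIr.
Qed.

Section projection.
Context {R : realType} {U V : normedVectType R} {P : set U} {Q : set V}.
Hypotheses (compactP : compact P) (compactQ : compact Q).
Context {nu : {measure set (borel (R * V)%type) -> \bar R}}
  {eta : {measure set (borel (R * U * V)%type) -> \bar R}}.
Hypotheses (nuP : Pi_Q Q nu) (etaP : compatible P Q nu eta).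

Let mQ : measurable (Q : set (borel V)).
Proof. exact: borel_compact. Qed.

Let slabQ (t : R) : set (R * V) := `[0, t]%classic `*` Q.
Let slab (t : R) : set (R * U * V) := `[0, t]%classic `*` P `*` Q.
Let pr (z : R * U * V) : R * V := (z.1.1, z.2).

Let pr_continuous : continuous pr.
Proof.
move=> z.
have c1 : (fun z : R * U * V => z.1.1) @ z --> z.1.1.
  by apply: cvg_comp; [exact: cvg_fst|exact: cvg_fst].
have c2 : (fun z : R * U * V => z.2) @ z --> z.2 by exact: cvg_snd.
exact: (cvg_pair c1 c2).
Qed.

Let mpr : measurable_fun setT (pr : borel (R * U * V)%type -> borel (R * V)%type).
Proof. exact: continuous_borel_measurable. Qed.

(** The measure nu and the projection of eta agree on rectangles, but a compact
    set K is not a countable union of rectangles.  An open neighbourhood of K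
    contains a finite union of rectangles which covers K; outer regularity of
    nu then gives that K has no more mass for the projection than for nu, which
    is what [portmanteau] needs, applied to a constant sequence. *)
Lemma integral_compatible (t : R) (h : R * V -> R) : 0 <= t ->
  {within `[0, t]%classic `*` Q, continuous h} ->
  \int[eta]_(z in `[0, t]%classic `*` P `*` Q) h (z.1.1, z.2) =
  \int[nu]_(z in `[0, t]%classic `*` Q) h z.
Proof.
move=> t0 ch; have [nu_reg nu0 nuI] := nuP; have [eta0 etaE] := etaP.
have cslabQ : compact (slabQ t) by exact: compact_slabQ.
have cslab : compact (slab t) by exact: compact_slabPQ.
have mslabQ : measurable (slabQ t : set (borel (R * V)%type)) by exact: borel_compact.
have mslab : measurable (slab t : set (borel (R * U * V)%type)) by exact: borel_compact.
have nut : nu (slabQ t) = t%:E by rewrite /slabQ slabQE; have [_ ->] := Pi_Q_timed nuP.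
have etat : eta (slab t) = t%:E.
  by rewrite /slab slabPQE; have [_ ->] := compatible_timed compactQ nuP etaP.
have [m [mE mint]] := pushforward_measure eta mpr.
have mpre (A : set (R * V)) : measurable (A : set (borel (R * V)%type)) ->
    measurable (pr @^-1` A : set (borel (R * U * V)%type)).
  by move=> mA; rewrite -[X in measurable X]setTI; exact: mpr.
have m_rect (I : set R) (A : set V) : measurable I -> I `<=` time ->
    measurable (A : set (borel V)) -> A `<=` Q -> m (I `*` A) = nu (I `*` A).
  move=> mI It mA AQ; rewrite mE.
  rewrite (timed_measure_setI (closed_timePQ compactP compactQ) eta0 (mpre _ (borel_rectQ mI mA))).
  rewrite -etaE//; congr (eta _); rewrite eqEsubset; split => -[[s u] v] /=.
    by move=> [[Is Av] [[_ Pu] _]].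
  by move=> [[Is Pu] Av]; do !split => //; [exact: It|exact: AQ].
have mt : m (slabQ t) = t%:E.
  by rewrite m_rect//; exact: itv0_time.
have usc (K : set (R * V)) : compact K -> K `<=` slabQ t ->
    exists2 l : R, fine (m K) @[n --> \oo] --> l & (l%:E <= nu K)%E.
  move=> cK Kt; exists (fine (m K)); first exact: cvg_cst.
  have mK : measurable (K : set (borel (R * V)%type)) by exact: borel_compact.
  rewrite fineK; last first.
    rewrite ge0_fin_numE// (@le_lt_trans _ _ (m (slabQ t)))//; last by rewrite mt ltry.
    by apply: le_measure; rewrite ?inE.
  have [-> _] := nu_reg _ mK; apply: le_ereal_inf_tmp => _ [W [oW KW] <-].
  have [r r0 rW] := compact_open_margin cK oW KW.
  have [k [c [cKi Kc]]] := finite_net cK r0.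
  pose I_ i := `[0, t] `&` ball (c i).1 r; pose A_ i := Q `&` ball (c i).2 r.
  have mI i : measurable (I_ i).
    by apply: measurableI => //; apply: open_measurable; exact: ball_open.
  have mA i : measurable (A_ i : set (borel V)).
    by apply: measurableI => //; apply: borel_open; exact: ball_open.
  pose C : set (set (borel (R * V)%type)) := [set B | exists I A, [/\ measurable I, I `<=` `[0, t],
    measurable (A : set (borel V)), A `<=` Q & B = I `*` A]].
  have CI : setI_closed C.
    move=> _ _ [I [A [mI' It mA' AQ ->]]] [I' [A' [mI'' It' mA'' AQ' ->]]].
    exists (I `&` I'), (A `&` A'); split.
    - exact: measurableI.
    - by move=> s [/It].
    - exact: measurableI.
    - by move=> v [/AQ].
    - by rewrite eqEsubset; split => -[s v] /=; [move=> [[? ?] [? ?]]|move=> [[? ?] [? ?]]].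
  have mC : C `<=` measurable.
    by move=> _ [I [A [mI' _ mA' _ ->]]]; exact: borel_rectQ.
  have eqC B : C B -> m B = nu B.
    move=> [I [A [mI' It mA' AQ ->]]]; apply: m_rect => //.
    exact: subset_trans (@itv0_time _ t).
  have finC B : C B -> (nu B < +oo)%E.
    move=> CB; rewrite (@le_lt_trans _ _ (nu (slabQ t)))//; last by rewrite nut ltry.
    apply: le_measure; rewrite ?inE//; first exact: mC.
    by case: CB => [I [A [_ It _ AQ ->]]] z [/It ? /AQ ?].
  have CR i : (i < k)%N -> C (I_ i `*` A_ i).
    by move=> _; exists (I_ i), (A_ i); split => //; [move=> s []|move=> v []].
  have [eU _] := measure_eq_bigcup CI mC eqC finC CR.
  have mU : measurable (\bigcup_(i < k) (I_ i `*` A_ i) : set (borel (R * V)%type)).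
    by apply: bigcup_measurable => i /= /CR/mC.
  apply: (@le_trans _ _ (m (\bigcup_(i < k) (I_ i `*` A_ i)))).
    apply: le_measure; rewrite ?inE// => z Kz; have [i ik zi] := Kc _ Kz.
    have [zt zQ] := Kt _ Kz; have : ball (c i) r z by rewrite -ball_normE/= distrC.
    by move=> [b1 b2]; exists i.
  rewrite eU; apply: le_measure; rewrite ?inE//; first exact: borel_open.
  move=> z [i /= ik [[_ b1] [_ b2]]]; apply: (rW (c i)); first exact: cKi.
  have : ball (c i) r z by split.
  by rewrite -ball_normE.
have [F [UF ooF]] := ultraFilterLemma (_ : ProperFilter \oo).
have uscF (K : set (R * V)) : compact K -> K `<=` slabQ t ->
    exists2 l : R, fine (m K) @[n --> F] --> l & (l%:E <= nu K)%E.
  by move=> cK Kt; have [l Kl lK] := usc _ cK Kt; exists l => // B /Kl; exact: ooF.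
have := portmanteau cslabQ uscF (fun _ => mt) nut ch.
move=> /(_ UF) cvg_h; have -> : \int[nu]_(z in slabQ t) h z = \int[m]_(z in slabQ t) h z.
  by rewrite -(cvg_lim _ cvg_h)// lim_cst.
have [C C0 hC] := within_continuous_bounded cslabQ ch.
have chpr : {within slab t, continuous (h \o pr)}.
  apply: (continuous_within_comp (E := slabQ t)) => //.
    exact: continuous_subspaceT.
  by move=> z [[]].
apply: (@Rintegral_transfer _ _ _ _ _ eta m _ _ (fun z => h (pr z)) h C) => //.
- by rewrite etat mt.
- by rewrite mt ltry.
- by apply: within_continuous_integrable => //; rewrite etat ltry.
- by apply: within_continuous_integrable => //; rewrite mt ltry.
have mhC : measurable_fun (slabQ t : set (borel (R * V)%type)) (fun z => (h z + C)%:E).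
  apply/measurable_EFinP; apply: measurable_funD => //.
  by apply: within_continuous_measurable => //; exact: (compact_closed (@norm_hausdorff _ _)).
rewrite mint//; last first.
  by move=> y /hC; rewrite lee_fin ler_norml => /andP[+ _]; rewrite -lerBlDr sub0r.
have mN : measurable (~` (time `*` P `*` Q) : set (borel (R * U * V)%type)).
  by apply: measurableC; apply: borel_closed; exact: closed_timePQ.
rewrite [RHS](ge0_negligible_integral mN _ _ _ eta0).
- congr (integral _ _ _); rewrite eqEsubset; split => -[[s u] v] /=.
    move=> [[+ Pu] Qv]; rewrite in_itv/= => /andP[s0 st]; split.
      by split => //=; rewrite in_itv/= s0.
    by apply.
  by move=> [[st Qv] /contrapT[[_ Pu] _]].
- exact: mpre.
- have mprD : measurable_fun (pr @^-1` slabQ t : set (borel (R * U * V)%type)) (pr : borel (R * U * V)%type -> borel (R * V)%type).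
    by apply: measurable_funTS; exact: mpr.
  apply: (measurable_comp mslabQ _ mhC mprD).
  by move=> _ [z ? <-].
- by move=> z /hC; rewrite lee_fin ler_norml => /andP[+ _]; rewrite -lerBlDr sub0r.
Qed.

End projection.

(** * Controls with continuous weights *)

Lemma within_continuous_sum {R : realType} {T : topologicalType} (D : set T) (I : Type)
    (s : seq I) (g : I -> T -> R) :
  (forall i, {within D, continuous (g i)}) ->
  {within D, continuous (fun z => \sum_(i <- s) g i z)}.
Proof.
move=> cg z; rewrite /continuous_at.
apply: (@cvg_big _ _ _ _ _ _ _ (nbhs (z : subspace D))); first exact: add_continuous.
by move=> i _; exact: cg.
Qed.

Section weights.
Context {R : realType} {U V : normedVectType R}.

(** Data for the kernel which sends (t, v) to the distribution with mass
    w_j (t, v) at u_j, for j < wsize. *)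
Record weights := Weights {
  wsize : nat; wpoint : nat -> U; weight : nat -> R * V -> R }.

Definition admissible (P : set U) (Q : set V) (a : weights) : Prop :=
  [/\ forall j, P (wpoint a j),
      forall j, {within time `*` Q, continuous (weight a j)},
      forall j z, (time `*` Q) z -> 0 <= weight a j z &
      forall z, (time `*` Q) z -> \sum_(j < wsize a) weight a j z = 1].

Definition average (a : weights) (g : R * U * V -> R) (z : R * V) : R :=
  \sum_(j < wsize a) weight a j z * g (z.1, wpoint a j, z.2).

End weights.

Section weighted_controls.
Context {R : realType} {U V : normedVectType R} {P : set U} {Q : set V}.
Hypotheses (compactP : compact P) (compactQ : compact Q).
Context {a : @weights R U V}.
Hypothesis aP : admissible P Q a.

Let Pu j : P (wpoint a j).
Proof. by have [] := aP. Qed.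

Let w_continuous j : {within time `*` Q, continuous (weight a j)}.
Proof. by have [] := aP. Qed.

Let w_ge0 j z : (time `*` Q) z -> 0 <= weight a j z.
Proof. by have [_ _ w0 _] := aP; exact: w0. Qed.

Let w_sum1 z : (time `*` Q) z -> \sum_(j < wsize a) weight a j z = 1.
Proof. by have [_ _ _] := aP; exact. Qed.

Let slabQ (t : R) : set (R * V) := `[0, t]%classic `*` Q.
Let slab (t : R) : set (R * U * V) := `[0, t]%classic `*` P `*` Q.
Let phi i (z : R * V) : R * U * V := (z.1, wpoint a i, z.2).

Let phi_continuous i : continuous (phi i).
Proof.
move=> z.
have c1 : (fun z : R * V => (z.1, wpoint a i)) @ z --> (z.1, wpoint a i).
  exact: (cvg_pair cvg_fst (cvg_cst _)).
exact: (cvg_pair c1 cvg_snd).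
Qed.

Let phi_slab i t : phi i @^-1` slab t = slabQ t.
Proof.
rewrite eqEsubset; split => -[s v]; first by move=> [[? _] ?].
by move=> [? ?]; split => //; split => //; exact: Pu.
Qed.

Let slabQ_time t : slabQ t `<=` time `*` Q.
Proof. by move=> [s v] [/itv0_time]. Qed.

Lemma average_continuous t (g : R * U * V -> R) :
  {within slab t, continuous g} ->
  {within slabQ t, continuous (average a g)}.
Proof.
move=> cg; apply: within_continuous_sum => i z.
have cw : {within slabQ t, continuous (weight a i)}.
  by exact: (continuous_subspaceW (@slabQ_time t) (@w_continuous i)).
apply: cvgM; first exact: cw.
have cphi : {within slabQ t, continuous (phi i)} by exact: continuous_subspaceT.
have sub z' : slabQ t z' -> slab t (phi i z') by move=> [? ?]; split => //; split => //; exact: Pu.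
exact: (continuous_within_comp cphi cg sub z).
Qed.

Section fixed_nu.
Context {nu : {measure set (borel (R * V)%type) -> \bar R}}.
Hypothesis nuP : Pi_Q Q nu.

Let mtimeQ : measurable (time `*` Q : set (borel (R * V)%type)).
Proof. by apply: borel_closed; exact: closed_timeQ. Qed.

Let h i : borel (R * V)%type -> \bar R := (EFin \o weight a i) \_ (time `*` Q).

Let mh i : measurable_fun setT (h i).
Proof.
apply/(measurable_restrictT _ mtimeQ)/measurable_EFinP.
by apply: within_continuous_measurable => //; exact: closed_timeQ.
Qed.

Let h0 i z : (0 <= h i z)%E.
Proof. by apply: erestrict_ge0 => z' zQ; rewrite lee_fin; exact: w_ge0. Qed.

Let hfin i z : h i z \is a fin_num.
Proof. by rewrite /h patchE; case: ifP. Qed.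

Let hE i z : (time `*` Q) z -> h i z = (weight a i z)%:E.
Proof. by move=> zQ; rewrite /h patchE mem_set. Qed.

Let h_sum1 z : (time `*` Q) z -> (\sum_(i < wsize a) h i z = 1)%E.
Proof.
move=> zQ; rewrite -(w_sum1 zQ) -sumEFin.
by apply: eq_bigr => i _; exact: hE.
Qed.

Let weighted_measure : exists m : {measure set (borel (R * U * V)%type) -> \bar R},
  (forall A, m A = \sum_(i < wsize a) \int[nu]_(z in phi i @^-1` A) h i z)%E /\
  forall D f, measurable D -> measurable_fun D f -> (forall z, D z -> 0 <= f z)%E ->
    (\int[m]_(z in D) f z = \sum_(i < wsize a) \int[nu]_(z in phi i @^-1` D) (f (phi i z) * h i z))%E.
Proof.
have mphi i : measurable_fun setT (phi i : borel (R * V)%type -> borel (R * U * V)%type).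
  exact: continuous_borel_measurable.
have : forall i, exists m : {measure set (borel (R * U * V)%type) -> \bar R},
  (forall A, m A = \int[nu]_(z in phi i @^-1` A) h i z)%E /\
  forall D f, measurable D -> measurable_fun D f -> (forall z, D z -> 0 <= f z)%E ->
    (\int[m]_(z in D) f z = \int[nu]_(z in phi i @^-1` D) (f (phi i z) * h i z))%E.
  move=> i; have [m1 [m1E m1int]] := density_measure nu (@mh i) (@h0 i) (@hfin i).
  have [m2 [m2E m2int]] := pushforward_measure m1 (mphi i).
  exists m2; split => [A|D f mD mf f0]; first by rewrite m2E m1E.
  have mpD : measurable (phi i @^-1` D : set (borel (R * V)%type)).
    by rewrite -[X in measurable X]setTI; exact: mphi.
  rewrite m2int// m1int//; last by move=> z /f0.
  apply: (measurable_comp mD _ mf (measurable_funTS (mphi i))).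
  by move=> _ [z ? <-].
move=> /choice[m mP].
exists (msum m (wsize a)); split=> [A|D f mD mf f0].
  by rewrite /msum; apply: eq_bigr => i _; have [-> _] := mP i.
rewrite ge0_integral_measure_sum//; apply: eq_bigr => i _.
by have [_ ->] := mP i.
Qed.

(** The sum over j of the image of w_j nu by (t, v) -> (t, u_j, v) is compatible
    with nu and has the right integrals.  The weights are cut off outside of
    time x Q to be measurable and nonnegative, and regularity is obtained by
    taking the limit of the constant sequence. *)
Lemma average_control : exists2 eta, Pi_compat P Q nu eta &
  forall (t : R) (g : R * U * V -> R), 0 <= t -> {within `[0, t]%classic `*` P `*` Q, continuous g} ->
    \int[eta]_(z in `[0, t]%classic `*` P `*` Q) g z =
    \int[nu]_(z in `[0, t]%classic `*` Q) average a g z.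
Proof.
have [eta0 [eta0E eta0int]] := weighted_measure.
have sum_int (D : set (borel (R * V)%type)) : measurable D -> D `<=` time `*` Q ->
    (\sum_(i < wsize a) \int[nu]_(z in D) h i z = nu D)%E.
  move=> mD DQ; rewrite -ge0_integral_sum//; last first.
    by move=> i; exact: measurable_funTS.
  rewrite -[RHS]mul1e -integral_cst//; apply: eq_integral => z /set_mem/DQ.
  exact: h_sum1.
have eta0C : compatible P Q nu eta0.
  split.
    rewrite eta0E big1// => i _; apply: integral0_eq => z /= zS.
    rewrite /h patchE; case: ifP => // /set_mem[z0 zQ]; case: zS; split => //.
  move=> I A mI It mA AQ; rewrite eta0E -sum_int; last 2 first.
  - exact: borel_rectQ.
  - by move=> z [/It ? /AQ].
  apply: eq_bigr => i _; congr (integral _ _ _).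
  by rewrite eqEsubset; split => -[s v] /=; [move=> [[? _] ?]|move=> [? ?]; split].
have [F [UF ooF]] := ultraFilterLemma (_ : ProperFilter \oo).
have [eta etaP eta_cvg] := Pi_compat_limit compactP compactQ UF nuP (fun=> eta0C).
exists eta => // t g t0 cg.
rewrite -(cvg_lim _ (eta_cvg t g t0 cg))// lim_cst//.
have eta0t : eta0 (slab t) = t%:E.
  by rewrite /slab slabPQE; have [_ ->] := compatible_timed compactQ nuP eta0C.
have nut : nu (slabQ t) = t%:E by rewrite /slabQ slabQE; have [_ ->] := Pi_Q_timed nuP.
have cslabQ : compact (slabQ t) by exact: compact_slabQ.
have cslab : compact (slab t) by exact: compact_slabPQ.
have mslabQ : measurable (slabQ t : set (borel (R * V)%type)) by exact: borel_compact.
have mslab : measurable (slab t : set (borel (R * U * V)%type)) by exact: borel_compact.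
have [C C0 gC] := within_continuous_bounded cslab cg.
have gC0 z : slab t z -> (0 <= (g z + C)%:E)%E.
  by move=> /gC; rewrite lee_fin ler_norml => /andP[+ _]; rewrite -lerBlDr sub0r.
have mg : measurable_fun (slab t : set (borel (R * U * V)%type)) (fun z => (g z + C)%:E).
  apply/measurable_EFinP; apply: measurable_funD => //.
  by apply: within_continuous_measurable => //; exact: (compact_closed (@norm_hausdorff _ _)).
apply: (@Rintegral_transfer _ _ _ _ _ eta0 nu _ _ g _ C) => //.
- by rewrite eta0t nut.
- by rewrite nut ltry.
- by apply: within_continuous_integrable => //; rewrite eta0t ltry.
- apply: within_continuous_integrable => //; first by rewrite nut ltry.
  exact: average_continuous.
rewrite eta0int//.
under eq_bigr do rewrite phi_slab.
rewrite -ge0_integral_sum//; last 2 first.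
- move=> i; apply: emeasurable_funM; last exact: measurable_funTS.
  rewrite -(phi_slab i).
  have mphi : measurable_fun setT (phi i : borel (R * V)%type -> borel (R * U * V)%type).
    exact: continuous_borel_measurable.
  apply: (measurable_comp mslab _ mg (measurable_funTS mphi)).
  by move=> _ [z ? <-].
- move=> i z zQ; rewrite mule_ge0//; apply: gC0.
  by move: zQ => [? ?]; split => //; split => //; exact: Pu.
apply: eq_integral => z /set_mem/slabQ_time zQ.
transitivity ((\sum_(i < wsize a) (weight a i z * (g (phi i z) + C)))%:E).
  by rewrite -sumEFin; apply: eq_bigr => i _; rewrite hE// muleC.
congr EFin; under eq_bigr do rewrite mulrDr.
by rewrite big_split/= -mulr_suml w_sum1// mul1r.
Qed.

End fixed_nu.

End weighted_controls.

(** * Density of the controls with continuous weights *)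

Lemma partition_of_unity {R : realType} {Z : normedModType R} (K : set Z) (d : R) :
  compact K -> 0 < d ->
  exists n (c : nat -> Z) (psi : nat -> Z -> R),
    [/\ forall i, (i < n)%N -> K (c i),
        forall i, {within K, continuous (psi i)},
        forall i z, 0 <= psi i z,
        forall i z, psi i z != 0 -> `|z - c i| < d &
        forall z, K z -> \sum_(i < n) psi i z = 1].
Proof.
move=> cK d0; have [n [c [cKi Kc]]] := finite_net cK d0.
pose phi i (z : Z) := Num.max 0 (d - `|z - c i|).
pose Phi z := \sum_(i < n) phi i z.
have phi0 i z : 0 <= phi i z by rewrite /phi le_max lexx.
have Phi_ge0 z : 0 <= Phi z by apply: sumr_ge0.
have Phi_gt0 z : K z -> 0 < Phi z.
  move=> /Kc[i ik zi]; rewrite /Phi (bigD1 (Ordinal ik))//= ltr_pwDl ?sumr_ge0//.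
  by rewrite /phi lt_max subr_gt0 zi orbT.
have cphi i : continuous (phi i).
  move=> z; apply: (@continuous_max _ _ (fun=> 0) (fun z => d - `|z - c i|) z).
    exact: cvg_cst.
  apply: cvgB; first exact: cvg_cst.
  by apply: cvg_norm; apply: cvgB; [exact: cvg_id|exact: cvg_cst].
exists n, c, (fun i z => phi i z / Phi z); split => //.
- move=> i; apply/subspace_continuousP => z Kz.
  apply: cvgM.
    by apply: cvg_trans (cphi i z); apply: cvg_app; exact: cvg_within.
  apply: cvgV; first by rewrite gt_eqF// Phi_gt0.
  have cPhi : Phi x @[x --> z] --> Phi z.
    by apply: cvg_big; [exact: add_continuous|move=> j _; exact: cphi].
  by apply: cvg_trans cPhi; apply: cvg_app; exact: cvg_within.
- by move=> i z; rewrite divr_ge0.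
- move=> i z; rewrite mulf_eq0 negb_or => /andP[+ _].
  rewrite /phi; case: (leP 0 (d - `|z - c i|)) => [+ n0|_]; last by rewrite eqxx.
  by rewrite le_eqVlt eq_sym (negbTE n0) subr_gt0.
- by move=> z Kz; rewrite -mulr_suml mulfV// gt_eqF// Phi_gt0.
Qed.

Section approximation.
Context {R : realType} {U V : normedVectType R} {P : set U} {Q : set V}.
Hypotheses (compactP : compact P) (compactQ : compact Q).
Context {nu : {measure set (borel (R * V)%type) -> \bar R}}
  {eta : {measure set (borel (R * U * V)%type) -> \bar R}}.
Hypotheses (nuP : Pi_Q Q nu) (etaP : compatible P Q nu eta).

Let slabQ (t : R) : set (R * V) := `[0, t]%classic `*` Q.
Let slab (s t : R) : set (R * U * V) := `[s, t]%classic `*` P `*` Q.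

Let cslab s t : compact (slab s t).
Proof. exact: compact_slab. Qed.

Let mslab s t : measurable (slab s t : set (borel (R * U * V)%type)).
Proof. by apply: borel_compact; exact: cslab. Qed.

Let eta_slabE s t : 0 <= s <= t -> eta (slab s t) = (t - s)%:E.
Proof. by move=> st; exact: (eta_slab compactQ nuP etaP). Qed.

(* A partition of unity does not respect the final time t of a test function g.
   So g, extended by 0 after t, is compared with a continuous function S, and
   the times at distance at most d of t are handled by boundedness. *)
Let cut_error (N t d e C : R) (g S : R * U * V -> R) :
  0 <= t -> 0 < d -> t + d <= N -> 0 <= e -> 0 <= C ->
  {within slab 0 t, continuous g} -> {within slab 0 N, continuous S} ->
  (forall z, slab 0 t z -> z.1.1 <= t - d -> `|g z - S z| <= e) ->
  (forall z, slab 0 t z -> `|g z - S z| <= e + C) ->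
  (forall z, slab 0 N z -> t < z.1.1 -> `|S z| <= C) ->
  (forall z, slab 0 N z -> t + d <= z.1.1 -> S z = 0) ->
  `|\int[eta]_(z in slab 0 t) g z - \int[eta]_(z in slab 0 N) S z| <= e * t + C * (2 * d).
Proof.
move=> t0 d0 tdN e0 C0 cg cS gS1 gS2 S1 S2.
have tN : t <= N by rewrite (le_trans _ tdN)// lerDl ltW.
have N0 : 0 <= N by exact: le_trans tN.
have slabtN : slab 0 t `<=` slab 0 N.
  by move=> -[[s u] v] [[+ Pu] Qv]; rewrite /= in_itv/= => /andP[s0 st];
    split => //; split => //=; rewrite in_itv/= s0 (le_trans st).
pose s0 := Num.max 0 (t - d).
pose E := slab s0 (t + d).
have s00 : 0 <= s0 by rewrite le_max lexx.
have s0t : s0 <= t + d by rewrite /s0 ge_max; apply/andP; split; lra.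
have etaE : eta E = (t + d - s0)%:E by rewrite eta_slabE// s00.
have finN : (eta (slab 0 N) < +oo)%E by rewrite eta_slabE ?lexx// ltry.
have ig : eta.-integrable (slab 0 t) (EFin \o (g : borel (R * U * V)%type -> R)).
  by apply: within_continuous_integrable => //; rewrite eta_slabE ?lexx// ltry.
have iS : eta.-integrable (slab 0 N) (EFin \o (S : borel (R * U * V)%type -> R)).
  exact: within_continuous_integrable.
have igN : eta.-integrable (slab 0 N) (EFin \o ((g \_ (slab 0 t)) : borel (R * U * V)%type -> R)).
  have : eta.-integrable (slab 0 N `&` slab 0 t) (EFin \o (g : borel (R * U * V)%type -> R)).
    by rewrite setIidr.
  rewrite integrable_restrict//; apply: eq_integrable => // z _.
  by rewrite /patch/=; case: ifP.
have -> : \int[eta]_(z in slab 0 t) g z = \int[eta]_(z in slab 0 N) (g \_ (slab 0 t)) z.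
  by rewrite -Rintegral_mkcondr setIidr.
rewrite -RintegralB//.
pose H (z : borel (R * U * V)%type) : R := e * \1_(slab 0 t) z + C * \1_E z.
have iind A : measurable (A : set (borel (R * U * V)%type)) ->
    eta.-integrable (slab 0 N) (EFin \o (\1_A : borel (R * U * V)%type -> R)).
  move=> mA; apply: (@le_integrable_bounded _ _ _ _ _ (\1_A : borel (R * U * V)%type -> R) 1) => //.
  by move=> z _; rewrite indicE; case: (_ \in _); rewrite ?normr1 ?normr0.
have iH : eta.-integrable (slab 0 N) (EFin \o H).
  by apply: integrable_addR => //; apply: integrable_scaleR => //; apply: iind => //; exact: mslab.
have idiff : eta.-integrable (slab 0 N)
    (EFin \o (fun z : borel (R * U * V)%type => (g \_ (slab 0 t)) z - S z)).
  apply: eq_integrable (integrableB _ igN iS) => //.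
apply: (le_trans (le_normr_Rintegral _ idiff)) => //.
apply: (@le_trans _ _ (\int[eta]_(z in slab 0 N) H z)).
  apply: le_Rintegral => //; first exact: integrable_norm.
  move=> [[s u] v] szN; have [[+ Pu] Qv] := szN; rewrite /= in_itv/= => /andP[s_ge0 sN].
  have inE' : (s0 <= s <= t + d) -> E (s, u, v).
    by move=> h; split => //; split => //=; rewrite in_itv.
  rewrite /H !indicE; have [st|ts] := leP s t.
    have sl : slab 0 t (s, u, v) by split => //; split => //=; rewrite in_itv/= s_ge0.
    rewrite patchE (mem_set sl) mulr1.
    have [std|tds] := leP s (t - d).
      apply: (le_trans (gS1 _ sl std)); rewrite lerDl mulr_ge0//.
    rewrite (mem_set (inE' _)) ?mulr1; first exact: gS2.
    rewrite /s0 ge_max s_ge0 (ltW tds)/= (le_trans st)// lerDl ltW//.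
  have nsl : (s, u, v) \notin slab 0 t.
    by apply/negP => /set_mem[[]] /=; rewrite in_itv/= => /andP[_]; rewrite leNgt ts.
  rewrite patchE (negbTE nsl) mulr0 !add0r normrN.
  have [tds|std] := leP (t + d) s; first by rewrite S2// normr0 mulr_ge0.
  rewrite (mem_set (inE' _)) ?mulr1; first exact: S1.
  rewrite /s0 ge_max s_ge0 (ltW std) andbT/= (le_trans _ (ltW ts))// gerBl ltW//.
rewrite RintegralD//; [|by apply: integrable_scaleR => //; apply: iind; exact: mslab..].
rewrite !RintegralZl//; [|by apply: iind; exact: mslab..].
rewrite !Rintegral_indic//; [|exact: mslab..].
rewrite setIidl// eta_slabE ?lexx// subr0/= lerD2l ler_wpM2l//.
apply: (@le_trans _ _ (fine (eta E))).
  apply: fine_le; last by apply: measureIl; exact: mslab.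
    rewrite ge0_fin_numE// (@le_lt_trans _ _ (eta E))// ?etaE ?ltry//.
    by rewrite -etaE; apply: measureIl; exact: mslab.
  by rewrite etaE.
rewrite etaE/= /s0; have : t - d <= Num.max 0 (t - d) by rewrite le_max lexx orbT.
lra.
Qed.

(* Both sums of the comparison below are averages of values of g: the left one
   takes values at the points q k z, the right one at the nearby points y k. *)
Let average_error (I : finType) (W : I -> R * U * V -> R) (y : I -> R * U * V)
    (q : I -> R * U * V -> R * U * V) (N t d e C : R) (g : R * U * V -> R) :
  0 <= t -> 0 < d -> t + d <= N -> 0 <= e -> 0 <= C ->
  (forall z, slab 0 t z -> `|g z| <= C) ->
  (forall z z', slab 0 t z -> slab 0 t z' -> `|z - z'| < d -> `|g z - g z'| <= e) ->
  (forall k, {within slab 0 N, continuous (W k)}) ->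
  (forall k z, 0 <= W k z) ->
  (forall z, slab 0 N z -> \sum_k W k z = 1) ->
  (forall k, slab 0 N (y k)) ->
  (forall k z, slab 0 t z -> slab 0 t (q k z)) ->
  (forall k z, (q k z).1.1 = z.1.1) ->
  (forall k z, slab 0 N z -> W k z != 0 -> `|q k z - y k| < d) ->
  {within slab 0 t, continuous (fun z => \sum_k W k z * g (q k z))} ->
  `|\int[eta]_(z in slab 0 t) (\sum_k W k z * g (q k z)) -
    \int[eta]_(z in slab 0 N) (\sum_k W k z * (if (y k).1.1 <= t then g (y k) else 0))|
  <= e * t + C * (2 * d).
Proof.
move=> t0 d0 tdN e0 C0 gC ge cW W0 W1 yN qt q1 qy cg.
pose G k := if (y k).1.1 <= t then g (y k) else 0.
have yt k : (y k).1.1 <= t -> slab 0 t (y k).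
  have := yN k; case: (y k) => -[s u] v [[+ Pu] Qv] /= st.
  by rewrite /= in_itv/= => /andP[s0 _]; split => //; split => //=; rewrite in_itv/= s0.
have GC k : `|G k| <= C by rewrite /G; case: ifP => [/yt/gC//|_]; rewrite normr0.
have tN z : slab 0 t z -> slab 0 N z.
  case: z => -[s u] v [[+ Pu] Qv]; rewrite /= in_itv/= => /andP[s0 st].
  by split => //; split => //=; rewrite in_itv/= s0; lra.
have time_close k z : slab 0 N z -> W k z != 0 -> `|z.1.1 - (y k).1.1| < d.
  move=> zN Wkz; apply: le_lt_trans (qy _ _ zN Wkz); rewrite -(q1 k).
  by rewrite prod_normE le_max/= prod_normE le_max/= lexx.
have average z (h : I -> R) (r : R) : slab 0 N z ->
    (forall k, W k z != 0 -> `|h k| <= r) -> `|\sum_k W k z * h k| <= r.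
  move=> zN hr; rewrite -[leRHS]mul1r -(W1 _ zN) mulr_suml.
  apply: (le_trans (ler_norm_sum _ _ _)); apply: ler_sum => k _.
  rewrite normrM ger0_norm//; have [->|Wkz] := eqVneq (W k z) 0; first by rewrite !mul0r.
  by rewrite ler_wpM2l// hr.
apply: cut_error => //.
- apply: within_continuous_sum => k z; apply: cvgM; first exact: cW.
  exact: cvg_cst.
- move=> z zt ztd; rewrite -sumrB; under eq_bigr do rewrite -mulrBr.
  apply: average; first exact: tN.
  move=> k Wkz; have := time_close _ _ (tN _ zt) Wkz; rewrite ltr_norml => /andP[h1 h2].
  have ykt : (y k).1.1 <= t by lra.
  rewrite ykt; apply: ge; [exact: qt|exact: yt|exact: qy (tN _ zt) Wkz].
- move=> z zt; rewrite -sumrB; under eq_bigr do rewrite -mulrBr.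
  apply: average; first exact: tN.
  move=> k Wkz; case: ifP => [/yt ykt|_].
    rewrite ler_wpDr//; apply: ge => //; [exact: qt|exact: qy (tN _ zt) Wkz].
  by rewrite subr0 ler_wpDl// gC//; exact: qt.
- by move=> z zN _; apply: average => // k _; exact: GC.
- move=> z zN tdz; apply: big1 => k _; have [->|Wkz] := eqVneq (W k z) 0; first by rewrite mul0r.
  have := time_close _ _ zN Wkz; rewrite ltr_norml => /andP[h1 h2].
  by case: ifP => [ykt|_]; [exfalso; lra|rewrite mulr0].
Qed.

Let time_clip (N : R) : 0 <= N ->
  {within time `*` Q, continuous (fun z : R * V => (Num.min z.1 N, z.2))}.
Proof.
move=> N0; apply: continuous_within_pair; apply: continuous_subspaceT => z; last exact: cvg_snd.
by apply: (@continuous_min _ _ (fun z : R * V => z.1) (fun=> N) z); [exact: cvg_fst|exact: cvg_cst].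
Qed.

(** Take partitions of unity psi_i of [0, N] x Q and theta_j of P at scale d.
    The mass of eta on the product cell (i, j) is p_ij times the mass of nu on the
    cell i, with p_ij a probability in j, and the weight of u_j is the sum over i
    of psi_i p_ij.  Replacing g by its values at the centres of the cells turns
    the integrals of g for eta and for the new control into the same
    combination of the masses of the product cells. *)
Lemma weights_approximation (N d : R) : 0 <= N -> 0 < d -> P !=set0 ->
  exists2 a : weights, admissible P Q a &
    forall t g e C, 0 <= t -> t + d <= N -> 0 <= e -> 0 <= C ->
      {within slab 0 t, continuous g} -> (forall z, slab 0 t z -> `|g z| <= C) ->
      (forall z z', slab 0 t z -> slab 0 t z' -> `|z - z'| < d -> `|g z - g z'| <= e) ->
      `|\int[eta]_(z in slab 0 t) g z - \int[nu]_(z in slabQ t) average a g z|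
      <= 2 * (e * t + C * (2 * d)).
Proof.
move=> N0 d0 [u0 Pu0].
have cQN : compact (slabQ N) by exact: compact_slabQ.
have [a [c [psi [cK cpsi psi0 psid psi1]]]] := partition_of_unity cQN d0.
have [b [u [theta [uP ctheta theta0 thetad theta1]]]] := partition_of_unity compactP d0.
have b0 : (0 < b)%N.
  by case: (b) (theta1 _ Pu0) => [|//]; rewrite big_ord0 => /eqP; rewrite eq_sym oner_eq0.
pose u_ j := if (j < b)%N then u j else u0.
have Pu_ j : P (u_ j) by rewrite /u_; case: ifP => // /uP.
pose pr (z : R * U * V) : R * V := (z.1.1, z.2).
have pr_continuous : continuous pr.
  move=> z; have c1 : (fun z : R * U * V => z.1.1) @ z --> z.1.1.
    by apply: cvg_comp; [exact: cvg_fst|exact: cvg_fst].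
  exact: (cvg_pair c1 cvg_snd).
have prN z : slab 0 N z -> slabQ N (pr z) by move=> [[]].
have cpsiN i : {within slab 0 N, continuous (fun z => psi i (pr z))}.
  by apply: (continuous_within_comp _ (cpsi i) prN); exact: continuous_subspaceT.
have cthetaN j : {within slab 0 N, continuous (fun z => theta j z.1.2)}.
  apply: (continuous_within_comp (D := slab 0 N) (g := fun z => z.1.2) _ (ctheta j)).
    apply: continuous_subspaceT => z.
    by apply: cvg_comp; [exact: cvg_fst|exact: cvg_snd].
  by move=> z [[]].
have cN : compact (slab 0 N) by [].
have finN : (eta (slab 0 N) < +oo)%E by rewrite eta_slabE ?lexx// ltry.
have int_cont (g : R * U * V -> R) : {within slab 0 N, continuous g} ->
    eta.-integrable (slab 0 N) (EFin \o (g : borel (R * U * V)%type -> R)).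
  exact: within_continuous_integrable.
pose W1 (k : 'I_a * 'I_b) z := psi k.1 (pr z) * theta k.2 z.1.2.
have cW1 k : {within slab 0 N, continuous (W1 k)}.
  by move=> z; apply: cvgM; [exact: cpsiN|exact: cthetaN].
pose nu_ i := \int[eta]_(z in slab 0 N) psi i (pr z).
pose mass k := \int[eta]_(z in slab 0 N) W1 k z.
have mass0 k : 0 <= mass k by apply: Rintegral_ge0 => z _; rewrite mulr_ge0.
have nu_0 i : 0 <= nu_ i by apply: Rintegral_ge0 => z _.
have mass_sum (i : 'I_a) : \sum_(j < b) mass (i, j) = nu_ i.
  rewrite -Rintegral_sum//; last by move=> j; apply: int_cont; exact: cW1.
  apply: eq_Rintegral => z /set_mem[[_ Pz] _].
  by rewrite /W1/= -mulr_sumr theta1// mulr1.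
(* On a cell of mass 0 the distribution is arbitrary: all the mass is put on
   the point of index 0. *)
pose p (i : 'I_a) (j : nat) : R :=
  if nu_ i == 0 then (j == 0%N)%:R else
  if insub j is Some j' then mass (i, j') / nu_ i else 0.
have p0 i j : 0 <= p i j.
  by rewrite /p; case: ifP => // _; case: insubP => // j' _ _; rewrite divr_ge0.
have p_mass i (j : 'I_b) : p i j * nu_ i = mass (i, j).
  rewrite /p; case: eqVneq => [ni|ni].
    have /eqP := mass_sum i; rewrite ni psumr_eq0// => /allP/(_ j).
    by rewrite mem_index_enum => /(_ isT)/eqP; rewrite mulr0.
  by rewrite valK divfK.
have p_sum i : \sum_(j < b) p i j = 1.
  have [ni|ni] := eqVneq (nu_ i) 0.
    rewrite (bigD1 (Ordinal b0))//= big1 ?addr0 /p ni eqxx// => j jb.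
    by apply/eqP; rewrite pnatr_eq0 eqb0; apply: contra jb => /eqP jb; apply/eqP/val_inj.
  by apply: (mulIf ni); rewrite mulr_suml mul1r -[RHS]mass_sum; apply: eq_bigr => j _.
pose W2 (k : 'I_a * 'I_b) z := psi k.1 (pr z) * p k.1 k.2.
(* After time N the weights keep their values at time N. *)
pose w (j : nat) (z : R * V) := \sum_(i < a) psi i (Num.min z.1 N, z.2) * p i j.
have clipN z : (time `*` Q) z -> slabQ N (Num.min z.1 N, z.2).
  move=> [z0 Qz]; split => //=; rewrite in_itv/= le_min N0 andbT ge_min lexx orbT andbT.
  exact: z0.
pose av := Weights b u_ w.
have avP : admissible P Q av.
  split => //=.
- move=> j; apply: within_continuous_sum => i z.
  apply: cvgM; last exact: cvg_cst.
  exact: (continuous_within_comp (time_clip N0) (cpsi i) clipN z).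
- by move=> j z _; apply: sumr_ge0 => i _; rewrite mulr_ge0.
- move=> z zQ; rewrite exchange_big/=; under eq_bigr do rewrite -mulr_sumr p_sum mulr1.
  by apply: psi1; exact: clipN.
exists av => // t g e C t0 tdN e0 C0 cg gC ge.
have tN : t <= N by rewrite (le_trans _ tdN)// lerDl ltW.
have slabtN z : slab 0 t z -> slab 0 N z.
  case: z => -[s v1] v2 [[+ Pv1] Qv2]; rewrite /= in_itv/= => /andP[s0 st].
  by split => //; split => //=; rewrite in_itv/= s0 (le_trans st).
pose y (k : 'I_a * 'I_b) : R * U * V := ((c k.1).1, u k.2, (c k.1).2).
have yN k : slab 0 N (y k).
  by have [? ?] := cK _ (ltn_ord k.1); split => //; split => //=; apply: uP; exact: ltn_ord.
pose q1 (k : 'I_a * 'I_b) (z : R * U * V) := z.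
pose q2 (k : 'I_a * 'I_b) (z : R * U * V) := (z.1.1, u k.2, z.2).
pose G k := if (y k).1.1 <= t then g (y k) else 0.
have psi_close i z : psi i (pr z) != 0 -> (`|z.1.1 - (c i).1| < d) && (`|z.2 - (c i).2| < d).
  by move=> /psid; rewrite prod_normE gt_max.
have W1_sum z : slab 0 N z -> \sum_k W1 k z = 1.
  move=> zN; rewrite -(pair_bigA _ (fun (i : 'I_a) (j : 'I_b) => psi i (pr z) * theta j z.1.2))/=.
  have Pz : P z.1.2 by case: zN => [[]].
  under eq_bigr do rewrite -mulr_sumr theta1// mulr1.
  by apply: psi1; exact: prN.
have W2_sum z : slab 0 N z -> \sum_k W2 k z = 1.
  move=> zN; rewrite -(pair_bigA _ (fun (i : 'I_a) (j : 'I_b) => psi i (pr z) * p i j))/=.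
  under eq_bigr do rewrite -mulr_sumr p_sum mulr1.
  by apply: psi1; exact: prN.
have E1 : \int[eta]_(z in slab 0 t) g z =
    \int[eta]_(z in slab 0 t) (\sum_k W1 k z * g (q1 k z)).
  by apply: eq_Rintegral => z /set_mem/slabtN zN; rewrite /q1 -mulr_suml W1_sum// mul1r.
have cg1 : {within slab 0 t, continuous (fun z => \sum_k W1 k z * g (q1 k z))}.
  apply: within_continuous_sum => k z; apply: cvgM; last exact: cg.
  have cWt : {within slab 0 t, continuous (W1 k)} by exact: continuous_subspaceW (cW1 k).
  exact: cWt.
have cg2 : {within slab 0 t, continuous (fun z => \sum_k W2 k z * g (q2 k z))}.
  apply: within_continuous_sum => k z; apply: cvgM.
    apply: cvgM; last exact: cvg_cst.
    have cpt : {within slab 0 t, continuous (fun z => psi k.1 (pr z))}.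
      exact: continuous_subspaceW (cpsiN k.1).
    exact: cpt.
  have cq : {within slab 0 t, continuous (q2 k)}.
    apply: continuous_subspaceT => z'.
    have c1 : (fun z : R * U * V => z.1.1) @ z' --> z'.1.1.
      by apply: cvg_comp; [exact: cvg_fst|exact: cvg_fst].
    exact: (cvg_pair (cvg_pair c1 (cvg_cst _)) cvg_snd).
  apply: (continuous_within_comp cq cg _ z) => z' [[? ?] ?].
  by split => //; split => //=; apply: uP; exact: ltn_ord.
have E2 : \int[nu]_(z in slabQ t) average av g z =
    \int[eta]_(z in slab 0 t) (\sum_k W2 k z * g (q2 k z)).
  rewrite -(integral_compatible compactP compactQ nuP etaP t0); last first.
    exact: (average_continuous avP cg).
  apply: eq_Rintegral => z /set_mem zt.
  have min_z : Num.min z.1.1 N = z.1.1.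
    by apply/min_idPl; have [[+ _] _] := slabtN _ zt; rewrite /= in_itv/= => /andP[].
  rewrite -(pair_bigA _ (fun (i : 'I_a) (j : 'I_b) => psi i (pr z) * p i j * g (z.1.1, u j, z.2)))/=.
  rewrite exchange_big/=; apply: eq_bigr => j _; rewrite /= /w mulr_suml.
  by apply: eq_bigr => i _; rewrite /= min_z /u_ ltn_ord.
have E3 : \int[eta]_(z in slab 0 N) (\sum_k W1 k z * G k) =
    \int[eta]_(z in slab 0 N) (\sum_k W2 k z * G k).
  have iW1 k : eta.-integrable (slab 0 N) (EFin \o (W1 k : borel (R * U * V)%type -> R)).
    by apply: int_cont; exact: cW1.
  have iW2 k : eta.-integrable (slab 0 N) (EFin \o (W2 k : borel (R * U * V)%type -> R)).
    by apply: int_cont => z; apply: cvgM; [exact: cpsiN|exact: cvg_cst].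
  rewrite !Rintegral_sum//; last 2 first.
  - by move=> k; under eq_fun do rewrite mulrC; exact: integrable_scaleR.
  - by move=> k; under eq_fun do rewrite mulrC; exact: integrable_scaleR.
  apply: eq_bigr => k _; rewrite !RintegralZr//; last exact: int_cont.
  by congr (_ * _); rewrite [RHS]mulrC [RHS]p_mass /mass; case: (k).
rewrite E1 E2 mulr_natl mulr2n.
rewrite (le_trans (ler_distD (\int[eta]_(z in slab 0 N) (\sum_k W1 k z * G k)) _ _))//.
rewrite lerD//; last rewrite distrC E3.
- apply: average_error => //.
  + by move=> k z; rewrite mulr_ge0.
  + move=> k z zN; rewrite mulf_eq0 negb_or => /andP[/psi_close/andP[h1 h2] /thetad h3].
    by rewrite prod_normE gt_max/= h2 andbT prod_normE gt_max/= h1.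
- apply: average_error => //.
  + by move=> k z; apply: cvgM; [exact: cpsiN|exact: cvg_cst].
  + by move=> k z; rewrite mulr_ge0.
  + by move=> k z [[? ?] ?]; split => //; split => //=; apply: uP; exact: ltn_ord.
  + move=> k z zN; rewrite mulf_eq0 negb_or => /andP[/psi_close/andP[h1 h2] _].
    by rewrite prod_normE gt_max/= h2 andbT prod_normE gt_max/= h1 subrr normr0.
Qed.

End approximation.

Lemma compact_uniform_modulus {R : realType} {Z : normedModType R} (K : set Z) (g : Z -> R) (e : R) :
  compact K -> {within K, continuous g} -> 0 < e ->
  \forall d \near (0 : R)^'+, forall z z', K z -> K z' -> `|z - z'| < d -> `|g z - g z'| <= e.
Proof.
move=> cK /subspace_continuousP cg e0.
have cover z : K z -> \forall z' \near z & d \near (0 : R)^'+,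
    K z' -> forall y, K y -> `|z' - y| < d -> `|g z' - g y| <= e.
  move=> Kz; have e20 : 0 < e / 2 by rewrite divr_gt0.
  have : \forall y \near z, K y -> `|g z - g y| < e / 2.
    by have /cvgrPdist_lt/(_ _ e20) := cg z Kz.
  move=> /nbhs_ballP[r /= r0 zr].
  have r20 : 0 < r / 2 by rewrite divr_gt0.
  near=> z' d => Kz' y Ky z'y.
  have zz' : ball z (r / 2) z' by near: z'; exact: nbhsx_ballx.
  have dr : d < r / 2 by near: d; exact: nbhs_right_lt.
  rewrite -ball_normE/= in zz'.
  have h1 : `|g z - g z'| < e / 2.
    by apply: zr => //; rewrite -ball_normE/= (lt_trans zz')// ltr_pdivrMr// ltr_pMr// ltr1n.
  have h2 : `|g z - g y| < e / 2.
    apply: zr => //; rewrite -ball_normE/= (splitr r).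
    by rewrite (le_lt_trans (ler_distD z' _ _))// ltrD// (lt_trans z'y).
  by rewrite (splitr e) (le_trans (ler_distD (g z) _ _))// lerD// ltW// distrC.
have /compact_near_coveringP/(_ R (0 : R)^'+ _ _ cover) := cK.
by apply: filterS => d dP z z' Kz; exact: dP.
Unshelve. all: by end_near. Qed.

Section approximation_sequence.
Context {R : realType} {U V : normedVectType R} {P : set U} {Q : set V}.
Hypotheses (compactP : compact P) (compactQ : compact Q).

(** The k-th weights are those of [weights_approximation] at scale 1/(k+1) up to
    time k. *)
Lemma weights_dense nu eta : Pi_Q Q nu -> compatible P Q nu eta ->
  exists2 a_ : nat -> weights, forall k, admissible P Q (a_ k) &
    forall (t : R) (g : R * U * V -> R), 0 <= t -> {within `[0, t]%classic `*` P `*` Q, continuous g} ->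
      \int[nu]_(z in `[0, t]%classic `*` Q) average (a_ k) g z @[k --> \oo] -->
      \int[eta]_(z in `[0, t]%classic `*` P `*` Q) g z.
Proof.
move=> nuP etaP.
have P0 : P !=set0.
  apply/set0P/eqP => PE; have := eta_slab compactQ nuP etaP (_ : 0 <= (0 : R) <= 1).
  rewrite lexx ler01 => /(_ isT)/eqP; rewrite PE setX0 set0X measure0 subr0.
  by rewrite eqe eq_sym oner_eq0.
have d0 k : 0 < k.+1%:R^-1 :> R by rewrite invr_gt0.
have : forall k, exists a, admissible P Q a /\
    forall (t : R) (g : R * U * V -> R) (e C : R), 0 <= t -> t + k.+1%:R^-1 <= k%:R -> 0 <= e -> 0 <= C ->
      {within `[0, t]%classic `*` P `*` Q, continuous g} ->
      (forall z, (`[0, t]%classic `*` P `*` Q) z -> `|g z| <= C) ->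
      (forall z z', (`[0, t]%classic `*` P `*` Q) z -> (`[0, t]%classic `*` P `*` Q) z' ->
        `|z - z'| < k.+1%:R^-1 -> `|g z - g z'| <= e) ->
      `|\int[eta]_(z in `[0, t]%classic `*` P `*` Q) g z -
        \int[nu]_(z in `[0, t]%classic `*` Q) average a g z|
      <= 2 * (e * t + C * (2 * k.+1%:R^-1)).
  move=> k; have [a aP aE] :=
    weights_approximation compactP compactQ nuP etaP (ler0n R k) (d0 k) P0.
  by exists a.
move=> /choice[a_ a_P]; exists a_ => [k|t g t0 cg]; first by have [] := a_P k.
have cslab : compact (`[0, t]%classic `*` P `*` Q) by exact: compact_slabPQ.
have [C C0 gC] := within_continuous_bounded cslab cg.
apply/cvgrPdist_le => e e0.
pose e1 := e / (4 * (t + 1)).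
have t1 : 0 < t + 1 by rewrite ltr_wpDl.
have e10 : 0 < e1 by rewrite divr_gt0// mulr_gt0.
have inv0 : (k.+1%:R^-1 : R) @[k --> \oo] --> (0 : R)^'+.
  move=> B; rewrite /at_right/within/= => /(@cvg_harmonic R); rewrite /nbhs/= => -[m _ mB].
  by exists m => // k /mB; apply; exact: harmonic_gt0.
near=> k.
have kt : t + k.+1%:R^-1 <= k%:R.
  rewrite (@le_trans _ _ (t + 1))// ?lerD2l ?invf_le1 ?ler1n//.
  by near: k; exact: nbhs_infty_ger.
have [_ /(_ t g e1 C t0 kt (ltW e10) (ltW C0) cg gC) h] := a_P k.
apply: (le_trans (h _)).
  near: k; exact: (inv0 _ (compact_uniform_modulus cslab cg e10)).
have small : k.+1%:R^-1 <= e / (8 * C).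
  near: k; apply: (inv0 _ (_ : \forall d \near 0^'+, d <= e / (8 * C))).
  by apply: nbhs_right_le; rewrite divr_gt0// mulr_gt0.
have -> : e = 2 * (e / 4 + C * (2 * (e / (8 * C)))) by field; rewrite gt_eqF.
rewrite ler_pM2l// lerD//.
  rewrite /e1 mulrAC ler_pdivrMr ?mulr_gt0//.
  have -> : e / 4 * (4 * (t + 1)) = e * (t + 1) by field.
  by rewrite ler_pM2l// lerDl.
by rewrite ler_pM2l// ler_pM2l.
Unshelve. all: by end_near. Qed.

End approximation_sequence.

(** * Bundles and the game *)

Section game.
Context {R : realType} {X U V : normedVectType R} {P : set U} {Q : set V}
  {x0 : X} {f : R -> X -> U -> V -> X}.
Hypotheses (compactP : compact P) (compactQ : compact Q)
    (f_cont : {within time `*` [set: X] `*` P `*` Q, continuous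
                (fun z : R * X * U * V => f z.1.1.1 z.1.1.2 z.1.2 z.2)})
    (f_lip : forall A : set (R * X), compact A -> A `<=` time `*` [set: X] ->
       exists2 L : R -> R, summable_on time L &
         forall t x1 x2 u v, A (t, x1) -> A (t, x2) -> P u -> Q v ->
           `|f t x1 u v - f t x2 u v| <= L t * `|x1 - x2|)
    (f_growth : exists2 a : R -> R,
       (forall K : set R, compact K -> K `<=` time -> summable_on K a) &
         forall t x u v, time t -> P u -> Q v ->
           `|f t x u v| <= a t * (1 + `|x|)).

Implicit Types (nu : {measure set (borel (R * V)%type) -> \bar R})
  (eta : {measure set (borel (R * U * V)%type) -> \bar R}).

Let traj eta x := trajectory f x0 P Q eta x.

Definition bundle nu : set (R -> X) := [set x | exists2 eta, Pi_compat P Q nu eta & traj eta x].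

Let bundle_control nu eta : Pi_Q Q nu -> Pi_compat P Q nu eta -> control P Q eta.
Proof. by move=> nuP /Pi_compat_compatible etaP; exists nu. Qed.

Lemma bundle_limit nu (F : set_system nat) (UF : UltraFilter F) x_ :
  Pi_Q Q nu -> (forall n, bundle nu (x_ n)) ->
  exists2 x, bundle nu x &
    forall T e, 0 < e -> \forall n \near F, forall t, 0 <= t <= T -> `|x_ n t - x t| <= e.
Proof.
move=> nuP x_P; have /choice[eta_ eta_P] : forall n, exists eta, Pi_compat P Q nu eta /\ traj eta (x_ n).
  by move=> n; have [eta ? ?] := x_P n; exists eta.
have eta_C n : compatible P Q nu (eta_ n) by apply: Pi_compat_compatible; have [] := eta_P n.
have [eta etaP eta_cvg] := Pi_compat_limit compactP compactQ UF nuP eta_C.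
have eta_ctrl n : control P Q (eta_ n) by exists nu.
have eta_traj n : traj (eta_ n) (x_ n) by have [] := eta_P n.
have [x xP xcvg] := trajectory_cvg compactP compactQ f_cont f_growth UF eta_ctrl eta_cvg eta_traj.
by exists x => //; exists eta.
Qed.

(** Points (t_n, x_n t_n) which converge have x_n converging uniformly to a path x
    of the bundle, and x is continuous. *)
Lemma bundle_graph_closed nu : Pi_Q Q nu ->
  closed [set p : R * X | time p.1 /\ exists2 x, bundle nu x & p.2 = x p.1].
Proof.
move=> nuP [s z] clp.
have : forall n, exists q : R * (R -> X), [/\ 0 <= q.1, bundle nu q.2,
    `|s - q.1| < n.+1%:R^-1 & `|z - q.2 q.1| < n.+1%:R^-1].
  move=> n; have n0 : 0 < n.+1%:R^-1 :> R by rewrite invr_gt0.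
  have [[t y] [[/= t0 [x xP yx]]]] := clp _ (nbhsx_ballx (s, z) _ n0).
  by rewrite -ball_normE/= prod_normE/= gt_max => /andP[h1 h2]; exists (t, x); rewrite /= -yx.
move=> /choice[q qP]; have [F [UF ooF]] := ultraFilterLemma (_ : ProperFilter \oo).
have xP n : bundle nu (q n).2 by have [] := qP n.
have [x xb xcvg] := bundle_limit UF nuP xP.
have inv_small (e : R) : 0 < e -> \forall n \near F, n.+1%:R^-1 < e.
  move=> e0; apply: ooF; exact: near_infty_natSinv_lt (PosNum e0).
have s0 : 0 <= s.
  apply/ler_addgt0Pr => e e0; have [n ne] := @filter_ex _ _ _ _ (inv_small e e0).
  have [q0 _ pq _] := qP n; move: (lt_trans pq ne); rewrite ltr_norml => /andP[h1 h2]; lra.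
split => //; exists x => //; apply/eqP; rewrite -subr_eq0 -normr_le0.
apply/ler_addgt0Pr => e e0; rewrite add0r.
have e30 : 0 < e / 3 by rewrite divr_gt0.
have [_ _ [/subspace_continuousP cx _]] := xb.
have /cvgrPdist_lt/(_ _ e30)/nbhs_ballP[r /= r0 xr] := cx _ s0.
have [n [ne nr n1 nx]] : exists n, [/\ n.+1%:R^-1 < e / 3, n.+1%:R^-1 < r, n.+1%:R^-1 < 1 :> R &
    forall t, 0 <= t <= s + 1 -> `|(q n).2 t - x t| <= e / 3].
  apply: (@filter_ex _ F); near=> n; split; near: n.
  - exact: inv_small.
  - exact: inv_small.
  - exact: inv_small.
  - exact: xcvg.
have [q0 _ pq pxq] := qP n.
have h1 : `|x s - x (q n).1| < e / 3 by apply: xr; rewrite // -ball_normE/= (lt_trans pq).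
have h2 : `|(q n).2 (q n).1 - x (q n).1| <= e / 3.
  by apply: nx; rewrite q0/=; move: (lt_trans pq n1); rewrite ltr_norml => /andP[h3 h4]; lra.
have h3 := lt_trans pxq ne.
have -> : z - x s = (z - (q n).2 (q n).1) + ((q n).2 (q n).1 - x (q n).1) - (x s - x (q n).1).
  by rewrite opprB !subrKA.
have := ler_normB (z - (q n).2 (q n).1 + ((q n).2 (q n).1 - x (q n).1)) (x s - x (q n).1).
have := ler_normD (z - (q n).2 (q n).1) ((q n).2 (q n).1 - x (q n).1).
lra.
Unshelve. all: by end_near. Qed.

Lemma trajectory_cvg_at (F : set_system nat) (UF : UltraFilter F)
    (eta_ : nat -> {measure set (borel (R * U * V)%type) -> \bar R}) eta
    (x_ : nat -> R -> X) (x : R -> X) (t e : R) :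
  (forall n, control P Q (eta_ n)) -> control P Q eta -> weak_cvg P Q F eta_ eta ->
  (forall n, traj (eta_ n) (x_ n)) -> traj eta x -> 0 <= t -> 0 < e ->
  \forall n \near F, `|x_ n t - x t| <= e.
Proof.
move=> eta_C etaC eta_cvg x_P xP t0 e0.
have [y yP ycvg] := trajectory_cvg compactP compactQ f_cont f_growth UF eta_C eta_cvg x_P.
rewrite (trajectory_unique compactP compactQ f_cont f_lip f_growth etaC xP yP t0).
by apply: filterS (ycvg t e e0) => n; apply; rewrite t0 lexx.
Qed.

(** Two successive approximations: at time t, a path x of the bundle of nu is
    close to the trajectory of nu for some weights a_ k, and for this k the latter
    is the limit of the trajectories of the nu_ n for the same weights. *)
Lemma bundle_lower_limit (F : set_system nat) (UF : UltraFilter F)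
    (nu_ : nat -> {measure set (borel (R * V)%type) -> \bar R}) nu (x : R -> X) (t e : R) :
  \oo `<=` F ->
  (forall n, Pi_Q Q (nu_ n)) -> Pi_Q Q nu ->
  (forall (t : R) g, 0 <= t -> {within `[0, t]%classic `*` Q, continuous g} ->
    \int[nu_ n]_(z in `[0, t]%classic `*` Q) g z @[n --> F] -->
    \int[nu]_(z in `[0, t]%classic `*` Q) (g z : R)) ->
  bundle nu x -> 0 <= t -> 0 < e ->
  \forall n \near F, exists2 y, bundle (nu_ n) y & `|y t - x t| <= e.
Proof.
move=> ooF nu_P nuP nu_cvg [eta etaP xP] t0 e0.
have [a_ a_P a_cvg] := weights_dense compactP compactQ nuP (Pi_compat_compatible etaP).
have exists_traj nu' eta' : Pi_Q Q nu' -> Pi_compat P Q nu' eta' -> exists y, traj eta' y.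
  move=> nuP' etaP'.
  exact: (trajectory_exists compactP compactQ f_cont f_lip f_growth (bundle_control nuP' etaP')).
have e20 : 0 < e / 2 by rewrite divr_gt0.
have : forall k, exists q : {measure set (borel (R * U * V)%type) -> \bar R} * (R -> X),
    [/\ Pi_compat P Q nu q.1, traj q.1 q.2 &
    forall (t : R) (g : R * U * V -> R), 0 <= t ->
    {within `[0, t]%classic `*` P `*` Q, continuous g} ->
    \int[q.1]_(z in `[0, t]%classic `*` P `*` Q) g z =
    \int[nu]_(z in `[0, t]%classic `*` Q) average (a_ k) g z].
  move=> k; have [eta' etaP' etaE] := average_control compactP compactQ (a_P k) nuP.
  by have [y yP] := exists_traj _ _ nuP etaP'; exists (eta', y).
move=> /choice[q qP].
have q_cvg : weak_cvg P Q F (fun k => (q k).1) eta.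
  move=> s g s0 cg.
  under eq_fun => k do have [_ _ ->//] := qP k.
  by move=> B /(a_cvg s g s0 cg); exact: ooF.
have q_C k : control P Q (q k).1 by have [etaP' _ _] := qP k; exact: bundle_control etaP'.
have q_traj k : traj (q k).1 (q k).2 by have [] := qP k.
have [k xk] := @filter_ex _ _ _ _
  (trajectory_cvg_at UF q_C (bundle_control nuP etaP) q_cvg q_traj xP t0 e20).
have : forall n, exists r : {measure set (borel (R * U * V)%type) -> \bar R} * (R -> X),
    [/\ Pi_compat P Q (nu_ n) r.1, traj r.1 r.2 &
    forall (t : R) (g : R * U * V -> R), 0 <= t ->
    {within `[0, t]%classic `*` P `*` Q, continuous g} ->
    \int[r.1]_(z in `[0, t]%classic `*` P `*` Q) g z =
    \int[nu_ n]_(z in `[0, t]%classic `*` Q) average (a_ k) g z].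
  move=> n; have [eta' etaP' etaE] := average_control compactP compactQ (a_P k) (nu_P n).
  by have [y yP] := exists_traj _ _ (nu_P n) etaP'; exists (eta', y).
move=> /choice[r rP].
have r_cvg : weak_cvg P Q F (fun n => (r n).1) (q k).1.
  move=> s g s0 cg; have [_ _ ->//] := qP k.
  under eq_fun => n do have [_ _ ->//] := rP n.
  exact: (nu_cvg s _ s0 (average_continuous (a_P k) cg)).
have r_C n : control P Q (r n).1 by have [etaP' _ _] := rP n; exact: bundle_control etaP'.
have r_traj n : traj (r n).1 (r n).2 by have [] := rP n.
have := trajectory_cvg_at UF r_C (q_C k) r_cvg r_traj (q_traj k) t0 e20.
apply: filterS => n xn; exists (r n).2; first by have [? ? _] := rP n; exists (r n).1.
by rewrite (splitr e) (le_trans (ler_distD ((q k).2 t) _ _))// lerD.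
Qed.

Lemma hitting_time_le (N : set (R * X)) x t : time t -> N (t, x t) -> (hitting_time N x <= t%:E)%E.
Proof. by move=> t0 Nt; apply: ereal_inf_lbound; left; exists t. Qed.

Lemma hitting_time_pinfty (N : set (R * X)) x :
  (forall t, time t -> ~ N (t, x t)) -> hitting_time N x = +oo%E.
Proof.
move=> xN; rewrite /hitting_time (_ : _ `|` _ = [set +oo%E]) ?ereal_inf1//.
by apply/setUidPr => _ [t [t0 Nt] <-]; case: (xN t t0).
Qed.

Variable M : set (R * X).
Hypotheses (closedM : closed M) (subM : M `<=` time `*` [set: X]).

Lemma precise_rough : precise (bundles f x0 P Q) M -> rough (bundles f x0 P Q) M.
Proof.
move=> [_ [nu nuP <-] nuM].
pose K := [set p : R * X | time p.1 /\ exists2 x, bundle nu x & p.2 = x p.1].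
have KM : M `<=` ~` K by move=> [t z] Mtz [/= t0 [x /nuM/(_ t t0) + zE]]; apply; rewrite -zE.
have [B MB BK] : exists2 B, set_nbhs M B & closure B `<=` ~` K.
  have := @pseudometric_normal R (R * X)%type M closedM (~` K).
  move=> /(_ _)[|B MB BK]; last by exists B.
  apply/set_nbhsP; exists (~` K); split => //.
  by rewrite openC; exact: bundle_graph_closed.
have closed_strip : closed ((time : set R) `*` [set: X]).
  rewrite setXT; apply: closed_comp; last exact: closed_time.
  by move=> z _; exact: cvg_fst.
exists (closure B `&` ((time : set R) `*` [set: X])); split.
- by apply: closedI => //; exact: closed_closure.
- by move=> p [].
- move=> p Mp; have Tp := subM Mp.
  rewrite /interior /= [nbhs _]/nbhs/= -(nbhs_subspace_in Tp).
  have : nbhs p B by exact: MB.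
  by apply: filterS => q Bq ?; split => //; exact: subset_closure.
apply/eqP; rewrite -leye_eq.
apply: (@le_trans _ _ (ereal_inf [set hitting_time (closure B `&` (time `*` setT)) x | x in bundle nu])).
  apply: le_ereal_inf_tmp => _ [x xP <-]; rewrite hitting_time_pinfty// => t t0 [Bx _].
  by apply: (BK _ Bx); split => //; exists x.
by apply: ereal_sup_ubound; exists (bundle nu) => //; exists nu.
Qed.

Lemma rough_precise : rough (bundles f x0 P Q) M -> precise (bundles f x0 P Q) M.
Proof.
move=> [Mt [_ _ MMt gMt]].
have : forall n : nat, exists nu, Pi_Q Q nu /\
    forall x, bundle nu x -> (n%:R%:E < hitting_time Mt x)%E.
  move=> n; have : (n%:R%:E < game_value (bundles f x0 P Q) Mt)%E by rewrite gMt ltry.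
  move=> /ereal_sup_gt[_ [_ [nu nuP <-] <-] nn]; exists nu; split => // x xP.
  by apply: (lt_le_trans nn); apply: ereal_inf_lbound; exists x.
move=> /choice[nu_ nu_P].
have [F [UF ooF]] := ultraFilterLemma (_ : ProperFilter \oo).
have nu_Q n : Pi_Q Q (nu_ n) by have [] := nu_P n.
have [nu nuP nu_cvg] := Pi_Q_limit compactQ UF nu_Q.
exists (bundle nu); first by exists nu.
move=> x xP t t0 Mt_x.
have Tx := subM Mt_x; have := MMt _ Mt_x.
rewrite /interior /= [nbhs _]/nbhs/= -(nbhs_subspace_in Tx).
move=> /nbhs_ballP[r /= r0 rMt].
have r20 : 0 < r / 2 by rewrite divr_gt0.
have [n [tn [y yP yx]]] : exists n, t <= n%:R /\ exists2 y, bundle (nu_ n) y & `|y t - x t| <= r / 2.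
  apply: (@filter_ex _ F); near=> n; split; near: n.
    by apply: ooF; exact: nbhs_infty_ger.
  exact: (bundle_lower_limit UF ooF nu_Q nuP nu_cvg xP t0 r20).
have [_ /(_ y yP)] := nu_P n; rewrite ltNge => /negP; apply.
rewrite (le_trans (hitting_time_le t0 _)) ?lee_fin//.
apply: rMt; last by split.
rewrite -ball_normE/= prod_normE gt_max/= subrr normr0 r0/= distrC.
by rewrite (le_lt_trans yx)// ltr_pdivrMr// ltr_pMr// ltr1n.
Unshelve. all: by end_near. Qed.

End game.

Unset Implicit Arguments.

Theorem mainTheorem5 (R : realType) (X U V : normedVectType R)
    (P : set U) (Q : set V) (x0 : X) (f : R -> X -> U -> V -> X)
    (M : set (R * X))
    (compactP : compact P) (compactQ : compact Q)
    (f_cont : {within time `*` [set: X] `*` P `*` Q, continuous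
                (fun z : R * X * U * V => f z.1.1.1 z.1.1.2 z.1.2 z.2)})
    (f_lip : forall A : set (R * X), compact A -> A `<=` time `*` [set: X] ->
       exists2 L : R -> R, summable_on time L &
         forall t x1 x2 u v, A (t, x1) -> A (t, x2) -> P u -> Q v ->
           `|f t x1 u v - f t x2 u v| <= L t * `|x1 - x2|)
    (f_growth : exists2 a : R -> R,
       (forall K : set R, compact K -> K `<=` time -> summable_on K a) &
         forall t x u v, time t -> P u -> Q v ->
           `|f t x u v| <= a t * (1 + `|x|))
    (closedM : closed M) (subM : M `<=` time `*` [set: X]) :
  precise (bundles f x0 P Q) M <-> rough (bundles f x0 P Q) M.
Proof.
split.
  exact: (precise_rough compactP compactQ f_cont f_growth closedM subM).
exact: (rough_precise compactP compactQ f_cont f_lip f_growth subM).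
Qed.
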